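(* Let $\mu\in\mathbb R$ and $0<s<t$. For $y>0$, $$ P\Big\{B^\mu(s)\in\mathrm dy\ \Big|\ \inf_{0<z<t}B^\mu(z)>0,\ B^\mu(0)=B^\mu(t)=0\Big\}=\sqrt{\frac2\pi}\,y^2\left(\frac{t}{s(t-s)}\right)^{3/2}e^{-\frac{y^2t}{2s(t-s)}}\,\mathrm dy $$ $$ =P\Big\{B(s)\in\mathrm dy\ \Big|\ \inf_{0<z<t}B(z)>0,\ B(0)=B(t)=0\Big\}. $$
   Context: $B$ is a standard one-dimensional Brownian motion and $B^\mu(t)=B(t)+\mu t$ is Brownian motion with drift $\mu$. For $u,c>0$, the conditional law given $\{\min_{0\le z\le t}B^\mu(z)>0,\ B^\mu(0)=u,\ B^\mu(t)=c\}$ is the law of the bridge of $B^\mu$ from $u$ at time $0$ to $c$ at time $t$, conditioned on the positive-probability event that it stays strictly positive on $[0,t]$. The conditional law given $\{\inf_{0<z<t}B^\mu(z)>0,\ B^\mu(0)=B^\mu(t)=0\}$ (drifted Brownian excursion) is defined as the limit of these laws as $u,c\downarrow0$; in particular its one-dimensional density at $s$ is the limit of the corresponding densities. The case $\mu=0$ gives the law on the last line. *)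

(* Defs.v *)
From HB Require Import structures.
From mathcomp Require Import all_boot all_order all_algebra.
From mathcomp Require Import all_classical all_reals all_analysis.
From mathcomp Require Import measurable_realfun.

Set Implicit Arguments.
Unset Strict Implicit.
Unset Printing Implicit Defensive.

Import Order.TTheory GRing.Theory Num.Theory.
Import numFieldTopology.Exports numFieldNormedType.Exports.

Local Open Scope classical_set_scope.
Local Open Scope ring_scope.

(* Processes are families X : R -> {RV P >-> R}, of which only the times z >= 0
   are meant. The second parameter of normal_prob is the standard deviation. *)
Definition standard_brownian_motion (R : realType) (d : measure_display)
    (T : measurableType d) (P : probability T R) (B : R -> {RV P >-> R}) : Prop :=
  [/\ {ae P, forall o, B 0 o = 0},
      (forall a b : R, 0 <= a -> a < b ->
        forall E : set R, measurable E ->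
          P [set o | E (B b o - B a o)] = normal_prob 0 (Num.sqrt (b - a)) E),
      (forall (n : nat) (z : nat -> R), 0 <= z 0%N ->
        {homo z : i j / (i <= j)%N >-> i <= j} ->
        forall E : 'I_n -> set R, (forall i, measurable (E i)) ->
          P [set o | forall i : 'I_n, E i (B (z i.+1) o - B (z i) o)] =
          (\prod_(i < n) P [set o | E i (B (z i.+1) o - B (z i) o)%R])%E) &
      {ae P, forall o, {within `[0, +oo[, continuous (fun z => B z o)}}].

Definition drifted (R : realType) (d : measure_display) (T : measurableType d)
    (P : probability T R) (B : R -> {RV P >-> R}) (mu : R) : R -> {RV P >-> R} :=
  fun z => (B z : {mfun T >-> R}) + (cst (mu * z) : {mfun T >-> R}).

Definition started_at (R : realType) (d : measure_display)
    (T : measurableType d) (P : probability T R) (u : R)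
    (X : R -> {RV P >-> R}) : R -> {RV P >-> R} :=
  fun z => (cst u : {mfun T >-> R}) + (X z : {mfun T >-> R}).

(* The space C([0, t]) with the sigma-algebra generated by the evaluations at
   the times of [0, t]. Values outside [0, t] are junk that no measurable set
   sees. *)
Record cpath (R : realType) (t : R) := CPath {
  cpath_fun :> R -> R ;
  cpath_cont : {within `[0, t], continuous cpath_fun} }.

Lemma cpath0_cont (R : realType) (t : R) :
  {within `[0, t], continuous (cst 0 : R -> R)}.
Proof. by apply: continuous_subspaceT => x; exact: cvg_cst. Qed.

HB.instance Definition _ (R : realType) (t : R) := gen_eqMixin (cpath t).
HB.instance Definition _ (R : realType) (t : R) := gen_choiceMixin (cpath t).
HB.instance Definition _ (R : realType) (t : R) :=
  isPointed.Build (cpath t) (CPath (@cpath0_cont R t)).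

Definition evaluation_sets (R : realType) (t : R) : set (set (cpath t)) :=
  [set A | exists z : R, 0 <= z <= t /\
           exists E : set R, measurable E /\ A = [set w : cpath t | E (w z)]].

Arguments evaluation_sets {R} t _.

Notation path_space t := (g_sigma_algebraType (evaluation_sets t)).

(* Q c is the law on C([0, t]) of X conditioned on X(t) = c: Q is a regular
   conditional distribution of (X(z))_{0 <= z <= t} given X(t). That alone only
   determines Q c for almost every c; the second clause (continuity in c of the
   finite-dimensional distributions) selects the version which is meaningful at
   every endpoint c. *)
Definition bridge_law (R : realType) (d : measure_display)
    (T : measurableType d) (P : probability T R) (X : R -> {RV P >-> R}) (t : R)
    (Q : R.-pker R ~> path_space t) : Prop :=
  (forall (n : nat) (z : 'I_n -> R), (forall i, 0 <= z i <= t) ->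
    forall (E : 'I_n -> set R) (C : set R),
      (forall i, measurable (E i)) -> measurable C ->
      P [set o | C (X t o) /\ forall i, E i (X (z i) o)] =
      (\int[distribution P (X t)]_(c in C)
         Q c [set w | forall i, E i (w (z i))])%E) /\
  (forall (n : nat) (z : 'I_n -> R), (forall i, 0 <= z i <= t) ->
    forall g : 'rV[R]_n -> R, continuous g ->
      (exists M : R, forall x, `|g x| <= M) ->
      continuous (fun c : R => \int[Q c]_w g (\row_i (w (z i))))).

Definition positive_paths (R : realType) (t : R) : set (path_space t) :=
  [set w | forall z : R, 0 <= z <= t -> 0 < w z].
Arguments positive_paths {R} t _.

(* Elementary conditioning of a law m on C([0, t]) on the event that the path
   stays positive, evaluated at an event and at a functional. *)
Definition prob_given_positive (R : realType) (t : R)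
    (m : {measure set (path_space t) -> \bar R}) (A : set (path_space t)) : R :=
  fine (m (A `&` positive_paths t)) / fine (m (positive_paths t)).

Definition mean_given_positive (R : realType) (t : R)
    (m : {measure set (path_space t) -> \bar R}) (F : path_space t -> R) : R :=
  (\int[m]_(w in positive_paths t) F w) / fine (m (positive_paths t)).

(* f is the density of w(s) under m conditioned on positivity, in its
   continuous version on (0, +oo); by continuity it is unique there. *)
Definition density_given_positive (R : realType) (t : R)
    (m : {measure set (path_space t) -> \bar R}) (s : R) (f : R -> R) : Prop :=
  [/\ forall y : R, 0 < y -> 0 <= f y,
      forall y : R, 0 < y -> {for y, continuous f} &
      forall E : set R, measurable E ->
        (prob_given_positive m [set w | E (w s)])%:E =
        (\int[lebesgue_measure]_(y in E `&` `]0%R, +oo[) (f y)%:E)%E].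

(* q is the density on (0, +oo) at time s of the process X (with X(0) = 0)
   conditioned on inf_{0 < z < t} X(z) > 0 and X(0) = X(t) = 0, i.e. of the
   limit as u, c -> 0+ of the bridges from u to c conditioned to stay positive:
   these conditioned laws make sense and have continuous densities at s, which
   converge pointwise to q, and their marginals at s converge weakly to
   q(y) dy. Bridge laws and densities are unique, so that
   existence together with universal quantification only records that the
   notion is well defined. *)
Definition excursion_density (R : realType) (d : measure_display)
    (T : measurableType d) (P : probability T R) (X : R -> {RV P >-> R})
    (t s : R) (q : R -> R) : Prop :=
  (exists Q : R -> R.-pker R ~> path_space t,
     forall u, 0 < u -> bridge_law (started_at u X) (Q u)) /\
  forall Q : R -> R.-pker R ~> path_space t,
    (forall u, 0 < u -> bridge_law (started_at u X) (Q u)) ->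
    [/\ (forall u c, 0 < u -> 0 < c -> (0 < Q u c (positive_paths t))%E),
        (exists f : R -> R -> R -> R, forall u c, 0 < u -> 0 < c ->
           density_given_positive (Q u c) s (f u c)),
        (forall f : R -> R -> R -> R,
           (forall u c, 0 < u -> 0 < c ->
              density_given_positive (Q u c) s (f u c)) ->
           forall y : R, 0 < y ->
             f uc.1 uc.2 y @[uc --> (0^'+, 0^'+)] --> q y) &
        (forall g : R -> R, continuous g ->
           (exists M : R, forall x, `|g x| <= M) ->
           mean_given_positive (Q uc.1 uc.2) (fun w => g (w s))
             @[uc --> (0^'+, 0^'+)] -->
           \int[lebesgue_measure]_(y in `]0, +oo[) (g y * q y))].

(* Main.v *)
Require Import Defs.
From HB Require Import structures.
From mathcomp Require Import all_boot all_order all_algebra.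
From mathcomp Require Import all_classical all_reals all_analysis.
From mathcomp Require Import measurable_realfun.
From mathcomp Require Import ring lra.
Import Order.TTheory GRing.Theory Num.Theory.
Import numFieldTopology.Exports numFieldNormedType.Exports.

Local Open Scope classical_set_scope.
Local Open Scope ring_scope.
Set Implicit Arguments.
Unset Strict Implicit.
Unset Printing Implicit Defensive.

(** Write V for the driftless motion started at u, and X for the motion with
drift mu started at u. On [0, t],
  X z = u + (z / t) (X t - u) + (Y z - (z / t) Y t),
where Y is the driftless motion started at 0: the drift only shows in the
endpoint of the interpolating chord. The bridge Y z - (z / t) Y t is
independent of Y t ([bridge_indep]), so that tilting it by the chord from u to c
gives a version of the law of X given X t = c ([disintegration],
[bridge_pker_law]). This version is weakly continuous in c, and a weakly
continuous version is unique at every c because the law of X t charges every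
interval ([bridge_law_unique]). It does not mention mu, hence the drifted and
the driftless excursions agree, and the computation below is that of the
driftless case.

The heart of that computation is the reflection principle
([reflection_principle]): an odd function of V a has the same mean on the event
that V stays positive on [r, a] as on the event that V r is positive. Using it
on [s, t] and then on [0, s] gives the law of (V s, V t) on the event that V is
positive on [0, t] ([killed_law], [killed_mass]): its density at (y, c) is
k_s(u, y) k_(t-s)(y, c), where k_v is the transition density [killed_gauss] of
Brownian motion killed at 0. Disintegration turns this into an identity for the
bridges, valid for almost every endpoint c. It holds for every c > 0 since both
sides are regular in c: raising c raises the tilted bridge, which makes the
probabilities at stake monotone, and the densities are continuous
([monotone_density], [bridge_positive_law]). The bridge conditioned to stay
positive therefore has density k_s(u, y) k_(t-s)(y, c) / k_t(u, c) at time s.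

Each k_v(x, y) is a Gaussian factor times sinh (x y / v), and
1 <= sinh x / x <= exp x for x > 0. So the density is q(y) times a ratio which
lies between a quantity tending to 1 uniformly in y and
exp (y (u / s + c / (t - s))) ([killed_bridge_pdfE], [killed_bridge_pdf_ge],
[killed_bridge_pdf_le]). This gives the pointwise limit, and the weak limit as
well because y exp y is integrable against q. *)

(** * Independence from generating families *)

Definition cylinder (T I R : Type) (Z : I -> T -> R) (n : nat) (z : nat -> I)
    (E : nat -> set R) : set T :=
  [set o | forall i, (i < n)%N -> E i (Z (z i) o)].

Definition coordinate_events (R : realType) (T I : Type) (Z : I -> T -> R)
    (D : set I) : set (set T) :=
  [set A | exists i, D i /\ exists E : set R, measurable E /\ A = Z i @^-1` E].

Lemma cylinderI (T I R : Type) (Z : I -> T -> R) n m z z' (E E' : nat -> set R) :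
  cylinder Z n z E `&` cylinder Z m z' E' =
  cylinder Z (n + m) (fun i => if (i < n)%N then z i else z' (i - n)%N)
    (fun i => if (i < n)%N then E i else E' (i - n)%N).
Proof.
apply/seteqP; split=> o /=.
  move=> [H1 H2] i im; case: ifPn => [|]; first exact: H1.
  by rewrite -leqNgt => ni; apply: H2; rewrite ltn_subLR.
move=> H; split=> i ii.
  by have := H i; rewrite ii; apply; rewrite ltn_addr.
have nn : (n + i < n)%N = false by rewrite ltnNge leq_addr.
by have := H (n + i)%N; rewrite ltn_add2l nn addKn; exact.
Qed.

Lemma cylinder_bigcap (T I R : Type) (Z : I -> T -> R) n z E :
  cylinder Z n z E = \big[setI/setT]_(i < n) (Z (z i) @^-1` E i).
Proof.
elim: n => [|n IH]; first by rewrite big_ord0; apply/seteqP; split.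
rewrite big_ord_recr /= -IH; apply/seteqP; split=> o /=.
  move=> H; split=> [i ii|]; last exact: H.
  by apply: H; rewrite ltnS ltnW.
by move=> [H1 H2] i; rewrite ltnS leq_eqVlt => /orP[/eqP->//|]; exact: H1.
Qed.

Lemma cylinder_sigma (R : realType) (T I : Type) (Z : I -> T -> R) (D : set I)
    (H : set (set T)) n z E :
  sigma_algebra setT H ->
  (forall i E, D i -> measurable E -> H (Z i @^-1` E)) ->
  (forall i, (i < n)%N -> D (z i)) -> (forall i, measurable (E i : set R)) ->
  H (cylinder Z n z E).
Proof.
move=> sH HZ Dz mE; rewrite cylinder_bigcap.
have HT : H setT by rewrite -setC0 -setTD; case: sH => H0 HC _; exact: HC.
have HI A B : H A -> H B -> H (A `&` B).
  move=> HA HB; rewrite -[A `&` B]setCK setCI -bigcup2E.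
  case: sH => H0 HC HU; rewrite -setTD; apply: (HC); apply: HU => -[|[|k]] /=;
    rewrite ?[bigcup2 _ _ _]/= //.
  - by rewrite /bigcup2 /= -setTD; exact: HC.
  - by rewrite /bigcup2 /= -setTD; exact: HC.
by apply: big_ind => //; move=> [i ii] _ /=; apply: HZ => //; exact: Dz.
Qed.

Lemma coordinate_event (R : realType) (T I : Type) (Z : I -> T -> R) (D : set I)
    i (E : set R) : D i -> measurable E ->
  <<s coordinate_events Z D >> (Z i @^-1` E).
Proof. by move=> Di mE; apply: sub_sigma_algebra; exists i; split => //; exists E. Qed.

Lemma coordinate_events_cylinder (R : realType) (T I : Type) (Z : I -> T -> R)
    (D : set I) n z (E : nat -> set R) :
  (forall i, (i < n)%N -> D (z i)) -> (forall i, measurable (E i)) ->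
  <<s coordinate_events Z D >> (cylinder Z n z E).
Proof.
move=> Dz mE; apply: (@cylinder_sigma _ _ _ Z D) => //.
by move=> i E0 Di mE0; exact: coordinate_event.
Qed.

Lemma coordinate_events_sub (R : realType) d (T : measurableType d) (I : Type)
    (Z : I -> T -> R) (D : set I) A :
  (forall i, D i -> measurable_fun setT (Z i)) ->
  <<s coordinate_events Z D >> A -> measurable A.
Proof.
move=> mZ; apply: smallest_sub; first exact: sigma_algebra_measurable.
by move=> _ [i [Di [E [mE ->]]]]; rewrite -[_ @^-1` _]setTI; exact: mZ.
Qed.

(** Cylinders over a generating class of Borel sets form a pi-system. The class is
a parameter because the uniqueness of bridge laws only controls rays. *)
Lemma measure_eq_cylinders_gen (R : realType) d (T : measurableType d) (I : Type)
    (Z : I -> T -> R) (D : set I) (B : set (set R))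
    (m1 m2 : {measure set T -> \bar R}) :
  D !=set0 -> B !=set0 -> (forall E : set R, measurable E <-> <<s B >> E) ->
  (forall i, D i -> measurable_fun setT (Z i)) ->
  (m1 setT < +oo)%E ->
  (forall n z E, (forall i, (i < n)%N -> D (z i)) -> (forall i, B (E i)) ->
     m1 (cylinder Z n z E) = m2 (cylinder Z n z E)) ->
  forall A, <<s coordinate_events Z D >> A -> m1 A = m2 A.
Proof.
move=> [i0 Di0] [b0 Bb0] BE mZ m1oo m12 A sA.
have mB E : B E -> measurable E.
  by move=> BEE; apply/BE; exact: sub_sigma_algebra.
pose G := [set A | exists n z (E : nat -> set R),
  [/\ forall i, (i < n)%N -> D (z i), forall i, B (E i) &
      A = cylinder Z n z E]].
have sub : <<s coordinate_events Z D >> `<=` <<s G >>.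
  apply: smallest_sub; first exact: smallest_sigma_algebra.
  move=> _ [i [Di [E [/BE mE ->]]]].
  suff : <<s B >> `<=` [set E | <<s G >> (Z i @^-1` E)] by exact.
  apply: smallest_sub.
    split=> [|C HC|F HF] /=.
    - by rewrite preimage_set0; exact: sigma_algebra0.
    - by rewrite setTD preimage_setC -setTD; exact: sigma_algebraCD.
    - by rewrite preimage_bigcup; exact: sigma_algebra_bigcup.
  move=> C BC; apply: sub_sigma_algebra.
  exists 1%N, (fun=> i), (fun=> C); split => //.
  by apply/seteqP; split=> o /= => [H j _ //|H]; exact: (H 0%N).
apply: (g_sigma_algebra_measure_unique G _ (fun=> setT)) => //.
- move=> _ [n [z [E [Dz mE ->]]]]; apply: (@coordinate_events_sub _ _ _ _ Z D) => //.
  by apply: coordinate_events_cylinder => // i; exact: mB.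
- move=> i; exists 0%N, (fun=> i0), (fun=> b0); split => //.
  by apply/seteqP; split.
- by apply/seteqP; split=> // x _; exists 0%N.
- move=> _ _ [n [z [E [Dz mE ->]]]] [n' [z' [E' [Dz' mE' ->]]]].
  rewrite cylinderI; do 3 eexists; split; last by reflexivity.
  + move=> i /=; case: ifPn => [/Dz//|]; rewrite -leqNgt => ni im.
    by apply: Dz'; rewrite ltn_subLR.
  + by move=> i /=; case: ifP.
- by move=> _ [n [z [E [Dz mE ->]]]]; exact: m12.
- exact: sub.
Qed.

Lemma measure_eq_cylinders (R : realType) d (T : measurableType d) (I : Type)
    (Z : I -> T -> R) (D : set I) (m1 m2 : {measure set T -> \bar R}) :
  D !=set0 -> (forall i, D i -> measurable_fun setT (Z i)) ->
  (m1 setT < +oo)%E ->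
  (forall n z E, (forall i, (i < n)%N -> D (z i)) ->
     (forall i, measurable (E i)) ->
     m1 (cylinder Z n z E) = m2 (cylinder Z n z E)) ->
  forall A, <<s coordinate_events Z D >> A -> m1 A = m2 A.
Proof.
move=> D0; apply: (@measure_eq_cylinders_gen _ _ _ _ _ _ (@measurable _ R)) => //.
  by exists set0.
move=> E; split=> [mE|]; first exact: sub_sigma_algebra.
by apply: smallest_sub => //; exact: sigma_algebra_measurable.
Qed.

Definition indep_events (R : realType) d (T : measurableType d)
    (P : probability T R) (A F : set T) := P (A `&` F) = (P A * P F)%E.

(** Both A |-> P (A `&` F) and A |-> P A * P F are finite measures, so comparing
them on cylinders is enough. *)
Lemma indep_coordinates (R : realType) d (T : measurableType d)
    (P : probability T R) (I : Type) (Z : I -> T -> R) (D : set I) (F : set T) :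
  D !=set0 ->
  (forall i, D i -> measurable_fun setT (Z i)) ->
  measurable F ->
  (forall n z E, (forall i, (i < n)%N -> D (z i)) ->
     (forall i, measurable (E i)) ->
     indep_events P (cylinder Z n z E) F) ->
  forall A, <<s coordinate_events Z D >> A -> indep_events P A F.
Proof.
move=> D0 mZ mF cF A sA.
have PF0 : 0 <= fine (P F) by apply: fine_ge0.
have PFE : P F = (fine (P F))%:E by rewrite fineK // fin_num_measure.
have := @measure_eq_cylinders _ _ _ _ Z D (mrestr P mF) (mscale (NngNum PF0) P)
  D0 mZ _ _ A sA.
have msE B : mscale (NngNum PF0) P B = (P B * P F)%E by rewrite [in RHS]PFE muleC.
rewrite /indep_events => mE; rewrite -[LHS]/(mrestr P mF A) mE.
- exact: msE.
- by rewrite /= /mrestr (le_lt_trans (probability_le1 _ _)) ?ltry //; exact: measurableI.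
- by move=> n z E Dz mE'; apply: etrans (cF n z E Dz mE') _; exact/esym/msE.
Qed.

(** A cylinder that uses some indices repeatedly is a cylinder that uses each of
the m indices once, after intersection of the constraints. *)
Lemma indep_finite_family (R : realType) d (T : measurableType d)
    (P : probability T R) (W : nat -> T -> R) (m : nat) (F : set T) :
  (0 < m)%N -> (forall k, (k < m)%N -> measurable_fun setT (W k)) ->
  measurable F ->
  (forall E : nat -> set R, (forall i, measurable (E i)) ->
     indep_events P (cylinder W m id E) F) ->
  forall A, <<s coordinate_events W [set k | (k < m)%N] >> A ->
    indep_events P A F.
Proof.
move=> m0 mW mF cF; apply: indep_coordinates => //; first by exists 0%N.
move=> n z E zm mE.
pose E' k := \big[setI/setT]_(i < n) (if z i == k then E i else setT).
have -> : cylinder W n z E = cylinder W m id E'.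
  have E'P k x : E' k x <-> forall i, (i < n)%N -> z i = k -> E i x.
    rewrite /E' -(bigcap_mkord n (fun i => if z i == k then E i else setT)); split.
      by move=> H i ii zi; have := H i ii; rewrite zi eqxx.
    by move=> H i /= ii; case: eqP => // zk; exact: H.
  apply/seteqP; split=> o /= H.
    by move=> k km /=; apply/E'P => i ii zk; rewrite -zk; exact: H.
  by move=> i ii; have /E'P := H _ (zm _ ii); exact.
apply: cF => k; apply: bigsetI_measurable => i _.
by case: ifP.
Qed.

Lemma sigma_preimage (R : realType) (T : pointedType) (G : set (set T))
    (f : T -> R) (E : set R) :
  measurable_fun (setT : set (g_sigma_algebraType G)) f -> measurable E ->
  <<s G >> (f @^-1` E).
Proof. by move=> mf mE; have := mf measurableT E mE; rewrite setTI. Qed.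

Lemma coordinate_measurable (R : realType) (T : pointedType) (I : Type)
    (Z : I -> T -> R) (D : set I) i : D i ->
  measurable_fun (setT : set (g_sigma_algebraType (coordinate_events Z D))) (Z i).
Proof.
move=> Di _ E mE; rewrite setTI.
exact: (@coordinate_event _ _ _ Z D).
Qed.

(** * Brownian motion and the Markov property *)

(** Brownian motion freed from its exceptional null sets: every path starts at 0
and is continuous on the whole line, which makes pathwise arguments hold for
every outcome. *)
Record clean_bm (R : realType) d (T : measurableType d) (P : probability T R)
    (Y : R -> T -> R) : Prop := CleanBM {
  bm_meas : forall z, measurable_fun setT (Y z);
  bm_start : forall o, Y 0 o = 0;
  bm_cont : forall o, continuous (fun z => Y z o);
  bm_law : forall a b : R, 0 <= a -> a < b -> forall E : set R, measurable E ->
    P [set o | E (Y b o - Y a o)] = normal_prob 0 (Num.sqrt (b - a)) E;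
  bm_incr : forall (n : nat) (z : nat -> R), 0 <= z 0%N ->
    {homo z : i j / (i <= j)%N >-> i <= j} ->
    forall E : nat -> set R, (forall i, measurable (E i)) ->
      P (cylinder (fun i o => Y (z i.+1) o - Y (z i) o) n id E) =
      (\prod_(i < n) P [set o | E i (Y (z i.+1) o - Y (z i) o)%R])%E }.

Definition past (R : realType) (T : Type) (Y : R -> T -> R) (r : R) :
  set (set T) := <<s coordinate_events Y [set z | 0 <= z <= r] >>.

(** Puts finitely many times of [0, r] into one nondecreasing sequence from 0 to r,
along which the independence of increments can be used. *)
Lemma sorted_times (R : realType) (r : R) (n : nat) (z : nat -> R) :
  0 <= r -> (forall i, (i < n)%N -> 0 <= z i <= r) ->
  exists m (tau : nat -> R), [/\ (0 < m)%N, tau 0%N = 0,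
    forall k, (m <= k)%N -> tau k = r,
    {homo tau : i j / (i <= j)%N >-> i <= j} &
    forall i, (i < n)%N -> exists2 k, (k <= m)%N & z i = tau k].
Proof.
move=> r0 zr.
pose l0 := 0 :: [seq z i | i <- iota 0 n]; pose l := sort <=%O l0.
have lP x : x \in l -> 0 <= x <= r.
  rewrite mem_sort inE => /orP[/eqP->|/mapP[i]]; first by rewrite lexx.
  by rewrite mem_iota add0n => /andP[_ ii] ->; exact: zr.
have ls : sorted <=%O l by apply: sort_sorted; exact: le_total.
have sl : (0 < size l)%N by rewrite size_sort.
have homo : {homo nth r l : i j / (i <= j)%N >-> i <= j}.
  move=> i j ij; have [js|sj] := ltnP j (size l); last first.
    rewrite [leRHS]nth_default //; have [si|si] := ltnP i (size l).
      by have /andP[] := lP _ (mem_nth r si).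
    by rewrite nth_default.
  by apply: (sorted_leq_nth le_trans le_refl) => //; rewrite inE //; exact: leq_ltn_trans js.
exists (size l), (nth r l); split => //.
- apply/eqP; rewrite eq_le; apply/andP; split; last first.
    by have /andP[] := lP _ (mem_nth r sl).
  have l0l : 0 \in l by rewrite mem_sort inE eqxx.
  by rewrite -[leRHS](nth_index r l0l); exact: homo.
- by move=> k; exact: nth_default.
- move=> i ii; have zl : z i \in l.
    by rewrite mem_sort inE map_f ?orbT // mem_iota.
  by exists (index (z i) l); rewrite ?nth_index // ltnW // index_mem.
Qed.

Section markov.
Context (R : realType) d (T : measurableType d) (P : probability T R).
Context (Y : R -> T -> R) (bm : clean_bm P Y).

Lemma past_measurable r A : past Y r A -> measurable A.
Proof. by apply: coordinate_events_sub => z _; exact: (bm_meas bm). Qed.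

Lemma past_le r b A : r <= b -> past Y r A -> past Y b A.
Proof.
move=> rb; apply: smallest_sub; first exact: smallest_sigma_algebra.
move=> _ [z [/andP[z0 zr] [E [mE ->]]]].
by apply: coordinate_event => //=; rewrite z0 (le_trans zr).
Qed.

(** The values at finitely many times before r are sums of increments before r,
and these are independent of the increment from r to b. *)
Lemma past_indep r b A F : 0 <= r -> r <= b -> measurable F -> past Y r A ->
  indep_events P A [set o | F (Y b o - Y r o)].
Proof.
move=> r0 rb mF pA.
have mD z z' : measurable_fun setT (fun o => Y z o - Y z' o).
  by apply: measurable_funB; exact: (bm_meas bm).
have mDF z z' E : measurable E -> measurable [set o | E (Y z o - Y z' o)].
  by move=> mE; have := mD z z' measurableT E mE; rewrite setTI.
move: A pA; apply: indep_coordinates; first by exists 0 => /=; rewrite lexx.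
- by move=> z _; exact: (bm_meas bm).
- exact: mDF.
move=> n z E zr mE.
have [m [tau [m0 tau0 taur tauh ztau]]] := sorted_times r0 zr.
pose W k o := Y (tau k.+1) o - Y (tau k) o.
have cW : <<s coordinate_events W [set k | (k < m)%N] >> (cylinder Y n z E).
  have Ytau k : (k <= m)%N ->
      measurable_fun (setT : set (g_sigma_algebraType
        (coordinate_events W [set k | (k < m)%N]))) (Y (tau k)).
    elim: k => [_|k IH km].
      rewrite tau0 (_ : Y 0 = cst 0) ?measurable_cst //.
      by apply/funext => o; exact: (bm_start bm).
    rewrite (_ : Y (tau k.+1) = Y (tau k) \+ W k); last first.
      by apply/funext => o; rewrite /W /= addrC subrK.
    apply: measurable_funD; first exact: (IH (ltnW km)).
    exact: (@coordinate_measurable R T nat W [set k | (k < m)%N]).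
  apply: (@cylinder_sigma R T R Y [set x | exists2 k, (k <= m)%N & x = tau k]) => //.
  by move=> _ E0 [k km ->] mE0; apply: sigma_preimage => //; exact: Ytau.
move: cW; apply: indep_finite_family => //; [by move=> k _; exact: mD|exact: mDF|].
move=> E' mE'; rewrite /indep_events.
pose tau' k := if (k <= m)%N then tau k else b.
have tau'h : {homo tau' : i j / (i <= j)%N >-> i <= j}.
  move=> i j ij; rewrite /tau'; case: (leqP j m) => jm.
    by rewrite (leq_trans ij jm); exact: tauh.
  case: ifP => // im; apply: le_trans rb.
  by rewrite -(taur m) //; exact: tauh.
pose E'' k := if (k < m)%N then E' k else F.
have mE'' k : measurable (E'' k) by rewrite /E''; case: ifP.
have tau'0 : 0 <= tau' 0%N by rewrite /tau' leq0n tau0.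
have incr1 := bm_incr bm m.+1 tau'0 tau'h mE''.
have incr0 := bm_incr bm m tau'0 tau'h mE''.
have e1 : cylinder (fun i o => Y (tau' i.+1) o - Y (tau' i) o) m id E'' =
    cylinder W m id E'.
  apply/seteqP; split=> o /= H i im; have := H i im;
    by rewrite /E'' /tau' /W im ltnW.
have e2 : cylinder (fun i o => Y (tau' i.+1) o - Y (tau' i) o) m.+1 id E'' =
    cylinder W m id E' `&` [set o | F (Y b o - Y r o)].
  have eF o : E'' m (Y (tau' m.+1) o - Y (tau' m) o) = F (Y b o - Y r o).
    by rewrite /E'' /tau' ltnn leqnn taur.
  rewrite -e1; apply/seteqP; split=> o /=.
    by move=> H; split=> [i im|]; [apply: H; exact: ltnW|rewrite -eF; exact: H].
  move=> [H1 H2] i; rewrite ltnS leq_eqVlt => /orP[/eqP->|]; last exact: H1.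
  by rewrite eF.
rewrite -e2 incr1 big_ord_recr /= -incr0 e1; congr (_ * P _)%E.
by rewrite /E'' /tau' ltnn leqnn taur.
Qed.

End markov.

(** * Measures with a density and joint laws *)

(** The library pushforward, presented as a bundled measure. *)
Definition image_measure (R : realType) d d' (T : measurableType d)
    (U : measurableType d') (m : {measure set T -> \bar R}) (f : T -> U)
    (mf : measurable_fun setT f) : {measure set U -> \bar R} :=
  measure_function_pushforward__canonical__measure_function_Measure m mf.

Lemma measure_eq_rectangles (R : realType) d1 d2 (T1 : measurableType d1)
    (T2 : measurableType d2) (m1 m2 : {measure set (T1 * T2) -> \bar R}) :
  (m1 setT < +oo)%E ->
  (forall A B, measurable A -> measurable B -> m1 (A `*` B) = m2 (A `*` B)) ->
  forall X, measurable X -> m1 X = m2 X.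
Proof.
move=> m1oo m12 X mX.
pose G : set (set (T1 * T2)) :=
  [set A `*` B | A in (@measurable _ T1) & B in (@measurable _ T2)].
apply: (measure_unique G (fun=> setT)) => //.
- exact: measurable_prod_measurableType.
- move=> _ _ [A mA [B mB <-]] [A' mA' [B' mB' <-]].
  rewrite -setXI; exists (A `&` A'); first exact: measurableI.
  by exists (B `&` B') => //; exact: measurableI.
- by move=> _; exists setT => //; exists setT => //; rewrite setXTT.
- by apply/seteqP; split => // x _; exists 0%N.
- by move=> _ [A mA [B mB <-]]; exact: m12.
Qed.

Lemma integral_indicl (R : realType) d (T : measurableType d)
    (mu : {measure set T -> \bar R}) (A : set T) (f : T -> \bar R) :
  (\int[mu]_(x in A) f x = \int[mu]_x ((\1_A x)%:E * f x))%E.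
Proof.
rewrite integral_mkcond; apply: eq_integral => x _.
by rewrite patchE indicE; case: ifPn => _; rewrite ?mul1e ?mul0e.
Qed.

Section density.
Local Open Scope ereal_scope.
Context (R : realType) d (T : measurableType d).
Context (mu nu : {measure set T -> \bar R}) (h : T -> R).
Context (h0 : forall x, (0 <= h x)%R) (mh : measurable_fun setT h).
Context (nuE : forall A, measurable A -> nu A = \int[mu]_(x in A) (h x)%:E).
Import HBNNSimple.

(** Holds for simple functions by definition of the density; the general case
follows by monotone convergence. *)
Lemma ge0_integral_density f : (forall x, 0 <= f x) -> measurable_fun setT f ->
  \int[nu]_x f x = \int[mu]_x (f x * (h x)%:E).
Proof.
move=> f0 mf; pose f_ := nnsfun_approx measurableT mf.
have f_cvg x : (f_ n x)%:E @[n --> \oo] --> f x.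
  exact: (cvg_nnsfun_approx measurableT mf).
have f_nd x : {homo (fun n => (f_ n x)%:E) : n m / (n <= m)%N >-> n <= m}.
  by move=> n m nm; rewrite lee_fin; have /lefP := nd_nnsfun_approx measurableT mf nm.
transitivity (limn (fun n => \int[nu]_x (f_ n x)%:E)).
  rewrite -monotone_convergence//.
  - by apply: eq_integral => x _; apply/esym/cvg_lim.
  - by move=> n; exact/measurable_EFinP.
  - by move=> n x _; rewrite lee_fin.
transitivity (limn (fun n => \int[mu]_x ((f_ n x)%:E * (h x)%:E))); last first.
  rewrite -monotone_convergence//.
  - by apply: eq_integral => x _; apply/cvg_lim => //; exact: cvgeZr.
  - by move=> n; apply: emeasurable_funM => //; exact/measurable_EFinP.
  - by move=> n x _; rewrite mule_ge0// lee_fin.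
  - by move=> x _ n m nm; apply: lee_wpmul2r; rewrite ?lee_fin//; exact: f_nd.
congr (lim (_ @ \oo)); apply/funext => n.
transitivity (\sum_(k \in range (f_ n))
    \int[mu]_x ((k * \1_(f_ n @^-1` [set k]) x)%:E * (h x)%:E)); last first.
  rewrite -ge0_integral_fsum//.
  - apply: eq_integral => x _; rewrite fimfunE -EFinM mulr_fsuml// fsumEFin//.
  - move=> r; apply: emeasurable_funM; last exact/measurable_EFinP.
    exact/measurable_EFinP/measurable_funM.
  - by move=> r x _; rewrite mule_ge0 ?EFinM ?nnfun_muleindic_ge0// lee_fin.
transitivity (\sum_(k \in range (f_ n))
    \int[nu]_x (k * \1_(f_ n @^-1` [set k]) x)%:E).
  under eq_integral do rewrite fimfunE -fsumEFin//.
  rewrite ge0_integral_fsum//.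
  - by move=> y; exact/measurable_EFinP/measurable_funM.
  - by move=> y x _; rewrite nnfun_muleindic_ge0.
apply: eq_fsbigr => r _; rewrite integralZl_indic_nnsfun// integral_indic//= setIT.
have [r0|r0] := ltP r 0%R.
  rewrite preimage_nnfun0// measure0 mule0 integral0_eq// => x _.
  by rewrite indicE in_set0 mulr0 mul0e.
under [RHS]eq_integral do rewrite EFinM -muleA.
rewrite ge0_integralZl//.
- by rewrite nuE// integral_indicl.
- by apply: emeasurable_funM; exact/measurable_EFinP.
- by move=> x _; rewrite mule_ge0 ?lee_fin.
Qed.

End density.

Lemma lebesgue_integral_shift (R : realType) (f : R -> \bar R) (a : R) :
  measurable_fun setT f -> (forall x, (0 <= f x)%E) ->
  (\int[lebesgue_measure]_x f (x + a)%R = \int[lebesgue_measure]_x f x)%E.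
Proof.
move=> mf f0.
have ms : measurable_fun setT (fun x : R => x + a : measurableTypeR R).
  exact: measurable_funD.
pose mu' := image_measure (@lebesgue_measure R) ms.
have muE A : measurable A -> lebesgue_measure A = mu' A.
  apply: lebesgue_measure_unique => _ [[b c] _ <-].
  rewrite /mu' /= /pushforward [X in _ = lebesgue_measure X](_ : _ = `]b - a, c - a]%classic).
    rewrite !lebesgue_measure_itv /= !lte_fin ltrD2r.
    by case: ifP => // _; rewrite -!EFinB; congr (_%:E); ring.
  by apply/seteqP; split=> x /=; rewrite !in_itv /= ltrBlDr lerBrDr.
rewrite [RHS](eq_measure_integral mu'); last by move=> A mA _; exact: muE.
by rewrite ge0_integral_pushforward // preimage_setT.
Qed.

Lemma lebesgue_integral_opp (R : realType) (f : R -> \bar R) :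
  measurable_fun setT f -> (forall x, (0 <= f x)%E) ->
  (\int[lebesgue_measure]_x f (- x)%R = \int[lebesgue_measure]_x f x)%E.
Proof.
move=> mf f0.
have ms : measurable_fun setT (fun x : R => - x : measurableTypeR R).
  exact: oppr_measurable.
pose mu' := image_measure (@lebesgue_measure R) ms.
rewrite [RHS](eq_measure_integral mu'); last first.
  by move=> A mA _; exact: (esym (lebesgue_measureN mA)).
by rewrite ge0_integral_pushforward // preimage_setT.
Qed.

(** * Gaussian densities *)
(** The centred normal density of variance v; normal_pdf takes the standard
deviation. *)
Definition gauss (R : realType) (v x : R) : R := normal_pdf 0 (Num.sqrt v) x.

Lemma gaussE (R : realType) (v x : R) : 0 < v ->
  gauss v x = (Num.sqrt (v * pi *+ 2))^-1 * expR (- (x ^+ 2 / (v *+ 2))).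
Proof.
move=> v0; rewrite /gauss normal_pdfE ?sqrtr_eq0 -?ltNge // /normal_peak.
by rewrite /normal_fun subr0 sqr_sqrtr 1?ltW // mulNr.
Qed.

Lemma gauss_gt0 (R : realType) (v x : R) : 0 < v -> 0 < gauss v x.
Proof.
move=> v0; rewrite gaussE // mulr_gt0 ?expR_gt0 // invr_gt0 sqrtr_gt0.
by rewrite mulrn_wgt0 // mulr_gt0 // pi_gt0.
Qed.

Lemma gauss_ge0 (R : realType) (v x : R) : 0 <= gauss v x.
Proof. exact: normal_pdf_ge0. Qed.

Lemma gaussN (R : realType) (v x : R) : 0 < v -> gauss v (- x) = gauss v x.
Proof. by move=> v0; rewrite !gaussE // sqrrN. Qed.

Lemma measurable_gauss (R : realType) (v : R) : measurable_fun setT (gauss v).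
Proof. exact: measurable_normal_pdf. Qed.

(** Completing the square: the joint density of independent normal variables of
variances a and b, at a point with sum c, factors through the sum. *)
Lemma gauss_mul (R : realType) (a b s c : R) : 0 < a -> 0 < b ->
  gauss a (s + a / (a + b) * c) * gauss b (c - (s + a / (a + b) * c)) =
  gauss (a * b / (a + b)) s * gauss (a + b) c.
Proof.
move=> a0 b0; have ab0 : 0 < a + b by rewrite addr_gt0.
have v0 : 0 < a * b / (a + b) by rewrite divr_gt0 // mulr_gt0.
rewrite !gaussE // mulrACA [RHS]mulrACA -!expRD -!invfM.
congr (_^-1 * expR _); last first.
  rewrite -opprD -[in RHS]opprD !mulr2n; congr (- _); field.
  have ab : 0 < a * b by rewrite mulr_gt0.
  by rewrite !gt_eqF // addr_gt0.
have pos x : 0 < x -> 0 <= x * pi *+ 2 :> R.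
  by move=> x0; rewrite mulrn_wge0 // mulr_ge0 ?pi_ge0 // ltW.
rewrite -[LHS]sqrtrM ?pos // -[RHS]sqrtrM ?pos //.
by congr Num.sqrt; rewrite !mulr2n; field; rewrite gt_eqF.
Qed.

Lemma integral_normal (R : realType) (v : R) (f : R -> \bar R) :
  measurable_fun setT f -> (forall x, (0 <= f x)%E) ->
  (\int[normal_prob 0 (Num.sqrt v)]_x f x =
   \int[lebesgue_measure]_x (f x * (gauss v x)%:E))%E.
Proof.
move=> mf f0; apply: (@ge0_integral_density R _ _ lebesgue_measure
  (normal_prob 0 (Num.sqrt v)) (gauss v)) => //.
  by move=> x; exact: gauss_ge0.
exact: measurable_gauss.
Qed.

(** * Rotation of independent Gaussian variables *)

Lemma normal_probE (R : realType) (v : R) (E : set R) :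
  (normal_prob 0 (Num.sqrt v) E =
   \int[lebesgue_measure]_x (\1_E x * gauss v x)%:E)%E.
Proof.
by rewrite /normal_prob integral_indicl; apply: eq_integral => x _; rewrite EFinM.
Qed.

Lemma lebesgue_tonelli (R : realType) (f : R * R -> \bar R) :
  measurable_fun setT f -> (forall x, (0 <= f x)%E) ->
  (\int[lebesgue_measure]_x \int[lebesgue_measure]_y f (x, y) =
   \int[lebesgue_measure]_y \int[lebesgue_measure]_x f (x, y))%E.
Proof.
move=> mf f0.
exact: (@fubini_tonelli _ _ (measurableTypeR R) (measurableTypeR R) R
  lebesgue_measure lebesgue_measure f mf f0).
Qed.

Section rotation.
Local Open Scope ereal_scope.
Context (R : realType) (a b : R) (a0 : (0 < a)%R) (b0 : (0 < b)%R).
Let N (v : R) := normal_prob 0%R (Num.sqrt v).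
Let rho := (a / (a + b))%R.

(** The linear change of variables (x, y) |-> (x - rho (x + y), x + y) decouples
the Gaussian density because rho is the regression coefficient of the first
variable on the sum. *)
Lemma gauss_rotation_prod (E C : set R) : measurable E -> measurable C ->
  (N a \x N b) [set x : R * R | E (x.1 - rho * (x.1 + x.2))%R /\ C (x.1 + x.2)%R]
  = N (a * b / (a + b)) E * N (a + b)%R C.
Proof.
move=> mE mC; set X := [set x | _].
have mX : measurable X.
  apply: measurableI.
    rewrite -[X in measurable X]setTI.
    apply: (_ : measurable_fun setT (fun x : R * R => x.1 - rho * (x.1 + x.2))%R) => //.
    apply: measurable_funB => //; apply: measurable_funM => //.
    exact: measurable_funD.
  rewrite -[X in measurable X]setTI.
  apply: (_ : measurable_fun setT (fun x : R * R => x.1 + x.2)%R) => //.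
  exact: measurable_funD.
pose k (x : R * R) := (\1_X x * gauss b x.2 * gauss a x.1)%R.
have k0 x : (0 <= k x)%R by rewrite !mulr_ge0 ?gauss_ge0.
have mk : measurable_fun setT k.
  apply: measurable_funM; first apply: measurable_funM.
  - exact: measurable_indic.
  - by apply: measurableT_comp => //; exact: measurable_gauss.
  - by apply: measurableT_comp => //; exact: measurable_gauss.
have mkl x : measurable_fun setT (fun y => (k (x, y))%:E).
  apply/measurable_EFinP; apply: (measurableT_comp mk) => //.
transitivity (\int[lebesgue_measure]_x \int[lebesgue_measure]_y (k (x, y))%:E).
  rewrite /product_measure1 integral_normal //; last exact: measurable_fun_xsection.
  apply: eq_integral => x _ /=; rewrite /N /normal_prob integral_indicl.
  rewrite -ge0_integralZr //; first last.
  - by rewrite lee_fin gauss_ge0.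
  - by move=> y _; rewrite mule_ge0 // lee_fin // gauss_ge0.
  - apply: emeasurable_funM; apply/measurable_EFinP.
      by apply: measurable_indic; exact: measurable_xsection.
    exact: measurable_gauss.
  apply: eq_integral => y _; rewrite /k -!EFinM.
  by rewrite !indicE mem_xsection.
transitivity (\int[lebesgue_measure]_x \int[lebesgue_measure]_c (k (x, c - x)%R)%:E).
  apply: eq_integral => x _.
  by rewrite -[LHS](lebesgue_integral_shift (- x)) // => y; rewrite lee_fin.
have mk' : measurable_fun setT (fun p : R * R => (k (p.1, p.2 - p.1))%:E).
  apply/measurable_EFinP; apply: (measurableT_comp mk) => //.
  by apply: measurable_fun_pair => //; exact: measurable_funB.
have k0' (p : R * R) : 0 <= (k (p.1, p.2 - p.1)%R)%:E by rewrite lee_fin.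
rewrite (lebesgue_tonelli mk' k0').
transitivity (\int[lebesgue_measure]_c \int[lebesgue_measure]_x
    ((\1_E x * gauss (a * b / (a + b)) x)%:E * (\1_C c * gauss (a + b) c)%:E)).
  apply: eq_integral => c _ /=.
  rewrite -[LHS](lebesgue_integral_shift (rho * c)) //; first last.
    by move=> x; rewrite lee_fin.
    apply/measurable_EFinP; apply: (measurableT_comp mk) => //.
    by apply: measurable_fun_pair => //; exact: measurable_funB.
  apply: eq_integral => x _; rewrite /k -EFinM; congr (_%:E) => /=.
  have -> : (\1_X (x + rho * c, c - (x + rho * c)) = \1_E x * \1_C c :> R)%R.
    rewrite !indicE -natrM mulnb; congr (_%:R)%R; congr nat_of_bool.
    have e1 : (x + rho * c + (c - (x + rho * c)) = c)%R by ring.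
    have e2 : (x + rho * c - rho * c = x)%R by ring.
    apply/idP/andP; rewrite !inE /X /= e1 e2 //.
  by rewrite -mulrA [(gauss b _ * _)%R]mulrC gauss_mul // mulrACA.
transitivity (\int[lebesgue_measure]_c ((\1_C c * gauss (a + b) c)%:E *
    N (a * b / (a + b)) E)).
  apply: eq_integral => c _; rewrite ge0_integralZr //.
  - by rewrite muleC /N normal_probE.
  - by apply/measurable_EFinP; apply: measurable_funM => //; exact: measurable_gauss.
  - by move=> x _; rewrite lee_fin mulr_ge0 // gauss_ge0.
  - by rewrite lee_fin mulr_ge0 // gauss_ge0.
have NE0 : 0 <= N (a * b / (a + b)) E by rewrite /N measure_ge0.
move: (N _ E) NE0 => NE NE0; rewrite ge0_integralZr //.
- by rewrite muleC /N normal_probE.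
- by apply/measurable_EFinP; apply: measurable_funM => //; exact: measurable_gauss.
- by move=> x _; rewrite lee_fin mulr_ge0 // gauss_ge0.
Qed.

(** The event A rides along: it is only assumed to be independent of the pair
(S, D), and it stays independent of the pair after the change of variables. *)
Lemma gauss_rotation d (T : measurableType d) (P : probability T R) (A : set T)
    (S D : T -> R) : measurable A -> measurable_fun setT S ->
  measurable_fun setT D ->
  (forall E F : set R, measurable E -> measurable F ->
    P (A `&` [set o | E (S o)] `&` [set o | F (D o)]) = P A * N a E * N b F) ->
  forall E C : set R, measurable E -> measurable C ->
    P (A `&` [set o | E (S o - rho * (S o + D o))%R] `&`
       [set o | C (S o + D o)%R]) = P A * N (a * b / (a + b)) E * N (a + b)%R C.
Proof.
move=> mA mS mD SD E C mE mC.
have mSD : measurable_fun setT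
    (fun o => (S o, D o) : (measurableTypeR R * measurableTypeR R)%type).
  exact: (@measurable_fun_pair _ _ _ T (measurableTypeR R) (measurableTypeR R)).
have PA0 : (0 <= fine (P A))%R by exact: fine_ge0.
have PAE : P A = (fine (P A))%:E by rewrite fineK // fin_num_measure.
pose X := [set x : R * R | E (x.1 - rho * (x.1 + x.2))%R /\ C (x.1 + x.2)%R].
have mX : measurable X.
  apply: measurableI.
    rewrite -[X in measurable X]setTI.
    apply: (_ : measurable_fun setT (fun x : R * R => x.1 - rho * (x.1 + x.2))%R) => //.
    apply: measurable_funB => //; apply: measurable_funM => //.
    exact: measurable_funD.
  rewrite -[X in measurable X]setTI.
  apply: (_ : measurable_fun setT (fun x : R * R => x.1 + x.2)%R) => //.
  exact: measurable_funD.
pose m1 : {measure set (measurableTypeR R * measurableTypeR R) -> \bar R} :=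
  image_measure (mrestr P mA) mSD.
pose m2 : {measure set (measurableTypeR R * measurableTypeR R) -> \bar R} :=
  mscale (NngNum PA0) (normal_prob 0%R (Num.sqrt a) \x normal_prob 0%R (Num.sqrt b)).
have := @measure_eq_rectangles R _ _ (measurableTypeR R) (measurableTypeR R) m1 m2 _ _ X mX.
have -> : m2 X = P A * (N (a * b / (a + b)) E * N (a + b)%R C).
  by rewrite [in RHS]PAE -gauss_rotation_prod.
move=> H; rewrite -muleA -[RHS]H; first last.
- move=> E' F' mE' mF'.
  have -> : m2 (E' `*` F') = P A * N a E' * N b F'.
    rewrite [in RHS]PAE -muleA -(@product_measure1E _ _ (measurableTypeR R)
      (measurableTypeR R) R (normal_prob 0%R (Num.sqrt a))
      (normal_prob 0%R (Num.sqrt b)) E' F') //.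
  rewrite -SD // /m1 /= /pushforward /mrestr; congr (P _).
  by rewrite -setIA setIC.
- rewrite /= /pushforward /mrestr preimage_setT setTI.
  by rewrite (le_lt_trans (probability_le1 _ _)) ?ltry.
- by rewrite /= /pushforward /mrestr; congr (P _); rewrite -setIA setIC.
Qed.

End rotation.

(** * The Brownian bridge is independent of the endpoint *)

Lemma normal_probT (R : realType) (v : R) :
  normal_prob 0 (Num.sqrt v) [set: R] = 1%E.
Proof. exact: probability_setT. Qed.

Section bridge_independence.
Context (R : realType) d (T : measurableType d) (P : probability T R).
Context (Y : R -> T -> R) (bm : clean_bm P Y).

Lemma bm_normal z (E : set R) : 0 < z -> measurable E ->
  P [set o | E (Y z o)] = normal_prob 0 (Num.sqrt z) E.
Proof.
move=> z0 mE; rewrite -[z in RHS]subr0 -(bm_law bm _ z0) //.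
by congr (P _); apply/funext => o /=; rewrite (bm_start bm) subr0.
Qed.

Lemma bm_event z (E : set R) : measurable E -> measurable [set o | E (Y z o)].
Proof. by move=> mE; have := bm_meas bm z measurableT mE; rewrite setTI. Qed.

Lemma past_event r z (E : set R) : 0 <= z <= r -> measurable E ->
  past Y r [set o | E (Y z o)].
Proof. by move=> zr mE; exact: (@coordinate_event R T R Y). Qed.

Lemma pastI r A B : past Y r A -> past Y r B -> past Y r (A `&` B).
Proof.
move=> pA pB.
exact: (@measurableI _ (g_sigma_algebraType (coordinate_events Y [set z | 0 <= z <= r]))).
Qed.

Lemma past_Y_measurable r z : 0 <= z <= r ->
  measurable_fun (setT : set (g_sigma_algebraType
     (coordinate_events Y [set z | 0 <= z <= r]))) (Y z).
Proof. by move=> zr; exact: (@coordinate_measurable R T R Y). Qed.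

(** Event of the past of r that is independent of the value at r itself. *)
Definition indep_of_value r A := past Y r A /\
  forall C : set R, measurable C -> indep_events P A [set o | C (Y r o)].

(** Conditionally on A, the value at r and the next increment are independent
Gaussian variables; rotating them shows that Y r - (r / r') Y r' is
independent of Y r'. *)
Lemma indep_of_value_step r r' (A : set T) (E : set R) : 0 <= r -> r <= r' ->
  measurable E -> indep_of_value r A ->
  indep_of_value r' (A `&` [set o | E (Y r o - r / r' * Y r' o)]).
Proof.
move=> r0 rr' mE [pA iA]; have pA' := past_le rr' pA.
have r'0 : 0 <= r' by exact: le_trans rr'.
have mA : measurable A := past_measurable bm pA.
have pW : past Y r' [set o | E (Y r o - r / r' * Y r' o)].
  apply: (@sigma_preimage R T _ (fun o => Y r o - r / r' * Y r' o)) => //.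
  apply: measurable_funB; first by apply: past_Y_measurable; rewrite r0.
  by apply: measurable_funM => //; apply: past_Y_measurable; rewrite r'0 /=.
split; first exact: pastI.
(* When r is 0 or r' there is no Gaussian pair to rotate: the new variable is 0. *)
have triv C : measurable C -> indep_events P A [set o | C (Y r' o)] ->
    (forall o, Y r o - r / r' * Y r' o = 0) ->
    indep_events P (A `&` [set o | E (Y r o - r / r' * Y r' o)]) [set o | C (Y r' o)].
  move=> mC iC W0; have [E0|E0] := pselect (E 0).
    suff -> : [set o | E (Y r o - r / r' * Y r' o)] = setT by rewrite setIT.
    by apply/seteqP; split=> // o _ /=; rewrite W0.
  suff -> : [set o | E (Y r o - r / r' * Y r' o)] = set0.
    by rewrite /indep_events setI0 set0I measure0 mul0e.
  by apply/seteqP; split=> // o /=; rewrite W0.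
move=> C mC; move: rr'; rewrite le_eqVlt => /orP[/eqP rr'|rr'].
  apply: triv => //; first by rewrite -rr'; exact: iA.
  move=> o; rewrite -rr'; have [->|rN0] := eqVneq r 0.
    by rewrite (bm_start bm) mul0r mul0r subr0.
  by rewrite divff // mul1r subrr.
move: r0; rewrite le_eqVlt => /orP[/eqP r0|r0].
  apply: triv => //; last by move=> o; rewrite -r0 (bm_start bm) mul0r mul0r subr0.
  have := past_indep bm (lexx 0) r'0 mC; rewrite -r0 in pA; move=> /(_ _ pA).
  suff -> : [set o | C (Y r' o - Y 0 o)] = [set o | C (Y r' o)] by [].
  by apply/funext => o /=; rewrite (bm_start bm) subr0.
have mD : measurable_fun setT (fun o => Y r' o - Y r o).
  by apply: measurable_funB; exact: (bm_meas bm).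
have rot (E' C' : set R) : measurable E' -> measurable C' ->
    P (A `&` [set o | E' (Y r o - r / r' * Y r' o)] `&` [set o | C' (Y r' o)]) =
    (P A * normal_prob 0 (Num.sqrt (r * (r' - r) / r')) E' *
     normal_prob 0 (Num.sqrt r') C')%E.
  move=> mE' mC'.
  have e1 : r + (r' - r) = r' by rewrite addrC subrK.
  have e2 o : Y r o + (Y r' o - Y r o) = Y r' o by rewrite addrC subrK.
  have := @gauss_rotation R r (r' - r) r0 _ d T P A (Y r)
    (fun o => Y r' o - Y r o) mA (bm_meas bm r) mD _ E' C' mE' mC'.
  rewrite subr_gt0 e1 => /(_ rr').
  under eq_set do rewrite e2.
  under [in X in (P (_ `&` X))]eq_set do rewrite e2.
  apply => E0 F0 mE0 mF0.
  have -> : P (A `&` [set o | E0 (Y r o)] `&` [set o | F0 (Y r' o - Y r o)]) =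
     (P (A `&` [set o | E0 (Y r o)]) * P [set o | F0 (Y r' o - Y r o)%R])%E.
    apply: (past_indep bm (ltW r0) (ltW rr')) => //; apply: pastI => //.
    by apply: past_event => //; rewrite (ltW r0) lexx.
  by rewrite iA // bm_normal // (bm_law bm (ltW r0)).
rewrite /indep_events rot // bm_normal //; last exact: lt_trans rr'.
congr (_ * _)%E.
have := rot E setT mE measurableT.
have -> : [set o | [set: R] (Y r' o)] = setT by apply/seteqP.
rewrite setIT => ->.
by rewrite normal_probT mule1.
Qed.

Definition bridge t z o := Y z o - z / t * Y t o.

Lemma bridge_meas t z : measurable_fun setT (bridge t z).
Proof.
apply: measurable_funB; first exact: (bm_meas bm).
by apply: measurable_funM => //; exact: (bm_meas bm).
Qed.

(** Along an increasing sequence of times tau, the bridge is recovered backwards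
from the variables W k = Y (tau k) - (tau k / tau k.+1) Y (tau k.+1), and
joining W k to the past keeps independence of the value at tau k.+1. *)
Lemma bridge_indep t A (C : set R) : 0 < t -> measurable C ->
  <<s coordinate_events (bridge t) [set z | 0 <= z <= t] >> A ->
  indep_events P A [set o | C (Y t o)].
Proof.
move=> t0 mC; move: A; apply: indep_coordinates.
- by exists 0 => /=; rewrite lexx ltW.
- by move=> z _; exact: bridge_meas.
- exact: bm_event.
move=> n z E zt mE.
have [m [tau [m0 tau0 taut tauh ztau]]] := sorted_times (ltW t0) zt.
have tau_ge0 k : 0 <= tau k by rewrite -tau0; exact: tauh.
pose W k o := Y (tau k) o - tau k / tau k.+1 * Y (tau k.+1) o.
have mW k : measurable_fun setT (W k).
  apply: measurable_funB; first exact: (bm_meas bm).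
  by apply: measurable_funM => //; exact: (bm_meas bm).
have cW : <<s coordinate_events W [set k | (k < m)%N] >> (cylinder (bridge t) n z E).
  have brm j : (j <= m)%N ->
      measurable_fun (setT : set (g_sigma_algebraType
        (coordinate_events W [set k | (k < m)%N]))) (bridge t (tau (m - j)%N)).
    elim: j => [_|j IH jm].
      rewrite subn0 (_ : bridge t _ = cst 0) ?measurable_cst //.
      by apply/funext => o; rewrite /bridge taut // divff ?gt_eqF // mul1r subrr.
    have mj : (m - j = (m - j.+1).+1)%N by rewrite subnSK.
    move: (IH (ltnW jm)); rewrite mj; set k := (m - j.+1)%N => IHk.
    have km : (k < m)%N by rewrite /k; apply: leq_trans (leq_subr j m); rewrite mj.
    rewrite (_ : bridge t (tau k) = W k \+
        (fun o => tau k / tau k.+1 * bridge t (tau k.+1) o)).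
      apply: measurable_funD.
        exact: (@coordinate_measurable R T nat W [set k | (k < m)%N]).
      by apply: measurable_funM.
    apply/funext => o; rewrite /bridge /W /=.
    have [t10|t1N] := eqVneq (tau k.+1) 0.
      have -> : tau k = 0 by apply/eqP; rewrite eq_le tau_ge0 -t10 tauh.
      by rewrite (bm_start bm) !mul0r !subr0 addr0.
    by field; rewrite t1N gt_eqF.
  apply: (@cylinder_sigma R T R (bridge t) [set x | exists2 k, (k <= m)%N & x = tau k]) => //.
  move=> _ E0 [k km ->] mE0; apply: sigma_preimage => //.
  by rewrite -(subKn km); apply: brm; exact: leq_subr.
move: cW; apply: indep_finite_family => //; first exact: bm_event.
move=> E' mE'.
suff H k : indep_of_value (tau k) (cylinder W k id E').
  by have [_] := H m; rewrite taut //; exact.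
elim: k => [|k IH].
  have -> : cylinder W 0 id E' = setT by apply/seteqP; split.
  split; first exact: (@measurableT _ (g_sigma_algebraType (coordinate_events Y [set z | 0 <= z <= tau 0%N]))).
  by move=> C' mC'; rewrite /indep_events setTI probability_setT mul1e.
rewrite (_ : cylinder W k.+1 id E' = cylinder W k id E' `&` [set o | E' k (W k o)]).
  by apply: indep_of_value_step => //; exact: tauh.
apply/seteqP; split=> o /=.
  by move=> H; split=> [i ik|]; apply: H => //; exact: ltnW.
by move=> [H1 H2] i; rewrite ltnS leq_eqVlt => /orP[/eqP->//|]; exact: H1.
Qed.

End bridge_independence.

(** * Path space *)

Lemma rat_near (R : realType) (y e : R) : 0 < e ->
  exists q : rat, `|ratr q - y| < e.
Proof.
move=> e0; have /rat_in_itvoo[q] : y - e < y + e by lra.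
by rewrite in_itv /= => /andP[q1 q2]; exists q; rewrite ltr_norml; apply/andP; split; lra.
Qed.

(** An open set of R^n is a countable union of rational boxes, and the preimage of
a box is measurable coordinate by coordinate. *)
Lemma continuous_rV_measurable (R : realType) n (g : 'rV[R]_n -> R) d
    (T : measurableType d) (f : 'I_n -> T -> R) : continuous g ->
  (forall i, measurable_fun setT (f i)) ->
  measurable_fun setT (fun x => g (\row_i f i x)).
Proof.
move=> cg mf; apply: (measurability _ (RGenOInfty.measurableE R)).
move=> /= _ [_ [a ->] <-]; rewrite setTI.
have oA : open [set v | a < g v].
  rewrite (_ : [set v | a < g v] = g @^-1` `]a, +oo[).
    by apply: open_comp => //; exact: interval_open.
  by apply/seteqP; split=> v /=; rewrite in_itv/= andbT.
pose center (q : {ffun 'I_n -> rat}) : 'rV[R]_n := \row_i ratr (q i).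
pose box (q : {ffun 'I_n -> rat} * nat) : set T :=
  [set x | ball (center q.1) q.2.+1%:R^-1 `<=` [set v | a < g v] /\
           forall i, `|ratr (q.1 i) - f i x| < q.2.+1%:R^-1].
have -> : (fun x => g (\row_i f i x)) @^-1` `]a, +oo[ = \bigcup_q box q.
  apply/seteqP; split=> x /=; rewrite in_itv /= andbT; last first.
    move=> [[q k] _ [/= sub near_x]]; apply: sub.
    split=> [|i j]; first by rewrite invr_gt0.
    by rewrite !mxE /ball /=; exact: near_x.
  move=> ax.
  have /nbhs_ballP[e /= e0 eA] : nbhs (\row_i f i x) [set v | a < g v].
    by apply: open_nbhs_nbhs; split.
  have [k ke] : exists k, k.+1%:R^-1 < e / 2.
    have e20 : 0 < e / 2 by rewrite divr_gt0.
    by have [k /= _] := near_infty_natSinv_lt (PosNum e20); move=> H; exists k; apply: H => /=.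
  have qP i : exists q : rat, `|ratr q - f i x| < k.+1%:R^-1.
    by apply: rat_near; rewrite invr_gt0.
  have [q qx] := choice qP.
  exists ([ffun i => q i], k) => //; split => /=; last by move=> i; rewrite ffunE.
  move=> v [_ bv]; apply: eA; split=> // i j; rewrite ord1.
  have := bv 0 j; have := qx j; rewrite !mxE ffunE /ball /= => h1 h2.
  rewrite [ltRHS]splitr; apply: le_lt_trans (ltrD (lt_trans h1 ke) (lt_trans h2 ke)).
  by rewrite (distrC (ratr (q j)) (f j x)) ler_distD.
apply: countable_bigcupT_measurable => // -[q k].
have [sub|nsub] := pselect (ball (center q) k.+1%:R^-1 `<=` [set v | a < g v]); last first.
  by rewrite (_ : box _ = set0) //; apply/seteqP; split => // x [].
rewrite (_ : box _ = \big[setI/setT]_(i < n) [set x | `|ratr (q i) - f i x| < k.+1%:R^-1]).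
  apply: bigsetI_measurable => i _.
  have := (mf i) measurableT (ball (ratr (q i) : R) k.+1%:R^-1).
  rewrite setTI; apply; exact: measurable_ball.
apply/seteqP; split=> x /=.
  move=> [_ H]; elim/big_rec: _ => // i A _; split => //; exact: H.
move=> H; split => // i; move: H; rewrite (bigD1 i) //=; by case.
Qed.

Section path_space.
Context (R : realType) (t : R).

Lemma measurable_path d (U : measurableType d) (f : U -> path_space t) :
  (forall z, 0 <= z <= t -> measurable_fun setT (fun x => f x z)) ->
  measurable_fun setT f.
Proof.
move=> mf; apply: (@measurability _ _ U (path_space t) setT f (evaluation_sets t)) => //.
move=> _ [_ [z [zt [E [mE ->]]]] <-].
exact: mf.
Qed.

Lemma measurable_evaluation z : 0 <= z <= t ->
  measurable_fun setT (fun w : path_space t => w z).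
Proof.
move=> zt _ E mE; rewrite setTI; apply: sub_sigma_algebra.
by exists z; split => //; exists E.
Qed.

End path_space.

(** * The bridge kernel *)

Section tilt.
Context (R : realType) (t u : R).

Lemma tilt_cont (c : R) (w : cpath t) :
  {within `[0, t], continuous (fun z => u + w z + z / t * (c - u))}.
Proof.
have cw : {within `[0, t], continuous w} by case: w.
move=> z.
apply: (@cvgD _ R^o); first by apply: (@cvgD _ R^o); [exact: cvg_cst|exact: cw].
have lc : continuous (fun z : R => z / t * (c - u)).
  move=> x; apply: cvgM; last exact: cvg_cst.
  by apply: cvgM; [exact: cvg_id|exact: cvg_cst].
exact: (continuous_subspaceT lc).
Qed.

(** Adds to a path from 0 to 0 the chord from u to c. *)
Definition tilt (p : R * path_space t) : path_space t := CPath (@tilt_cont p.1 p.2).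

Lemma measurable_tilt : measurable_fun setT tilt.
Proof.
apply: measurable_path => z zt /=.
apply: measurable_funD.
  apply: measurable_funD => //.
  exact: (measurableT_comp (measurable_evaluation zt) measurable_snd).
apply: measurable_funM => //.
by apply: measurable_funB => //; exact: measurable_fst.
Qed.

End tilt.

Section bridge_kernel.
Context (R : realType) d (T : measurableType d) (P : probability T R).
Context (Y : R -> T -> R) (bm : clean_bm P Y) (t : R).

Lemma bridge_cont o : {within `[0, t], continuous (fun z => bridge Y t z o)}.
Proof.
apply: continuous_subspaceT => z; apply: (@cvgB _ R^o); first exact: (bm_cont bm).
apply: cvgM; last exact: cvg_cst.
by apply: cvgM; [exact: cvg_id|exact: cvg_cst].
Qed.

Definition bridge_path o : path_space t := CPath (@bridge_cont o).

Lemma measurable_bridge_path : measurable_fun setT bridge_path.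
Proof. by apply: measurable_path => z zt /=; exact: (bridge_meas bm). Qed.

Lemma measurable_tilted u c : measurable_fun setT (fun o => tilt u (c, bridge_path o)).
Proof.
apply: measurableT_comp; first exact: measurable_tilt.
by apply: measurable_fun_pair => //; exact: measurable_bridge_path.
Qed.

Definition bridge_kernel (u c : R) : {measure set (path_space t) -> \bar R} :=
  image_measure P (measurable_tilted u c).

Lemma bridge_kernelE u c (A : set (path_space t)) :
  bridge_kernel u c A = P [set o | A (tilt u (c, bridge_path o))].
Proof. by []. Qed.

Lemma measurable_bridge_kernel u (A : set (path_space t)) : measurable A ->
  measurable_fun setT (fun c => bridge_kernel u c A).
Proof.
move=> mA.
have mJ : measurable_fun setT (fun p : R * T => tilt u (p.1, bridge_path p.2)).
  apply: measurableT_comp; first exact: measurable_tilt.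
  apply: measurable_fun_pair; first exact: measurable_fst.
  exact: (measurableT_comp measurable_bridge_path measurable_snd).
have := mJ measurableT A mA; rewrite setTI => mJA.
have := measurable_fun_xsection P mJA.
congr (measurable_fun _ _); apply/funext => c /=.
by rewrite bridge_kernelE; congr (P _); apply/seteqP; split=> o /=; rewrite /xsection /= inE.
Qed.

HB.instance Definition _ u :=
  isKernel.Build _ _ _ _ R (bridge_kernel u) (@measurable_bridge_kernel u).

Lemma bridge_kernelT u c : bridge_kernel u c setT = 1%E.
Proof. by rewrite bridge_kernelE probability_setT. Qed.

HB.instance Definition _ u :=
  Kernel_isProbability.Build _ _ _ _ R (bridge_kernel u) (@bridge_kernelT u).

Definition bridge_pker u : R.-pker R ~> path_space t := bridge_kernel u.

End bridge_kernel.

(** * Disintegration along the endpoint *)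

Lemma measure_ae_eq (R : realType) d (T : measurableType d)
    (P : {measure set T -> \bar R}) (A B : set T) : measurable A -> measurable B ->
  {ae P, forall o, A o <-> B o} -> P A = P B.
Proof.
move=> mA mB [N [mN N0 sub]].
have le (A' B' : set T) : measurable A' -> measurable B' ->
    (forall o, ~ N o -> A' o -> B' o) -> (P A' <= P B')%E.
  move=> mA' mB' AB; have mBN : measurable (B' `|` N) by exact: measurableU.
  have s : A' `<=` B' `|` N.
    by move=> o Ao; have [No|No] := pselect (N o); [right|left; exact: AB].
  apply: le_trans (le_measure P _ _ s) _; rewrite ?inE //.
  by apply: (le_trans (measureU2 _ mB' mN)); rewrite [X in (_ + X)%E](_ : _ = 0%E) ?adde0.
have iff o : ~ N o -> (A o <-> B o).
  by move=> No; apply: contrapT => H; exact/No/sub.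
by apply/eqP; rewrite eq_le !le //; move=> o No Ho; apply/(iff _ No).
Qed.

Lemma probability_lty (R : realType) d (T : measurableType d)
    (P : probability T R) : ((P : {measure set T -> \bar R}) setT < +oo)%E.
Proof. by rewrite -ge0_fin_numE // fin_num_measure. Qed.

Lemma bounded_integrable (R : realType) d (T : measurableType d)
    (P : {measure set T -> \bar R}) (F : T -> R) (M : R) : (P setT < +oo)%E ->
  measurable_fun setT F -> (forall x, `|F x| <= M) ->
  P.-integrable setT (EFin \o F).
Proof.
move=> Poo mF FM; apply: measurable_bounded_integrable => //.
exists M; split; first exact: num_real.
by move=> x Mx y _ /=; rewrite (le_trans (FM y)) // ltW.
Qed.

Lemma Rintegral_image (R : realType) d d' (T : measurableType d)
    (U : measurableType d') (P : {measure set T -> \bar R}) (f : T -> U)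
    (mf : measurable_fun setT f) (F : U -> R) (M : R) : (P setT < +oo)%E ->
  measurable_fun setT F -> (forall x, `|F x| <= M) ->
  \int[image_measure P mf]_x F x = \int[P]_x F (f x).
Proof.
move=> Poo mF FM; rewrite /Rintegral; congr fine.
rewrite integral_pushforward ?preimage_setT //; first exact/measurable_EFinP.
apply: (@bounded_integrable _ _ _ _ (F \o f) M) => //.
  exact: measurableT_comp.
by move=> x; exact: FM.
Qed.

Lemma cvg_row (R : realType) n (f : R -> 'I_n -> R) (x : R) :
  (forall i, {for x, continuous (fun y => f y i)}) ->
  {for x, continuous (fun y => \row_i f y i : 'rV[R]_n)}.
Proof.
move=> cf; apply/cvg_ballP => e e0.
have H : \forall y \near x, forall i, ball (f x i) e (f y i).
  apply: (@filter_forall _ 'I_n (fun i y => ball (f x i) e (f y i)) (nbhs x)) => i.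
  by have /cvg_ballP := cf i; exact.
near=> y; split=> // i j; rewrite !mxE.
by move: j; near: y.
Unshelve. all: by end_near.
Qed.

Section bridge_law.
Context (R : realType) d (T : measurableType d) (P : probability T R).
Context (Y : R -> T -> R) (bm : clean_bm P Y) (t : R) (t0 : 0 < t).

Lemma bridge_path_indep (A : set (path_space t)) (C : set R) :
  measurable A -> measurable C ->
  indep_events P (bridge_path bm t @^-1` A) [set o | C (Y t o)].
Proof.
move=> mA mC; apply: (bridge_indep bm t0 mC).
suff : <<s evaluation_sets t >> `<=`
  [set B | <<s coordinate_events (bridge Y t) [set z | 0 <= z <= t] >>
             (bridge_path bm t @^-1` B)] by move=> /(_ A mA).
apply: smallest_sub.
- split=> [|B HB|F HF] /=.
  + by rewrite preimage_set0; exact: sigma_algebra0.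
  + rewrite setTD preimage_setC -setTD; exact: sigma_algebraCD.
  + by rewrite preimage_bigcup; exact: sigma_algebra_bigcup.
- move=> _ [z [zt [E [mE ->]]]]; exact: (@coordinate_event R T R (bridge Y t)).
Qed.

(** Tilting the bridge by its own endpoint gives back the drifted path, for every
drift mu: the kernel of the tilted bridges does not depend on mu. *)
Lemma tilt_bridge u mu z o :
  tilt u (u + mu * t + Y t o, bridge_path bm t o) z = u + mu * z + Y z o.
Proof. by rewrite /= /bridge; field; rewrite gt_eqF. Qed.

(** Endpoint and bridge are independent, so this is Fubini on the product of their
laws. *)
Lemma disintegration u mu (S : {mfun T >-> R}) (C : set R)
    (A : set (path_space t)) : (forall o, S o = u + mu * t + Y t o) ->
  measurable C -> measurable A ->
  P [set o | C (S o) /\ A (tilt u (S o, bridge_path bm t o))] =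
  (\int[distribution P S]_(c in C) bridge_pker bm t u c A)%E.
Proof.
move=> SE mC mA.
pose beta : {mfun T >-> path_space t} :=
  mfun_Sub (mem_set (@measurable_bridge_path _ _ _ _ _ bm t)).
have mSb : measurable_fun setT (fun o => (S o, beta o)).
  exact: measurable_fun_pair.
pose m1 := image_measure P mSb.
pose m2 : {measure set (R * path_space t) -> \bar R} :=
  (distribution P S \x distribution P beta)%E.
pose Z := [set p : R * path_space t | C p.1 /\ A (tilt u p)].
have mZ : measurable Z.
  apply: measurableI; last first.
    by rewrite -[X in measurable X]setTI; exact: measurable_tilt.
  by rewrite -[X in measurable X]setTI; exact: measurable_fst.
have := @measure_eq_rectangles R _ _ _ _ m1 m2 _ _ Z mZ.
rewrite {1}/m1 /= /pushforward => ->.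
- rewrite /product_measure1 [RHS]integral_mkcond; apply: eq_integral => c _ /=.
  rewrite patchE; case: ifPn => cC.
    rewrite /distribution /pushforward; congr (P _).
    by apply/seteqP; split=> o /=; rewrite /xsection /= inE /Z /=; move: cC; rewrite inE; tauto.
  rewrite (_ : xsection Z c = set0) ?measure0 //.
  apply/seteqP; split=> // w; rewrite /xsection /= inE /Z /= => -[Cc _].
  by move/negP: cC; apply; rewrite inE.
- rewrite preimage_setT; exact: probability_lty.
- move=> B D mB mD; rewrite /m2 product_measure1E //=.
  rewrite /distribution /= /pushforward muleC.
  pose B' := [set y | B (u + mu * t + y)].
  have mB' : measurable B'.
    rewrite -[X in measurable X]setTI.
    by apply: (_ : measurable_fun setT (fun y => u + mu * t + y)) => //; exact: measurable_funD.
  have := bridge_path_indep mD mB'.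
  rewrite /indep_events.
  have -> : [set o | B' (Y t o)] = S @^-1` B.
    by apply/funext => o; rewrite /B' /= SE.
  by move=> <-; congr (P _); rewrite setIC.
Qed.

Lemma bridge_pker_law (X : R -> {RV P >-> R}) mu u :
  (forall z, 0 <= z -> {ae P, forall o, X z o = mu * z + Y z o}) ->
  bridge_law (started_at u X) (bridge_pker bm t u).
Proof.
move=> XY; split; last first.
  move=> n z zt g cg [M gM].
  have mF : measurable_fun setT (fun w : path_space t => g (\row_i w (z i))).
    by apply: continuous_rV_measurable => // i; exact: measurable_evaluation.
  have -> : (fun c => \int[bridge_pker bm t u c]_w g (\row_i w (z i))) =
      (fun c => \int[P]_o g (\row_i tilt u (c, bridge_path bm t o) (z i))).
    apply/funext => c; apply: (Rintegral_image _ _ mF (M := M)) => //.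
    exact: probability_lty.
  move=> c; have cI : c \in `]c - 1, c + 1[%classic.
    by rewrite inE /= in_itv /=; apply/andP; split; lra.
  move: c cI => c0; have cg' o : continuous (fun c =>
       g (\row_i tilt u (c, bridge_path bm t o) (z i))).
    move=> c; apply: (@continuous_comp _ _ _ (fun c : R =>
       \row_i tilt u (c, bridge_path bm t o) (z i)) g); last exact: cg.
    apply: cvg_row => i /=; apply: cvgD; first exact: cvg_cst.
    apply: cvgM; first exact: cvg_cst.
    by apply: cvgB; [exact: cvg_id|exact: cvg_cst].
  have M0 : 0 <= M by exact: le_trans (gM 0).
  apply: (@continuity_under_integral R _ T P _ setT measurableT _ _ _ _ (cst M)).
  - move=> c _; apply: (@bounded_integrable _ _ _ _ _ M) => //.
      exact: probability_lty.
    apply: (measurableT_comp mF); exact: measurable_tilted.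
  - by apply: aeW => o _ c _; exact: cg'.
  - apply: (@bounded_integrable _ _ _ _ _ M) => //.
      exact: probability_lty.
    by move=> o; rewrite ger0_norm.
  - by move=> c _; apply: aeW => o _; exact: gM.
move=> n z zt E C mE mC.
have mS : measurable_fun setT (fun o => u + mu * t + Y t o).
  by apply: measurable_funD => //; exact: (bm_meas bm).
pose S : {mfun T >-> R} := mfun_Sub (mem_set mS).
pose A := [set w : path_space t | forall i, E i (w (z i))].
have mA : measurable A.
  rewrite (_ : A = \big[setI/setT]_(i < n) [set w : path_space t | E i (w (z i))]).
    apply: bigsetI_measurable => i _; rewrite -[X in measurable X]setTI.
    exact: measurable_evaluation.
  apply/seteqP; split=> w /=.
    by move=> H; elim/big_rec: _ => // i B _; split => //; exact: H.
  by move=> H i; move: H; rewrite (bigD1 i) //=; case.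
have SX z' : 0 <= z' -> {ae P, forall o, started_at u X z' o = u + mu * z' + Y z' o}.
  move=> z'0; apply: filterS (XY _ z'0) => o /= Xo.
  by rewrite -addrA -Xo.
have mX z' (D : set R) : measurable D -> measurable [set o | D (started_at u X z' o)].
  move=> mD; rewrite -[X in measurable X]setTI.
  exact: (measurable_funPT (started_at u X z')).
have mAX : measurable [set o | forall i : 'I_n, E i (started_at u X (z i) o)].
  rewrite (_ : [set o | _] = \big[setI/setT]_(i < n) [set o | E i (started_at u X (z i) o)]).
    by apply: bigsetI_measurable => i _; exact: mX.
  apply/seteqP; split=> w /=.
    by move=> H; elim/big_rec: _ => // i B _; split => //; exact: H.
  by move=> H i; move: H; rewrite (bigD1 i) //=; case.
transitivity (\int[distribution P S]_(c in C) bridge_pker bm t u c A)%E; last first.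
  apply: eq_measure_integral => D mD _; 
  apply: (@measure_ae_eq _ _ T P (S @^-1` D) [set o | D (started_at u X t o)]).
  - by move: (mS measurableT _ mD); rewrite setTI.
  - exact: mX.
  - by apply: filterS (SX _ (ltW t0)) => o /= ->.
rewrite -(@disintegration u mu S) //; apply: measure_ae_eq.
- exact: measurableI (mX _ _ mC) mAX.
- apply: measurableI; first by move: (mS measurableT _ mC); rewrite setTI.
  have mtS : measurable_fun setT (fun o => tilt u (S o, bridge_path bm t o)).
    apply: measurableT_comp; first exact: measurable_tilt.
    by apply: measurable_fun_pair => //; exact: measurable_bridge_path.
  by rewrite -[X in measurable X]setTI; by apply: mtS.
have H : {ae P, forall o, forall i : 'I_n, started_at u X (z i) o = u + mu * z i + Y (z i) o}.
  by apply: filter_forall => i; apply: SX; have /andP[] := zt i.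
apply: filterS2 H (SX _ (ltW t0)) => o /= Ho ->.
split=> -[Co HA]; split=> // i.
  by have := HA i; rewrite Ho -(tilt_bridge u mu (z i) o); exact.
by rewrite Ho -(tilt_bridge u mu (z i) o); exact: HA.
Qed.

End bridge_law.

(** * Uniqueness of the bridge laws *)

(** Continuous approximation of the indicator of the ray above a: 0 up to a, and
1 from a + e on. *)
Definition ramp (R : realType) (a e x : R) : R := Num.min 1 (Num.max 0 ((x - a) / e)).

Lemma ramp_ge0 (R : realType) (a e x : R) : 0 <= ramp a e x.
Proof. by rewrite /ramp le_min ler01 le_max lexx. Qed.

Lemma ramp_le1 (R : realType) (a e x : R) : ramp a e x <= 1.
Proof. by rewrite /ramp ge_min lexx. Qed.

Lemma ramp0 (R : realType) (a e x : R) : 0 < e -> x <= a -> ramp a e x = 0.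
Proof.
move=> e0 xa; rewrite /ramp (_ : Num.max _ _ = 0) ?min_r //.
by apply/max_idPl; rewrite pmulr_lle0 ?invr_gt0 // subr_le0.
Qed.

Lemma ramp1 (R : realType) (a e x : R) : 0 < e -> a + e <= x -> ramp a e x = 1.
Proof.
move=> e0 xa; apply/min_idPl; rewrite le_max; apply/orP; right.
by rewrite ler_pdivlMr // mul1r lerBrDl.
Qed.

Lemma continuous_ramp (R : realType) (a e : R) : continuous (ramp a e).
Proof.
move=> x; apply: (@continuous_min R R (cst 1) (fun x => Num.max 0 ((x - a) / e)) x).
  exact: cvg_cst.
apply: (@continuous_max R R (cst 0) (fun x => (x - a) / e) x); first exact: cvg_cst.
by apply: cvgM; [apply: cvgB; [exact: cvg_id|exact: cvg_cst]|exact: cvg_cst].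
Qed.

Lemma borel_rays (R : realType) (E : set R) :
  measurable E <-> <<s @RGenOInfty.G R >> E.
Proof.
have H : @measurable _ (measurableTypeR R) = <<s @RGenOInfty.G R >>.
  exact: RGenOInfty.measurableE.
by split=> h; [rewrite -H; exact: h|move: h; rewrite -H].
Qed.

Definition ray_cylinder (R : realType) (t : R) n (z a : nat -> R) : set (path_space t) :=
  cylinder (fun z (w : cpath t) => w z) n z (fun i => `]a i, +oo[%classic).
Arguments ray_cylinder {R} t n z a.

Lemma measurable_ray_cylinder (R : realType) (t : R) n (z a : nat -> R) :
  (forall i, (i < n)%N -> 0 <= z i <= t) -> measurable (ray_cylinder t n z a).
Proof.
by move=> zt; apply: (@coordinate_events_cylinder R _ _ _ [set z | 0 <= z <= t]).
Qed.

Lemma measure_indic (R : realType) d (T : measurableType d)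
    (m : {measure set T -> \bar R}) (A : set T) : measurable A ->
  m A = (\int[m]_x (\1_A x)%:E)%E.
Proof. by move=> mA; rewrite integral_indic // setIT. Qed.

Lemma continuous_prod (R : realType) (U : topologicalType) (I : Type)
    (s : seq I) (f : I -> U -> R) : (forall i, continuous (f i)) ->
  continuous (fun x => \prod_(i <- s) f i x).
Proof.
move=> cf; elim: s => [|i s IH].
  rewrite (_ : (fun x => _) = cst 1); first by move=> x; exact: cvg_cst.
  by apply/funext => x; rewrite big_nil.
rewrite (_ : (fun x => _) = (fun x => f i x * \prod_(j <- s) f j x)).
  by move=> x; apply: cvgM; [exact: cf|exact: IH].
by apply/funext => x; rewrite big_cons.
Qed.

Section uniqueness.
Context (R : realType) d (T : measurableType d) (P : probability T R).
Context (V : R -> {RV P >-> R}) (t : R).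
Context (t0 : 0 <= t).
Context (V_charges : forall a b : R, a < b ->
  (0 < distribution P (V t) `]a, b[%classic)%E).

Definition ramp_prod n (z a : nat -> R) (e : R) (w : path_space t) : R :=
  \prod_(i < n) ramp (a i) e (w (z i)).

Lemma ramp_prod_ge0 n z a e w : 0 <= ramp_prod n z a e w.
Proof. by apply: prodr_ge0 => i _; exact: ramp_ge0. Qed.

Lemma ramp_prod_le n z a e w : 0 < e ->
  ramp_prod n z a e w <= \1_(ray_cylinder t n z a) w.
Proof.
move=> e0; rewrite indicE; case: (boolP (w \in _)) => [_|].
  by apply: prodr_ile1 => i _; rewrite ramp_ge0 ramp_le1.
rewrite notin_setE => H.
have [i Hi] : exists i : 'I_n, w (z i) <= a i.
  apply: contrapT => nH; apply: H => i ii /=; rewrite in_itv /= andbT ltNge.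
  by apply/negP => H; apply: nH; exists (Ordinal ii).
by rewrite /ramp_prod (bigD1 i) //= ramp0 // mul0r.
Qed.

Lemma ramp_prod_ge n z a e w : 0 < e ->
  \1_(ray_cylinder t n z (fun i => a i + e)) w <= ramp_prod n z a e w.
Proof.
move=> e0; rewrite indicE; case: (boolP (w \in _)) => [|_]; last exact: ramp_prod_ge0.
rewrite inE => H; rewrite /ramp_prod big1 // => i _; rewrite ramp1 //.
by have := H i (ltn_ord i); rewrite /= in_itv /= andbT => /ltW.
Qed.

Definition ramp_mean (Q0 : R.-pker R ~> path_space t) n z a e c :=
  \int[Q0 c]_w ramp_prod n z a e w.

Lemma measurable_ramp_prod n z a e : (forall i, (i < n)%N -> 0 <= z i <= t) ->
  measurable_fun setT (ramp_prod n z a e).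
Proof.
move=> zt; apply: measurable_prod => i _.
apply: (measurableT_comp (continuous_measurable_fun (@continuous_ramp R (a i) e))).
by apply: measurable_evaluation; exact: zt.
Qed.

Lemma ramp_prod_le1 n z a e w : 0 < e -> ramp_prod n z a e w <= 1.
Proof.
move=> e0; apply: le_trans (ramp_prod_le n z a w e0) _.
by rewrite indicE; case: (_ \in _).
Qed.

Lemma kernel_lty (Q0 : R.-pker R ~> path_space t) c : (Q0 c setT < +oo)%E.
Proof. by rewrite prob_kernel ltry. Qed.

Lemma ramp_meanE (Q0 : R.-pker R ~> path_space t) n z a e c : 0 < e ->
  (forall i, (i < n)%N -> 0 <= z i <= t) ->
  (ramp_mean Q0 n z a e c)%:E = (\int[Q0 c]_w (ramp_prod n z a e w)%:E)%E.
Proof.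
move=> e0 zt; rewrite /ramp_mean /Rintegral fineK //.
apply: integrable_fin_num => //.
apply: (@bounded_integrable _ _ _ _ _ 1); first exact: kernel_lty.
  exact: measurable_ramp_prod.
by move=> w; rewrite ger0_norm ?ramp_prod_ge0 // ramp_prod_le1.
Qed.

Lemma ramp_mean_le (Q0 : R.-pker R ~> path_space t) n z a e c : 0 < e ->
  (forall i, (i < n)%N -> 0 <= z i <= t) ->
  ((ramp_mean Q0 n z a e c)%:E <= Q0 c (ray_cylinder t n z a))%E.
Proof.
move=> e0 zt; have mC := measurable_ray_cylinder a zt.
rewrite ramp_meanE // measure_indic //.
apply: ge0_le_integral => //.
- by move=> w _; rewrite lee_fin ramp_prod_ge0.
- by apply/measurable_EFinP; exact: measurable_ramp_prod.
- by apply/measurable_EFinP; exact: measurable_indic.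
- by move=> w _; rewrite lee_fin ramp_prod_le.
Qed.

Lemma ramp_mean_ge (Q0 : R.-pker R ~> path_space t) n z a e c : 0 < e ->
  (forall i, (i < n)%N -> 0 <= z i <= t) ->
  (Q0 c (ray_cylinder t n z (fun i => a i + e)%R) <= (ramp_mean Q0 n z a e c)%:E)%E.
Proof.
move=> e0 zt; have mC := measurable_ray_cylinder (fun i => a i + e) zt.
rewrite ramp_meanE // measure_indic //.
apply: ge0_le_integral => //.
- by apply/measurable_EFinP; exact: measurable_indic.
- by apply/measurable_EFinP; exact: measurable_ramp_prod.
- by move=> w _; rewrite lee_fin ramp_prod_ge.
Qed.

Lemma continuous_ramp_mean (Q0 : R.-pker R ~> path_space t) n z a e : 0 < e ->
  bridge_law V Q0 -> (forall i, (i < n)%N -> 0 <= z i <= t) ->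
  continuous (ramp_mean Q0 n z a e).
Proof.
move=> e0 [_ H] zt.
pose g (x : 'rV[R]_n) := \prod_(i < n) ramp (a i) e (x 0 i).
have cg : continuous g.
  apply: continuous_prod => i x.
  apply: (@continuous_comp _ _ _ (fun x : 'rV[R]_n => x 0 i) (ramp (a i) e)).
    exact: coord_continuous.
  exact: continuous_ramp.
have gM : exists M, forall x, `|g x| <= M.
  exists 1 => x; rewrite ger0_norm; last by apply: prodr_ge0 => i _; exact: ramp_ge0.
  by apply: prodr_ile1 => i _; rewrite ramp_ge0 ramp_le1.
suff -> : ramp_mean Q0 n z a e = (fun c => \int[Q0 c]_w g (\row_i w (z i))).
  exact: (H n (fun i : 'I_n => z i) (fun i => zt i (ltn_ord i)) g cg gM).
apply/funext => c; rewrite /ramp_mean; apply: eq_Rintegral => w _.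
by rewrite /g /ramp_prod; apply: eq_bigr => i _; rewrite mxE.
Qed.

(** Otherwise, by continuity in c, the inequality would fail by a fixed amount on
a whole interval of endpoints. Integrated over this interval, which the law of
V t charges, this contradicts that both kernels disintegrate the law of V. *)
Lemma ramp_mean_cmp (Q0 Q1 : R.-pker R ~> path_space t) n z a e c :
  bridge_law V Q0 -> bridge_law V Q1 -> 0 < e ->
  (forall i, (i < n)%N -> 0 <= z i <= t) ->
  ramp_mean Q0 n z (fun i => a i + e) e c <= ramp_mean Q1 n z a e c.
Proof.
move=> Q0V Q1V e0 zt; rewrite leNgt; apply/negP => lt01.
set a' := fun i => a i + e in lt01.
set x1 := ramp_mean Q1 _ _ _ _ _ in lt01; set x0 := ramp_mean Q0 _ _ _ _ _ in lt01.
pose m := (x1 + x0) / 2; pose de := (x0 - x1) / 4.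
have de0 : 0 < de by rewrite /de; lra.
have n0 : \forall c' \near c, m + de < ramp_mean Q0 n z a' e c'.
  have := @continuous_ramp_mean Q0 n z a' e e0 Q0V zt c.
  move=> /cvgr_gt; apply; rewrite -/x0 /m /de; lra.
have n1 : \forall c' \near c, ramp_mean Q1 n z a e c' < m - de.
  have := @continuous_ramp_mean Q1 n z a e e0 Q1V zt c.
  move=> /cvgr_lt; apply; rewrite -/x1 /m /de; lra.
have [r /= r0 cr] : nbhs_ball c [set c' | m + de < ramp_mean Q0 n z a' e c' /\
    ramp_mean Q1 n z a e c' < m - de].
  by apply/nbhs_ballP; near=> c'; split; near: c'.
pose I := `]c - r, c + r[%classic.
have Icr c' : I c' -> m + de < ramp_mean Q0 n z a' e c' /\
    ramp_mean Q1 n z a e c' < m - de.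
  rewrite /I /= in_itv /= => /andP[c1 c2]; apply: cr.
  by rewrite /ball /= ltr_distlC; apply/andP; split; lra.
have mC := measurable_ray_cylinder a' zt.
pose D := distribution P (V t).
have mI : measurable I by exact: measurable_itv.
have D0 : (0 < D I)%E by apply: V_charges; lra.
have Dfin : D I \is a fin_num by exact: fin_num_measure.
have intE (Q2 : R.-pker R ~> path_space t) : bridge_law V Q2 ->
  (\int[D]_(c in I) Q2 c (ray_cylinder t n z a') =
   P [set o | I (V t o) /\ forall i : 'I_n, `]a' i, +oo[%classic (V (z i) o)])%E.
  move=> [H _].
  have -> : ray_cylinder t n z a' = [set w | forall i : 'I_n, `]a' i, +oo[%classic (w (z i))].
    apply/seteqP; split=> w H'; first by move=> i; exact: H'.
    by move=> i ii; exact: (H' (Ordinal ii)).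
  apply/esym; apply: (H n (fun i : 'I_n => z i) (fun i => zt i (ltn_ord i))
    (fun i => `]a' i, +oo[%classic)) => //.
have : ((m + de)%:E * D I <= (m - de)%:E * D I)%E.
  apply: (@le_trans _ _ (\int[D]_(c in I) Q0 c (ray_cylinder t n z a'))%E).
    rewrite -integral_cst //; apply: ge0_le_integral => //.
    - move=> c' /Icr [_ h]; rewrite lee_fin.
      have h' : 0 <= ramp_mean Q1 n z a e c'.
        by apply: Rintegral_ge0 => w _; exact: ramp_prod_ge0.
      move: de0 h h'; clear; move: (ramp_mean _ _ _ _ _ _) => x; lra.
    - by apply: measurable_funTS; exact: measurable_kernel.
    - move=> c' /Icr [h _]; apply: (@le_trans _ _ (ramp_mean Q0 n z a' e c')%:E).
        by rewrite lee_fin ltW.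
      exact: ramp_mean_le.
  rewrite intE // -(intE Q1) // -integral_cst //; apply: ge0_le_integral => //.
  - by apply: measurable_funTS; exact: measurable_kernel.
  - move=> c' /Icr [_ h]; apply: (@le_trans _ _ (ramp_mean Q1 n z a e c')%:E).
      exact: ramp_mean_ge.
    by rewrite lee_fin ltW.
rewrite lee_pmul2r //; rewrite lee_fin; move: de0; lra.
Unshelve. all: by end_near.
Qed.

(** Open rays are exhausted from inside, so the comparison of ramps passes to the
limit of vanishing widths. *)
Lemma ray_cylinder_le (Q0 Q1 : R.-pker R ~> path_space t) n z a c :
  bridge_law V Q0 -> bridge_law V Q1 ->
  (forall i, (i < n)%N -> 0 <= z i <= t) ->
  (Q0 c (ray_cylinder t n z a) <= Q1 c (ray_cylinder t n z a))%E.
Proof.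
move=> Q0V Q1V zt; pose e k : R := k.+1%:R^-1.
have e0 k : 0 < e k by rewrite invr_gt0.
pose F k := ray_cylinder t n z (fun i => a i + e k + e k).
have UF : \bigcup_k F k = ray_cylinder t n z a.
  apply/seteqP; split=> [w [k _ Hw] i ii|w Hw].
    have := Hw i ii; rewrite /= !in_itv /= !andbT; have := e0 k; lra.
  pose gap i : R := (if (i < n)%N then w (z i) - a i else 1) / 2.
  have gap0 i : 0 < gap i.
    rewrite /gap; case: ifP => [ii|_]; last by rewrite divr_gt0.
    by have := Hw i ii; rewrite /= in_itv /= andbT => h; rewrite divr_gt0 // subr_gt0.
  have : \forall k \near \oo, forall i : 'I_n, e k < gap i.
    apply: (@filter_forall _ 'I_n (fun i k => e k < gap i)) => i.
    exact: (near_infty_natSinv_lt (PosNum (gap0 i))).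
  move=> [k _ Hk]; exists k => // i ii /=.
  have := Hk k (leqnn k) (Ordinal ii); rewrite /gap /= ii in_itv /= andbT; lra.
have mF k : measurable (F k) by exact: measurable_ray_cylinder.
have ndF : {homo F : n m / (n <= m)%N >-> (n <= m)%O}.
  move=> k l kl; apply/subsetPset => w Hw i ii; have := Hw i ii.
  rewrite /= !in_itv /= !andbT; apply: le_lt_trans.
  have ekl : e l <= e k by rewrite /e lef_pV2 ?posrE // ler_nat ltnS.
  by rewrite -!addrA !lerD.
have := @nondecreasing_cvg_mu _ _ _ (Q0 c) F mF _ ndF.
rewrite UF => /(_ (measurable_ray_cylinder a zt)) /cvg_lim => <- //.
apply: lime_le.
  apply: ereal_nondecreasing_is_cvgn => k l kl.
  by apply: le_measure; rewrite ?inE //; apply/subsetPset; exact: ndF.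
apply: nearW => k /=.
apply: (@le_trans _ _ (ramp_mean Q0 n z (fun i => a i + e k) (e k) c)%:E).
  exact: ramp_mean_ge.
apply: (@le_trans _ _ (ramp_mean Q1 n z a (e k) c)%:E).
  by rewrite lee_fin ramp_mean_cmp.
exact: ramp_mean_le.
Qed.

(** Ray cylinders generate the sigma-algebra of the path space. *)
Lemma bridge_law_unique (Q0 Q1 : R.-pker R ~> path_space t) c A :
  bridge_law V Q0 -> bridge_law V Q1 -> measurable A -> Q0 c A = Q1 c A.
Proof.
move=> Q0V Q1V mA.
apply: (@measure_eq_cylinders_gen R _ (path_space t) R (fun z w => w z)
  [set z | 0 <= z <= t] (@RGenOInfty.G R)) => //.
- by exists 0; rewrite /= lexx.
- by exists `]0, +oo[%classic; exists 0.
- exact: borel_rays.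
- by move=> z /measurable_evaluation.
- exact: kernel_lty.
- move=> n z E zt GE.
  have [a aE] := choice GE.
  have -> : cylinder (fun z (w : cpath t) => w z) n z E = ray_cylinder t n z a.
    by apply/seteqP; split=> w H i ii; have := H i ii; rewrite aE.
  by apply/eqP; rewrite eq_le !ray_cylinder_le.
Qed.

End uniqueness.

(** * The heat semigroup and the Markov property for integrals *)

Lemma indep_integral (R : realType) d d1 d2 (T : measurableType d)
    (U : measurableType d1) (U' : measurableType d2) (P : probability T R)
    (W : {mfun T >-> U}) (D : {mfun T >-> U'}) (Phi : U * U' -> \bar R) :
  (forall S F, measurable S -> measurable F ->
     indep_events P (W @^-1` S) (D @^-1` F)) ->
  measurable_fun setT Phi -> (forall x, (0 <= Phi x)%E) ->
  (\int[P]_o Phi (W o, D o) =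
   \int[P]_o \int[distribution P D]_y Phi (W o, y))%E.
Proof.
move=> ind mPhi Phi0.
have mWD : measurable_fun setT (fun o => (W o, D o)) by exact: measurable_fun_pair.
pose m1 := image_measure P mWD.
pose m2 : {measure set (U * U') -> \bar R} := (distribution P W \x distribution P D)%E.
have m12 A : measurable A -> m1 A = m2 A.
  apply: measure_eq_rectangles.
    rewrite /= /pushforward preimage_setT; exact: probability_lty.
  move=> S F mS mF; transitivity (distribution P W S * distribution P D F)%E.
    exact: ind.
  by apply/esym; exact: product_measure1E.
transitivity (\int[m1]_x Phi x)%E.
  by rewrite ge0_integral_pushforward // preimage_setT.
rewrite (eq_measure_integral m2); last by move=> A mA _; exact: m12.
rewrite fubini_tonelli1 // /fubini_F.
rewrite [LHS]ge0_integral_distribution //.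
  exact: measurable_fun_fubini_tonelli_F.
by move=> x; exact: integral_ge0.
Qed.

Lemma Rintegral_cvg (R : realType) d (T : measurableType d)
    (P : {measure set T -> \bar R}) (f_ : nat -> T -> R) (f : T -> R) (M : R) :
  (P setT < +oo)%E -> (forall n, measurable_fun setT (f_ n)) ->
  (forall n x, `|f_ n x| <= M) ->
  (forall x, f_ n x @[n --> \oo] --> f x) ->
  \int[P]_x f_ n x @[n --> \oo] --> \int[P]_x f x.
Proof.
move=> Poo mf fM fc.
have mfl : measurable_fun setT f.
  by apply: (@measurable_fun_cvg _ _ _ setT f_) => // x _; exact: fc.
have fM' x : `|f x| <= M.
  have h : `|f_ n x| @[n --> \oo] --> `|f x| by apply: cvg_norm; exact: fc.
  rewrite -(cvg_lim _ h) //; apply: limr_le; first by apply/cvg_ex; exists `|f x|.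
  by apply: nearW => n.
have M0 (x : T) : 0 <= M by apply: le_trans (fM' x).
have int_f (g : T -> R) : measurable_fun setT g -> (forall x, `|g x| <= M) ->
    P.-integrable setT (EFin \o g) by move=> mg gM; exact: (@bounded_integrable _ _ _ _ g M).
apply: fine_cvg; rewrite fineK; last by apply: integrable_fin_num => //; exact: int_f.
apply: (@dominated_cvg _ _ _ P setT measurableT (fun n x => (f_ n x)%:E)
  (fun x => (f x)%:E) (fun=> M%:E)) => //.
- by move=> n; exact/measurable_EFinP.
- by move=> x _; apply: cvg_EFin; [exact: nearW|exact: fc].
- have [x|noT] := pselect (exists x : T, True); last first.
    rewrite (_ : setT = set0); first exact: integrable_set0.
    by apply/seteqP; split=> // x _; apply: noT; exists x.
  case: x => x _; apply: (@bounded_integrable _ _ _ _ (fun=> M) M) => // y.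
  by rewrite ger0_norm ?(M0 x).
- by move=> n x _; rewrite lee_fin.
Qed.

Lemma Rintegral_prob_cst (R : realType) d (T : measurableType d)
    (P : probability T R) (M : R) : \int[P]_x M = M.
Proof.
rewrite Rintegral_cst // [X in fine X](_ : _ = 1%E) ?mulr1 //.
exact: probability_setT.
Qed.

Lemma Rintegral_le_cst (R : realType) d (T : measurableType d)
    (P : probability T R) (f : T -> R) (M : R) : measurable_fun setT f ->
  (forall x, `|f x| <= M) -> `|\int[P]_x f x| <= M.
Proof.
move=> mf fM; have M0 : 0 <= M by apply: le_trans (fM point).
have intf : P.-integrable setT (EFin \o f).
  by apply: (@bounded_integrable _ _ _ _ f M) => //; exact: probability_lty.
apply: le_trans (le_normr_Rintegral measurableT intf) _.
rewrite -[leRHS](Rintegral_prob_cst P); apply: le_Rintegral => //.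
- apply: (@bounded_integrable _ _ _ _ (fun x => `|f x|) M).
  + exact: probability_lty.
  + exact: measurableT_comp.
  + by move=> x /=; rewrite normr_id.
- apply: (@bounded_integrable _ _ _ _ (cst M) M) => //; first exact: probability_lty.
  by move=> x; rewrite /= ger0_norm.
Qed.

Definition lip (R : realType) (G : R -> R) (L : R) := forall x y, `|G x - G y| <= L * `|x - y|.

Lemma lip_continuous (R : realType) (G : R -> R) (L : R) : lip G L -> continuous G.
Proof.
move=> GL x; apply/cvgrPdist_le => /= e e0.
have L1 : 0 < `|L| + 1 by rewrite ltr_wpDl.
near=> y; apply: le_trans (GL x y) _.
apply: (@le_trans _ _ ((`|L| + 1) * `|x - y|)).
  by rewrite ler_wpM2r // (le_trans (ler_norm _)) // lerDl.
rewrite -ler_pdivlMl //; near: y.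
by apply: cvgr_dist_le; [exact: cvg_id|rewrite mulr_gt0 // invr_gt0].
Unshelve. all: by end_near.
Qed.

Lemma lip_measurable (R : realType) (G : R -> R) (L : R) :
  lip G L -> measurable_fun setT G.
Proof. by move=> /lip_continuous /continuous_measurable_fun. Qed.

Lemma Rintegral_indicl (R : realType) d (T : measurableType d)
    (P : {measure set T -> \bar R}) (A : set T) (f : T -> R) :
  \int[P]_(x in A) f x = \int[P]_x (\1_A x * f x).
Proof.
by rewrite /Rintegral integral_indicl; congr fine.
Qed.

Section heat.
Context (R : realType).

Definition gaussP (v : R) : probability (measurableTypeR R) R :=
  normal_prob 0 (Num.sqrt v).

(** The heat semigroup: mean of G after a centred Gaussian displacement of
variance v. *)
Definition heat (v : R) (G : R -> R) (x : R) : R := \int[gaussP v]_y G (x + y).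

Lemma gaussPE v E : gaussP v E = normal_prob 0 (Num.sqrt v) E.
Proof. by []. Qed.

Lemma gaussP_opp v (E : set R) : 0 < v -> measurable E ->
  gaussP v (-%R @^-1` E) = gaussP v E.
Proof.
move=> v0 mE; rewrite !gaussPE.
rewrite !normal_probE.
rewrite -[RHS](@lebesgue_integral_opp R (fun x => (\1_E x * gauss v x)%:E)); first last.
- by move=> x; rewrite lee_fin mulr_ge0 // gauss_ge0.
- apply/measurable_EFinP; apply: measurable_funM; last exact: measurable_gauss.
  exact: measurable_indic.
- by apply: eq_integral => x _; rewrite gaussN.
Qed.

Lemma measurable_shift (G : R -> R) (z : R) : measurable_fun setT G ->
  measurable_fun (setT : set (measurableTypeR R)) (fun y : R => G (z + y)).
Proof. by move=> mG; apply: (measurableT_comp mG); exact: measurable_funD. Qed.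

Lemma gauss_integrable v (z : R) (G : R -> R) (M : R) : measurable_fun setT G ->
  (forall x, `|G x| <= M) ->
  (gaussP v).-integrable setT (EFin \o (fun y : R => G (z + y))).
Proof.
move=> mG GM; apply: (@bounded_integrable R _ (measurableTypeR R) (gaussP v)
  (fun y : R => G (z + y)) M).
- exact: probability_lty.
- exact: measurable_shift.
- by move=> y; exact: GM.
Qed.

Lemma measurable_heat v (G : R -> R) M : measurable_fun setT G ->
  (forall x, `|G x| <= M) -> measurable_fun setT (heat v G).
Proof.
move=> mG GM.
have GM0 x : 0 <= G x + M by have := GM x; rewrite ler_norml => /andP[]; lra.
pose f (p : (measurableTypeR R * measurableTypeR R)%type) : \bar R := (G (p.1 + p.2) + M)%:E.
have mf : measurable_fun setT f.
  apply/measurable_EFinP; apply: measurable_funD => //; apply: (measurableT_comp mG).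
  exact: measurable_funD.
have f0 p : (0 <= f p)%E by rewrite lee_fin.
have := @measurable_fun_fubini_tonelli_F _ _ (measurableTypeR R) (measurableTypeR R)
  R (gaussP v) f mf f0.
rewrite /fubini_F /f /= => mF.
have -> : heat v G = (fun x => fine (\int[gaussP v]_y (G (x + y) + M)%:E)%E - M).
  apply/funext => x; have intG := gauss_integrable v x mG GM.
  under [in RHS]eq_integral do rewrite EFinD.
  rewrite integralD //; last exact: finite_measure_integrable_cst.
  rewrite integral_cst // [X in (_ * X)%E](_ : _ = 1%E) ?mule1; last exact: probability_setT.
  rewrite fineD //=; last exact: integrable_fin_num.
  by rewrite /heat /Rintegral addrK.
apply: measurable_funB => //; apply: measurableT_comp => //.
Qed.

Lemma heat_le v (G : R -> R) M x : measurable_fun setT G -> (forall x, `|G x| <= M) ->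
  `|heat v G x| <= M.
Proof.
move=> mG GM; apply: Rintegral_le_cst => //.
exact: measurable_shift.
Qed.

Lemma heat_odd v (G : R -> R) M x : 0 < v -> measurable_fun setT G -> (forall x, `|G x| <= M) ->
  (forall x, G (- x) = - G x) -> heat v G (- x) = - heat v G x.
Proof.
move=> v0 mG GM Godd.
have mN : measurable_fun (setT : set (measurableTypeR R))
    (fun x : measurableTypeR R => - x : measurableTypeR R).
  exact: oppr_measurable.
have intG z := gauss_integrable v z mG GM.
transitivity (\int[image_measure (gaussP v) mN]_y G (- x + y)).
  rewrite /heat /Rintegral; congr fine; apply: eq_measure_integral => A mA _.
  by rewrite -[LHS]gaussP_opp.
rewrite (@Rintegral_image R _ _ (measurableTypeR R) (measurableTypeR R) (gaussP v)
  _ mN (fun y : R => G (- x + y)) M); first last.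
- by move=> y; exact: GM.
- exact: measurable_shift.
- exact: probability_lty.
rewrite -[RHS]mulN1r -RintegralZl //.
by apply: eq_Rintegral => y _; rewrite -opprD Godd mulN1r.
Qed.

Lemma heat_lip v (G : R -> R) M L : 0 <= L -> (forall x, `|G x| <= M) -> lip G L -> lip (heat v G) L.
Proof.
move=> L0 GM GL x x'; have mG := lip_measurable GL.
have intG z := gauss_integrable v z mG GM.
rewrite /heat -RintegralB //; apply: Rintegral_le_cst.
  by apply: measurable_funB; exact: measurable_shift.
by move=> y; apply: le_trans (GL _ _) _; rewrite opprD addrACA subrr addr0.
Qed.

End heat.

Section markov_integral.
Context (R : realType) d (T : measurableType d) (P : probability T R).
Context (Y : R -> T -> R) (bm : clean_bm P Y) (u : R).

Lemma measurable_V z : measurable_fun setT (fun o => u + Y z o).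
Proof. by apply: measurable_funD => //; exact: (bm_meas bm). Qed.

(** The increment after r is independent of A and of the value at r, so it can be
integrated out first. *)
Lemma markov_integral r a (A : set T) (G : R -> R) (M : R) :
  0 <= r -> r < a -> past Y r A -> measurable_fun setT G ->
  (forall x, `|G x| <= M) ->
  \int[P]_(o in A) G (u + Y a o) = \int[P]_(o in A) heat (a - r) G (u + Y r o).
Proof.
move=> r0 ra pA mG GM.
have mA : measurable A := past_measurable bm pA.
have ar0 : 0 < a - r by rewrite subr_gt0.
have M0 : 0 <= M by exact: le_trans (GM 0).
have mW : measurable_fun setT (fun o => (\1_A o : R, u + Y r o)).
  by apply: measurable_fun_pair; [exact: measurable_indic|exact: measurable_V].
have mD : measurable_fun setT (fun o => Y a o - Y r o : measurableTypeR R).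
  by apply: measurable_funB; exact: (bm_meas bm).
pose W : {mfun T >-> (R * R)%type} := mfun_Sub (mem_set mW).
pose D : {mfun T >-> measurableTypeR R} :=
  @mfun_Sub _ _ T (measurableTypeR R) (fun o => Y a o - Y r o) (mem_set mD).
(* The shift by M and the truncation at 0 only make Phi nonnegative everywhere. *)
pose Phi (p : (R * R * measurableTypeR R)%type) : \bar R := (Num.max 0 p.1.1 * (G (p.1.2 + p.2) + M))%:E.
have GM0 x : 0 <= G x + M by have := GM x; rewrite ler_norml => /andP[]; lra.
have mPhi : measurable_fun setT Phi.
  apply/measurable_EFinP; apply: measurable_funM.
    apply: measurable_maxr => //.
    by apply: (measurableT_comp measurable_fst); exact: measurable_fst.
  apply: measurable_funD => //; apply: (measurableT_comp mG).
  apply: measurable_funD; last exact: measurable_snd.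
  by apply: (measurableT_comp measurable_snd); exact: measurable_fst.
have indWD (S : set (R * R)%type) (F : set (measurableTypeR R)) : measurable S -> measurable F ->
    indep_events P (W @^-1` S) (D @^-1` F).
  move=> mS mF; apply: (past_indep bm r0 (ltW ra) mF).
  have mW' : measurable_fun (setT : set (g_sigma_algebraType
      (coordinate_events Y [set z | 0 <= z <= r]))) (fun o => (\1_A o : R, u + Y r o)).
    apply: measurable_fun_pair; first exact: (measurable_indic (pA : measurable (A :
      set (g_sigma_algebraType (coordinate_events Y [set z | 0 <= z <= r]))))).
    by apply: measurable_funD => //; apply: past_Y_measurable; rewrite r0 lexx.
  by have := mW' measurableT S mS; rewrite setTI.
have Phi0 x : (0 <= Phi x)%E by rewrite lee_fin mulr_ge0 // le_max lexx.
have maxA o : Num.max 0 (\1_A o) = \1_A o :> R by rewrite max_r.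
have mV := measurable_V.
have mGV : measurable_fun setT (fun o => G (u + Y a o)) by exact: measurableT_comp.
have mH : measurable_fun setT (heat (a - r) G) by exact: measurable_heat.
have mHV : measurable_fun setT (fun o => heat (a - r) G (u + Y r o)).
  exact: measurableT_comp.
have key : \int[P]_o (\1_A o * (G (u + Y a o) + M)) =
    \int[P]_o (\1_A o * (heat (a - r) G (u + Y r o) + M)).
  rewrite /Rintegral; congr fine.
  transitivity (\int[P]_o Phi (W o, D o))%E.
    apply: eq_integral => o _; rewrite /Phi /= maxA; congr (_ * (G _ + _))%:E.
    by rewrite -addrA; congr (_ + _); rewrite addrC subrK.
  rewrite (indep_integral indWD mPhi Phi0); apply: eq_integral => o _.
  rewrite (eq_measure_integral (gaussP (a - r))); last first.
    by move=> E mE _; exact: (bm_law bm r0 ra).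
  rewrite /Phi /= maxA.
  under eq_integral do rewrite EFinM.
  rewrite ge0_integralZl //; first last.
  - by move=> x _; rewrite lee_fin.
  - by apply/measurable_EFinP; apply: measurable_funD => //; exact: measurable_shift.
  rewrite [RHS]EFinM; congr (_ * _)%E.
  have intG := gauss_integrable (a - r) (u + Y r o) mG GM.
  under eq_integral do rewrite EFinD.
  rewrite integralD //; last exact: finite_measure_integrable_cst.
  rewrite integral_cst // EFinD; congr (_ + _)%E.
    by rewrite /heat /Rintegral fineK // integrable_fin_num.
  by rewrite [X in (_ * X)%E](_ : _ = 1%E) ?mule1 //; exact: probability_setT.
have intP (f : T -> R) (M' : R) : measurable_fun setT f -> (forall o, `|f o| <= M') ->
    P.-integrable setT (EFin \o (fun o => \1_A o * f o)).
  move=> mf fM; apply: (@bounded_integrable _ _ _ _ _ M').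
  - exact: probability_lty.
  - by apply: measurable_funM.
  - move=> o; rewrite normrM indicE; case: (_ \in _).
      by rewrite normr1 mul1r.
    by rewrite normr0 mul0r (le_trans _ (fM o)).
have split_cst (f : T -> R) : measurable_fun setT f -> (forall o, `|f o| <= M) ->
    \int[P]_o (\1_A o * (f o + M)) = \int[P]_(o in A) f o + \int[P]_o (\1_A o * M).
  move=> mf fM; rewrite (Rintegral_indicl P A f) -RintegralD //.
  - by apply: eq_Rintegral => o _; rewrite mulrDr.
  - exact: (intP f M).
  - by apply: (intP (fun=> M) M) => // o; rewrite ger0_norm.
move: key; rewrite !split_cst //; first by move=> /addIr.
by move=> o; exact: heat_le.
Qed.

End markov_integral.

(** * The reflection principle *)

Lemma heine (R : realType) (f : R -> R) (a b e : R) : continuous f -> 0 < e ->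
  exists2 del, 0 < del & forall x y, a <= x <= b -> `|x - y| < del ->
    `|f x - f y| < e.
Proof.
move=> cf e0.
pose Q (del x : R) := forall y, `|x - y| < del -> `|f x - f y| < e.
have /compact_near_coveringP cov := @segment_compact R a b.
have [del /= del0 H] : \forall del \near 0^'+, `[a, b] `<=` Q del.
  apply: cov => x _; have e20 : 0 < e / 2 by rewrite divr_gt0.
  have /cvgrPdist_lt /(_ _ e20) /nbhs_ballP[rho /= rho0 Hr] := cf x.
  have rho20 : 0 < rho / 2 by rewrite divr_gt0.
  exists (ball x (rho / 2), [set del | del < rho / 2]) => /=.
    by split; [exact: nbhsx_ballx|exact: nbhs_right_lt].
  move=> [x' del] [/= xx' drho] y x'y.
  have h1 := Hr x' _; have h2 := Hr y _.
  have : `|f x' - f y| <= `|f x - f x'| + `|f x - f y|.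
    by rewrite (distrC (f x)) ler_distD.
  move/le_lt_trans; apply; rewrite [ltRHS]splitr; apply: ltrD.
    by apply: h1; rewrite /ball /= in xx' *; apply: lt_trans xx' _; lra.
  apply: h2; rewrite /ball /= in xx' *.
  by apply: le_lt_trans (ler_distD x' _ _) _; lra.
exists (del / 2); first by rewrite divr_gt0.
move=> x y xab; have d2 : 0 < del / 2 by rewrite divr_gt0.
apply: (H (del / 2)) => //=.
by rewrite sub0r normrN gtr0_norm //; lra.
Qed.

Section grid.
Context (R : realType) (r a : R) (ra : r < a).

Definition grid (N k : nat) : R := r + k%:R / N.+1%:R * (a - r).

Lemma grid0 N : grid N 0 = r.
Proof. by rewrite /grid !mul0r addr0. Qed.

Lemma gridN N : grid N N.+1 = a.
Proof. by rewrite /grid divff ?mul1r ?pnatr_eq0 // addrC subrK. Qed.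

Lemma grid_le N j k : (j <= k)%N -> grid N j <= grid N k.
Proof.
have ar : 0 <= a - r by rewrite subr_ge0 ltW.
by move=> jk; rewrite lerD2l ler_wpM2r // ler_wpM2r ?invr_ge0 // ler_nat.
Qed.

Lemma grid_itv N k : (k <= N.+1)%N -> r <= grid N k <= a.
Proof.
move=> kN; have := @grid_le N _ _ (leq0n k); have := @grid_le N _ _ kN.
by rewrite grid0 gridN => -> ->.
Qed.

Lemma grid_lt N k : (k <= N)%N -> grid N k < a.
Proof.
move=> kN; rewrite /grid -ltrBrDl gtr_pMl ?subr_gt0 //.
by rewrite ltr_pdivrMr // mul1r ltr_nat ltnS.
Qed.

Lemma gridS N k : grid N k.+1 - grid N k = (a - r) / N.+1%:R.
Proof. by rewrite /grid -natr1; field; rewrite -(natrD _ 1 N) pnatr_eq0. Qed.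

Lemma grid_near N z : r <= z <= a ->
  exists2 k, (k <= N.+1)%N & `|z - grid N k| <= (a - r) / N.+1%:R.
Proof.
move=> /andP[rz za].
suff H k : z <= grid N k -> exists2 j, (j <= k)%N & `|z - grid N j| <= (a - r) / N.+1%:R.
  by apply: H; rewrite gridN.
have step0 : 0 <= (a - r) / N.+1%:R by rewrite divr_ge0 // subr_ge0 ltW.
elim: k => [|k IH] zk.
  by exists 0%N => //; rewrite grid0 in zk *; rewrite (_ : z = r) ?subrr ?normr0 //; lra.
have [zk'|zk'] := leP z (grid N k).
  by have [j jk H] := IH zk'; exists j => //; exact: leqW.
exists k => //; rewrite gtr0_norm ?subr_gt0 // -(gridS N k); lra.
Qed.

Lemma mesh_lt (e : R) : 0 < e -> \forall N \near \oo, (a - r) / N.+1%:R < e.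
Proof.
move=> e0; have ar : 0 < a - r by rewrite subr_gt0.
have := near_infty_natSinv_lt (PosNum (divr_gt0 e0 ar)).
apply: filterS => N /=; rewrite ltr_pdivlMr // mulrC; exact.
Qed.

(** Continuity lets a fine grid detect every excursion of the path below a level. *)
Lemma grid_below (f : R -> R) (e z : R) : {within `[r, a], continuous f} ->
  r <= z <= a -> f z < e ->
  \forall N \near \oo, exists2 k, (k <= N.+1)%N & f (grid N k) < e.
Proof.
move=> cf zra fz.
have zI : `[r, a]%classic z by rewrite /= in_itv.
have /nbhs_ballP[del /= del0 H] : \forall y \near within `[r, a] (nbhs z), f y < e.
  by have /subspace_continuousP /(_ z zI) /cvgr_lt := cf; exact.
near=> N; have [k kN zk] := grid_near N zra; exists k => //.
apply: H; last by rewrite in_itv /= grid_itv.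
rewrite /ball /=; apply: le_lt_trans zk _.
by near: N; exact: mesh_lt.
Unshelve. all: by end_near.
Qed.

End grid.

Lemma RintegralD_sub (R : realType) d (T : measurableType d)
    (P : {measure set T -> \bar R}) (X X' : set T) (f : T -> R) :
  measurable X -> measurable X' -> X `<=` X' -> P.-integrable setT (EFin \o f) ->
  \int[P]_(o in X') f o = \int[P]_(o in X) f o + \int[P]_(o in X' `\` X) f o.
Proof.
move=> mX mX' XX' intf.
rewrite -[in LHS](setDUK XX') Rintegral_setU //.
- exact: measurableD.
- by rewrite setDUK //; exact: (integrableS measurableT).
- by apply/disj_setPS => o [Xo [_ /(_ Xo)]].
Qed.

Lemma Rintegral_indic_cvg (R : realType) d (T : measurableType d)
    (P : probability T R) (X : nat -> set T) (X0 : set T) (f : T -> R) (M : R) :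
  (forall n, measurable (X n)) -> measurable_fun setT f -> (forall o, `|f o| <= M) ->
  (forall o, X0 o -> \forall n \near \oo, X n o) ->
  (forall o, ~ X0 o -> \forall n \near \oo, ~ X n o) ->
  \int[P]_(o in X n) f o @[n --> \oo] --> \int[P]_(o in X0) f o.
Proof.
move=> mX mf fM inX outX; rewrite (Rintegral_indicl P X0 f).
under eq_fun do rewrite (Rintegral_indicl P).
apply: (@Rintegral_cvg _ _ _ _ _ _ M) => [|n|n o|o].
- exact: probability_lty.
- by apply: measurable_funM => //; exact: measurable_indic.
- rewrite normrM indicE; case: (_ \in _); rewrite ?normr1 ?mul1r // normr0 mul0r.
  exact: le_trans (fM o).
- have [Xo|Xo] := pselect (X0 o).
    apply: cvg_near_cst; apply: filterS (inX o Xo) => n Xn.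
    by rewrite !indicE !mem_set.
  apply: cvg_near_cst; apply: filterS (outX o Xo) => n Xn.
  by rewrite !indicE !memNset.
Qed.

Section reflection.
Context (R : realType) d (T : measurableType d) (P : probability T R).
Context (Y : R -> T -> R) (bm : clean_bm P Y) (u r a : R) (r0 : 0 <= r) (ra : r < a).
Context (A : set T) (pA : past Y r A).
Context (G : R -> R) (M L : R) (L0 : 0 <= L) (GM : forall x, `|G x| <= M)
  (GL : lip G L) (Godd : forall x, G (- x) = - G x).

Let V z o := u + Y z o.
Let g := grid r a.
Let mG : measurable_fun setT G := lip_measurable GL.
Let mV z : measurable_fun setT (V z) := measurable_V bm u z.
Let mGV z : measurable_fun setT (fun o => G (V z o)).
Proof. exact: measurableT_comp. Qed.

Let intGV z : P.-integrable setT (EFin \o (fun o => G (V z o))).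
Proof.
apply: (@bounded_integrable _ _ _ P (fun o => G (V z o)) M) => //.
exact: probability_lty.
Qed.

Definition above (e : R) (N k : nat) : set T :=
  [set o | A o /\ forall j, (j <= k)%N -> e <= V (g N j) o].

Lemma above_sub e N j k : (j <= k)%N -> above e N k `<=` above e N j.
Proof. by move=> jk o [Ao H]; split => // i ij; apply: H; exact: leq_trans jk. Qed.

Lemma past_ge z b (e : R) : 0 <= z <= b -> past Y b [set o | e <= V z o].
Proof.
move=> zb; rewrite (_ : [set o | _] = [set o | `[e - u, +oo[%classic (Y z o)]).
  by apply: past_event => //; exact: measurable_itv.
by apply/seteqP; split=> o /=; rewrite in_itv /= andbT lerBlDl.
Qed.

Lemma grid_ge0 N k : 0 <= g N k.
Proof.
by apply: (le_trans r0); have := @grid_le _ _ _ ra N _ _ (leq0n k); rewrite grid0.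
Qed.

Lemma past_above e N k : past Y (g N k) (above e N k).
Proof.
elim: k => [|k IH].
  rewrite (_ : above e N 0 = A `&` [set o | e <= V r o]).
    rewrite /g grid0; apply: pastI => //; apply: past_ge; by rewrite r0 lexx.
  apply/seteqP; split=> o [Ao H]; split => //; first by move: (H 0%N isT); rewrite /g grid0.
  by move=> j; rewrite leqn0 => /eqP ->; rewrite /g grid0.
rewrite (_ : above e N k.+1 = above e N k `&` [set o | e <= V (g N k.+1) o]).
  apply: pastI; last by apply: past_ge; rewrite grid_ge0 lexx.
  by apply: (past_le _ IH); exact: grid_le.
apply/seteqP; split=> o.
  by move=> [Ao H]; split; [split => // j jk; apply: H; exact: leqW|exact: H].
move=> [[Ao H] H']; split => // j; rewrite leq_eqVlt => /orP[/eqP->//|].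
by rewrite ltnS; exact: H.
Qed.

Lemma measurable_above e N k : measurable (above e N k).
Proof. exact: (past_measurable bm (@past_above e N k)). Qed.

Definition oscillation (N : nat) (o : T) : R :=
  \big[Num.max/0]_(k < N.+1) `|V (g N k.+1) o - V (g N k) o|.

Lemma measurable_oscillation N : measurable_fun setT (oscillation N).
Proof.
rewrite /oscillation; elim: (index_enum _) => [|k s IH].
  by under eq_fun do rewrite big_nil; exact: measurable_cst.
under eq_fun do rewrite big_cons; apply: measurable_maxr; last exact: IH.
by apply: measurableT_comp => //; exact: measurable_funB.
Qed.

Lemma oscillation_ge0 N o : 0 <= oscillation N o.
Proof.
rewrite /oscillation; elim/big_rec: _ => // k x _ x0.
by rewrite le_max x0 orbT.
Qed.

Lemma oscillation_ge N k o : (k <= N)%N ->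
  `|V (g N k.+1) o - V (g N k) o| <= oscillation N o.
Proof.
rewrite -ltnS => kN; rewrite /oscillation (bigD1 (Ordinal kN)) //=.
by rewrite le_max lexx.
Qed.

Lemma oscillation_cvg o : oscillation N o @[N --> \oo] --> 0.
Proof.
apply/cvgrPdist_le => /= e e0.
have [del del0 H] := heine r a (@bm_cont _ _ _ _ _ bm o) e0.
have := mesh_lt ra del0; apply: filterS => N meshN.
rewrite sub0r normrN ger0_norm ?oscillation_ge0 //.
rewrite /oscillation; elim/big_ind: _ => [|x y xe ye|k _]; first exact: ltW.
  by rewrite ge_max xe.
rewrite (_ : V _ o - V _ o = Y (g N k.+1) o - Y (g N k) o); last by rewrite /V; ring.
rewrite ltW // distrC; apply: H.
  by apply: grid_itv => //; exact: ltnW.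
rewrite distrC gridS ger0_norm // divr_ge0 // subr_ge0 ltW //.
Qed.

(** Bounds what an odd L-Lipschitz function can be worth at the first grid time
where the path is below e: the path is then at distance at most
e + oscillation from 0. The cap M keeps the bound integrable. *)
Definition overshoot e N o : R := L * e + Num.min M (L * oscillation N o).

Lemma overshoot_ge0 e N o : 0 <= e -> 0 <= overshoot e N o.
Proof.
move=> e0; rewrite addr_ge0 ?mulr_ge0 // le_min; apply/andP; split.
  exact: le_trans (GM 0).
by rewrite mulr_ge0 // oscillation_ge0.
Qed.

Lemma measurable_overshoot e N : measurable_fun setT (overshoot e N).
Proof.
apply: measurable_funD => //; apply: measurable_minr => //.
by apply: measurable_funM => //; exact: measurable_oscillation.
Qed.

Lemma overshoot_le e N o : 0 <= e -> overshoot e N o <= L * e + M.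
Proof. by move=> e0; rewrite lerD2l ge_min lexx. Qed.

Lemma integrable_overshoot e N : 0 <= e -> P.-integrable setT (EFin \o overshoot e N).
Proof.
move=> e0; apply: (@bounded_integrable _ _ _ P (overshoot e N) (L * e + M)).
- exact: probability_lty.
- exact: measurable_overshoot.
- by move=> o; rewrite ger0_norm ?overshoot_ge0 // overshoot_le.
Qed.

(** The paths of this event are below e for the first time at grid time k.+1.
There, averaging G over the remaining time gives a function H which is again
odd and L-Lipschitz, hence small near 0. This replaces the strong Markov
property. *)
Lemma first_passage_step e N k : 0 <= e -> (k <= N)%N ->
  `|\int[P]_(o in above e N k `\` above e N k.+1) G (V a o)| <=
  \int[P]_(o in above e N k `\` above e N k.+1) overshoot e N o.
Proof.
move=> e0 kN; set X := _ `\` _.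
have pX : past Y (g N k.+1) X.
  have pk : past Y (g N k.+1) (above e N k).
    by apply: past_le (@past_above e N k); exact: grid_le.
  exact: (@measurableD _ (g_sigma_algebraType (coordinate_events Y
    [set z | 0 <= z <= g N k.+1])) _ _ pk (@past_above e N k.+1)).
have mX : measurable X by exact: (past_measurable bm pX).
(* At the last grid time there is no time left to average over: H is G itself. *)
have [H [HM HL Hodd ->]] : exists H : R -> R, [/\ forall x, `|H x| <= M,
    lip H L, forall x, H (- x) = - H x &
    \int[P]_(o in X) G (V a o) = \int[P]_(o in X) H (V (g N k.+1) o)].
  have [kN'|Nk] := ltnP k N.
    have ga : g N k.+1 < a by exact: grid_lt.
    have ag0 : 0 < a - g N k.+1 by rewrite subr_gt0.
    exists (heat (a - g N k.+1) G); split.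
    - by move=> x; exact: heat_le.
    - exact: (@heat_lip _ _ _ M).
    - by move=> x; exact: (@heat_odd _ _ _ M).
    - exact: (markov_integral bm u (grid_ge0 N k.+1) ga pX mG GM).
  have -> : k = N by apply/eqP; rewrite eqn_leq kN.
  by exists G; split => //; rewrite /g gridN.
have mHV : measurable_fun setT (fun o => H (V (g N k.+1) o)).
  by apply: measurableT_comp => //; exact: lip_measurable HL.
have intH : P.-integrable X (EFin \o (fun o => H (V (g N k.+1) o))).
  apply: (integrableS measurableT) => //.
  by apply: (@bounded_integrable _ _ _ P _ M) => //; exact: probability_lty.
apply: le_trans (le_normr_Rintegral mX intH) _; apply: le_Rintegral => //.
- exact: (integrable_norm intH).
- by apply: (integrableS measurableT) => //; exact: integrable_overshoot.
move=> o [[Ao Hk] Hk1].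
have Vk : e <= V (g N k) o by exact: Hk.
have Vk1 : V (g N k.+1) o < e.
  rewrite ltNge; apply/negP => Vk1; apply: Hk1; split => // j.
  by rewrite leq_eqVlt => /orP[/eqP->//|]; rewrite ltnS; exact: Hk.
have H0 : H 0 = 0 by have := Hodd 0; rewrite oppr0 => h; lra.
have HLx : `|H (V (g N k.+1) o)| <= L * `|V (g N k.+1) o|.
  by have := HL (V (g N k.+1) o) 0; rewrite H0 !subr0.
have Vx : `|V (g N k.+1) o| <= e + oscillation N o.
  have osc := oscillation_ge o kN; rewrite distrC ger0_norm in osc; last lra.
  have osc0 := oscillation_ge0 N o.
  by rewrite ler_norml; apply/andP; split; lra.
rewrite /overshoot; have [_|_] := leP M (L * oscillation N o).
  by apply: le_trans (HM _) _; rewrite lerDr mulr_ge0.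
by apply: le_trans HLx _; rewrite -mulrDr ler_wpM2l.
Qed.

(** Summation over the grid time of the first passage. *)
Lemma first_passage e N : 0 <= e ->
  `|\int[P]_(o in above e N 0) G (V a o) - \int[P]_(o in above e N N.+1) G (V a o)|
  <= \int[P]_o overshoot e N o.
Proof.
move=> e0.
have ma := measurable_above e N.
have H k : (k <= N.+1)%N ->
    `|\int[P]_(o in above e N 0) G (V a o) - \int[P]_(o in above e N k) G (V a o)|
    <= \int[P]_(o in above e N 0 `\` above e N k) overshoot e N o.
  elim: k => [_|k IH kN]; first by rewrite subrr normr0 setDv Rintegral_set0.
  have sk : above e N k.+1 `<=` above e N k by exact: above_sub.
  have s0 : above e N k `<=` above e N 0 by exact: above_sub.
  have := IH (ltnW kN); have := @first_passage_step e N k e0 kN.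
  rewrite (RintegralD_sub (ma k.+1) (ma k) sk (intGV a)).
  have -> : \int[P]_(o in above e N 0 `\` above e N k.+1) overshoot e N o =
      \int[P]_(o in above e N 0 `\` above e N k) overshoot e N o +
      \int[P]_(o in above e N k `\` above e N k.+1) overshoot e N o.
    rewrite (@RintegralD_sub _ _ _ _ (above e N 0 `\` above e N k)).
    - congr (_ + \int[_]_(o in _) _); apply/seteqP; split=> o /=.
        by move=> [[A0 Ak1] nA]; split => //; apply: contrapT => nk; exact: nA.
      by move=> [Ak nAk1]; split; [split => //; exact: s0|case].
    - exact: measurableD.
    - exact: measurableD.
    - by move=> o [A0 nAk]; split => // Ak1; apply: nAk; exact: sk.
    - exact: integrable_overshoot.
  set x0 := \int[P]_(o in above e N 0) _; set x1 := \int[P]_(o in above e N k.+1) _.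
  set x := \int[P]_(o in above e N k `\` _) G _.
  move=> h1 h2; rewrite (_ : x0 - x1 = (x0 - (x1 + x)) + x); last by ring.
  by apply: le_trans (ler_normD _ _) _; exact: lerD.
apply: le_trans (H N.+1 (leqnn _)) _.
rewrite (@RintegralD_sub _ _ _ _ (above e N 0 `\` above e N N.+1) setT) //.
- by rewrite lerDl; apply: Rintegral_ge0 => o _; exact: overshoot_ge0.
- exact: measurableD.
- exact: integrable_overshoot.
Qed.

Lemma past_above_all e : past Y a
  (A `&` [set o | forall z, r <= z <= a -> e <= V z o]).
Proof.
rewrite (_ : _ `&` _ = \bigcap_N above e N N.+1).
  apply: (@bigcapT_measurable _ (g_sigma_algebraType (coordinate_events Y
     [set z | 0 <= z <= a]))) => N.
  by have := @past_above e N N.+1; rewrite /g gridN.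
apply/seteqP; split=> o /=.
  move=> [Ao H] N _; split => // j jN; apply: H; exact: grid_itv.
move=> H; split; first by have [] := H 0%N I.
move=> z zra; rewrite leNgt; apply/negP => Vz.
have cV : continuous (fun z => V z o).
  by move=> x; apply: cvgD; [exact: cvg_cst|exact: (bm_cont bm)].
have [N _ /(_ N (leqnn N)) [k kN Vk]] := grid_below ra (continuous_subspaceT cV) zra Vz.
have [_ /(_ k kN)] := H N I; by rewrite leNgt Vk.
Qed.

(** The oscillation on the grid tends to 0 as the mesh does, so only the share
L * e of the overshoot survives. *)
Lemma reflection_level e : 0 <= e ->
  `|\int[P]_(o in A `&` [set o | e <= V r o]) G (V a o) -
    \int[P]_(o in A `&` [set o | forall z, r <= z <= a -> e <= V z o]) G (V a o)|
  <= L * e.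
Proof.
move=> e0; set X := A `&` [set o | forall z, _].
have above0 N : above e N 0 = A `&` [set o | e <= V r o].
  apply/seteqP; split=> o [Ao H]; split => //; first by move: (H 0%N isT); rewrite /g grid0.
  by move=> j; rewrite leqn0 => /eqP ->; rewrite /g grid0.
have cvgX : \int[P]_(o in above e N N.+1) G (V a o) @[N --> \oo] -->
    \int[P]_(o in X) G (V a o).
  apply: (@Rintegral_indic_cvg _ _ _ _ _ _ _ M) => //.
  - by move=> N; exact: measurable_above.
  - move=> o [Ao H]; apply: nearW => N; split => // j jN.
    by apply: H; exact: grid_itv.
  - move=> o nX; have [Ao|nA] := pselect (A o); last first.
      by apply: nearW => N [].
    have [z zra Vz] : exists2 z, r <= z <= a & V z o < e.
      apply: contrapT => nz; apply: nX; split => // z zra.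
      by rewrite leNgt; apply/negP => Vz; apply: nz; exists z.
    have cV : continuous (fun z => V z o).
      by move=> x; apply: cvgD; [exact: cvg_cst|exact: (bm_cont bm)].
    have := grid_below ra (continuous_subspaceT cV) zra Vz; apply: filterS => N [k kN Vk] [_ /(_ k kN)].
    by rewrite leNgt Vk.
have cvgb : \int[P]_o overshoot e N o @[N --> \oo] --> L * e.
  rewrite -[X in _ --> X](Rintegral_prob_cst P).
  apply: (@Rintegral_cvg _ _ _ _ _ _ (L * e + M)).
  - exact: probability_lty.
  - by move=> N; exact: measurable_overshoot.
  - by move=> N o; rewrite ger0_norm ?overshoot_ge0 // overshoot_le.
  - move=> o; rewrite -[X in _ --> X]addr0; apply: cvgD; first exact: cvg_cst.
    have M0 : 0 <= M by exact: le_trans (GM 0).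
    apply: (@squeeze_cvgr _ _ _ _ (fun=> 0) (fun N => L * oscillation N o)).
    + apply: nearW => N; rewrite le_min M0 mulr_ge0 ?oscillation_ge0 //=.
      by rewrite ge_min lexx orbT.
    + exact: cvg_cst.
    + by rewrite -[X in _ --> X](mulr0 L); apply: cvgM; [exact: cvg_cst|exact: oscillation_cvg].
apply: (ler_cvg_to _ cvgb).
  by apply: cvg_norm; apply: cvgB; [exact: cvg_cst|exact: cvgX].
apply: nearW => N; rewrite -(above0 N); exact: first_passage.
Qed.

(** The part of the paths which start positive at time r and meet 0 before a
contributes 0, since the reflected path is as likely and G is odd. It is the
limit of reflection at the level e as e tends to 0. *)
Lemma reflection_principle :
  \int[P]_(o in A `&` [set o | 0 < V r o]) G (V a o) =
  \int[P]_(o in A `&` [set o | forall z, r <= z <= a -> 0 < V z o]) G (V a o).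
Proof.
pose e n : R := n.+1%:R^-1.
have e0 n : 0 < e n by rewrite invr_gt0.
set X0 := A `&` [set o | 0 < V r o]; set X1 := A `&` [set o | forall z, _].
have mA : measurable A := past_measurable bm pA.
have ev x : 0 < x -> \forall n \near \oo, e n < x.
  by move=> x0; exact: (near_infty_natSinv_lt (PosNum x0)).
have c0 : \int[P]_(o in A `&` [set o | e n <= V r o]) G (V a o) @[n --> \oo] -->
    \int[P]_(o in X0) G (V a o).
  apply: (@Rintegral_indic_cvg _ _ _ _ _ _ _ M) => //.
  - move=> n; apply: measurableI => //.
    by apply: (past_measurable bm (r := r)); apply: past_ge; rewrite r0 lexx.
  - by move=> o [Ao Vr]; apply: filterS (ev _ Vr) => n /ltW.
  - move=> o nX; apply: nearW => n [Ao Vr]; apply: nX; split => //.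
    exact: lt_le_trans Vr.
have c1 : \int[P]_(o in A `&` [set o | forall z, r <= z <= a -> e n <= V z o])
    G (V a o) @[n --> \oo] --> \int[P]_(o in X1) G (V a o).
  apply: (@Rintegral_indic_cvg _ _ _ _ _ _ _ M) => //.
  - by move=> n; exact: (past_measurable bm (@past_above_all (e n))).
  - move=> o [Ao VX].
    have cV : continuous (fun z => V z o).
      by move=> x; apply: cvgD; [exact: cvg_cst|exact: (bm_cont bm)].
    have [c cra Hc] := @EVT_min R (fun z => V z o) r a (ltW ra) (continuous_subspaceT cV).
    have Vc : 0 < V c o by apply: VX; move: cra; rewrite in_itv.
    apply: filterS (ev _ Vc) => n nc; split => // z zra.
    by apply: (le_trans (ltW nc)); apply: Hc; rewrite in_itv.
  - move=> o nX; apply: nearW => n [Ao VX]; apply: nX; split => // z zra.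
    exact: lt_le_trans (VX z zra).
have H n := reflection_level (ltW (e0 n)).
have Le0 : L * e n @[n --> \oo] --> 0.
  rewrite -[X in _ --> X](mulr0 L); apply: cvgM; first exact: cvg_cst.
  apply/cvgrPdist_lt => /= x x0; apply: filterS (ev _ x0) => n.
  by rewrite sub0r normrN gtr0_norm.
apply/eqP; rewrite -subr_eq0 -normr_le0.
apply: (ler_cvg_to _ Le0); first by apply: cvg_norm; apply: cvgB; [exact: c0|exact: c1].
by apply: nearW => n; exact: H.
Qed.

End reflection.

(** * Joint law of the values at two times on the event of staying positive *)

Lemma clip_lip (R : realType) (p q : R) :
  `|Num.min 1 (Num.max 0 p) - Num.min 1 (Num.max 0 q)| <= `|p - q|.
Proof.
have h1 := ler_norm (p - q); have h2 := ler_norm (q - p); rewrite distrC in h2.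
rewrite ler_norml.
have [p0|p0] := leP 0 p; have [q0|q0] := leP 0 q;
  rewrite ?(min_r ler01); try have [p1|p1] := leP 1 p; try have [q1|q1] := leP 1 q;
  apply/andP; split; lra.
Qed.

Lemma ramp_lip (R : realType) (a e : R) : 0 < e -> lip (ramp a e) e^-1.
Proof.
move=> e0 x y; apply: le_trans (clip_lip _ _) _.
rewrite -mulrBl normrM (gtr0_norm (x := e^-1)) ?invr_gt0 // mulrC.
by rewrite opprB addrA subrK.
Qed.

Lemma ramp_cvg (R : realType) (a x : R) : ramp a n.+1%:R^-1 x @[n --> \oo] -->
  (if a < x then 1 else 0 : R).
Proof.
have [ax|xa] := ltP a x; apply: cvg_near_cst.
  have xa0 : 0 < x - a by rewrite subr_gt0.
  apply: filterS (near_infty_natSinv_lt (PosNum xa0)) => n /= h.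
  by rewrite ramp1 ?invr_gt0 // -lerBrDl ltW.
by apply: nearW => n; rewrite ramp0 ?invr_gt0.
Qed.

Definition odd_ramp (R : realType) (b e x : R) : R := ramp b e x - ramp b e (- x).

Lemma odd_rampN (R : realType) (b e x : R) : odd_ramp b e (- x) = - odd_ramp b e x.
Proof. by rewrite /odd_ramp opprK opprB. Qed.

Lemma odd_ramp_le1 (R : realType) (b e x : R) : `|odd_ramp b e x| <= 1.
Proof.
rewrite /odd_ramp ler_norml; have := ramp_ge0 b e x; have := ramp_ge0 b e (- x).
by have := ramp_le1 b e x; have := ramp_le1 b e (- x) => *; apply/andP; split; lra.
Qed.

Lemma odd_ramp_lip (R : realType) (b e : R) : 0 < e -> lip (odd_ramp b e) (e^-1 + e^-1).
Proof.
move=> e0 x y; rewrite /odd_ramp mulrDl.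
have -> : ramp b e x - ramp b e (- x) - (ramp b e y - ramp b e (- y)) =
  (ramp b e x - ramp b e y) - (ramp b e (- x) - ramp b e (- y)) by ring.
apply: le_trans (ler_normB _ _) _; apply: lerD; first exact: ramp_lip.
apply: le_trans (ramp_lip _ e0 _ _) _.
by rewrite -opprD normrN.
Qed.

Lemma indic_pred (R : realType) (T : Type) (Q : pred T) (x : T) :
  \1_[set y | Q y] x = (Q x)%:R :> R.
Proof. by rewrite indicE; congr (nat_of_bool _)%:R; apply/idP/idP; rewrite inE. Qed.

Lemma odd_ramp_cvg (R : realType) (b x : R) : odd_ramp b n.+1%:R^-1 x @[n --> \oo] -->
  ((b < x)%R%:R - (b < - x)%R%:R : R)%R.
Proof.
apply: cvgB.
  by have := ramp_cvg (a := b) (x := x); case: (b < x).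
by have := ramp_cvg (a := b) (x := - x); case: (b < - x).
Qed.

Lemma Rintegral_indicB (R : realType) d (T : measurableType d)
    (P : probability T R) (A B C : set T) : measurable A -> measurable B ->
  measurable C ->
  \int[P]_(x in A) (\1_B x - \1_C x) = fine (P (A `&` B)) - fine (P (A `&` C)).
Proof.
move=> mA mB mC.
have int1 D : measurable D -> P.-integrable A (EFin \o \1_D).
  move=> mD; apply: (integrableS measurableT) => //.
  apply: (@bounded_integrable _ _ _ _ _ 1); first exact: probability_lty.
    exact: measurable_indic.
  by move=> x; rewrite indicE; case: (_ \in _); rewrite ?normr1 ?normr0.
rewrite RintegralB //; last exact: int1.
  by rewrite /Rintegral !integral_indic // ![_ `&` A]setIC.
exact: int1.
Qed.

Lemma measurable_ray (R : realType) (b : R) : measurable [set x : R | b < x].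
Proof.
rewrite (_ : [set x | _] = `]b, +oo[%classic) //.
by apply/seteqP; split=> x; rewrite /= in_itv /= andbT.
Qed.

Lemma measurable_neg_ray (R : realType) (b : R) : measurable [set x : R | b < - x].
Proof.
rewrite (_ : [set x | _] = `]-oo, (- b)[%classic) //.
by apply/seteqP; split=> x; rewrite /= in_itv /= ltrNr.
Qed.

Lemma measurable_abs_ray (R : realType) (b : R) : measurable [set x : R | b < `|x|].
Proof.
rewrite (_ : [set x | _] = [set x | b < x] `|` [set x | b < - x]).
  by apply: measurableU; [exact: measurable_ray|exact: measurable_neg_ray].
apply/seteqP; split=> x /=; first by move=> h; apply/orP; rewrite -lt_max maxrN.
by move=> /orP; rewrite -lt_max maxrN.
Qed.

Section killed.
Context (R : realType) d (T : measurableType d) (P : probability T R).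
Context (Y : R -> T -> R) (bm : clean_bm P Y) (u : R) (u0 : 0 < u).

Let V z o := u + Y z o.
Let mV z : measurable_fun setT (V z) := measurable_V bm u z.

Let cV o : continuous (fun z => V z o).
Proof. by move=> x; apply: cvgD; [exact: cvg_cst|exact: (bm_cont bm)]. Qed.

Definition positive_on (a b : R) : set T := [set o | forall z, a <= z <= b -> 0 < V z o].

Lemma past_positive (a : R) : 0 < a -> past Y a (positive_on 0 a).
Proof.
move=> a0.
have pT : past Y 0 setT.
  exact: (@measurableT _ (g_sigma_algebraType (coordinate_events Y [set z | 0 <= z <= 0]))).
rewrite (_ : positive_on 0 a = \bigcup_n (setT `&`
    [set o | forall z, 0 <= z <= a -> n.+1%:R^-1 <= V z o])).
  apply: (@bigcupT_measurable _ (g_sigma_algebraType (coordinate_events Y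
     [set z | 0 <= z <= a]))) => n.
  exact: (@past_above_all _ _ _ _ _ bm u 0 a (lexx 0) a0 setT pT).
apply/seteqP; split=> o /=; last first.
  by move=> [n _ [_ H]] z /H; apply: lt_le_trans; rewrite invr_gt0.
move=> H; have [c ca Hc] := EVT_min (ltW a0) (continuous_subspaceT (@cV o)).
have Vc : 0 < V c o by apply: H; move: ca; rewrite in_itv.
have [n _ /(_ n (leqnn n)) nc] := near_infty_natSinv_lt (PosNum Vc).
exists n => //; split => // z za; apply: (le_trans (ltW nc)).
by apply: Hc; rewrite in_itv.
Qed.

Lemma event_V z (C : set R) : measurable C -> measurable [set o | C (V z o)].
Proof. by move=> mC; have := mV z measurableT mC; rewrite setTI. Qed.

Lemma past_event_V r z (C : set R) : 0 <= z <= r -> measurable C ->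
  past Y r [set o | C (V z o)].
Proof.
move=> zr mC; apply: (@sigma_preimage R T _ (V z)) => //.
by apply: measurable_funD => //; apply: past_Y_measurable.
Qed.

Section two_times.
Context (s t al b : R) (s0 : 0 < s) (st : s < t) (al0 : 0 <= al) (b0 : 0 <= b).

(** Reflection on [s, t] removes the positivity constraint after s. The mean of
G (V t) given the past of s is then an odd function h of V s. Reflection on
[0, s], used on the odd function equal to h where al < |x| and to 0
elsewhere, removes the constraint before s; a Lipschitz ramp stands for the
jump at al. *)
Lemma killed_odd (G : R -> R) (M L : R) : 0 <= L -> (forall x, `|G x| <= M) ->
  lip G L -> (forall x, G (- x) = - G x) ->
  \int[P]_(o in positive_on 0 t `&` [set o | al < V s o]) G (V t o) =
  \int[P]_(o in [set o | al < `|V s o|]) G (V t o).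
Proof.
move=> L0 GM GL Godd; have mG := lip_measurable GL.
have M0 : 0 <= M by exact: le_trans (GM 0).
have ts0 : 0 < t - s by rewrite subr_gt0.
pose A := positive_on 0 s `&` [set o | al < V s o].
have pA : past Y s A.
  apply: pastI; first exact: past_positive.
  rewrite (_ : [set o | _] = [set o | `]al, +oo[%classic (V s o)]).
    by apply: past_event_V; rewrite ?lexx ?ltW.
  by apply/seteqP; split=> o; rewrite /= in_itv /= andbT.
transitivity (\int[P]_(o in A) G (V t o)).
  have := reflection_principle bm u (ltW s0) st pA L0 GM GL Godd.
  rewrite (_ : A `&` [set o | 0 < u + Y s o] = A) => [->|].
    congr Rintegral; apply/seteqP; split=> o /=.
      move=> [pos als]; split; [split => // z /andP[z0 zs]|move=> z /andP[sz zt]]; apply: pos.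
        by rewrite z0 (le_trans zs) // ltW.
      by rewrite zt (le_trans (ltW s0)).
    move=> [[pos als] pos']; split => // z /andP[z0 zt].
    by have [zs|/ltW sz] := leP z s; [apply: pos; rewrite z0|apply: pos'; rewrite sz].
  apply/seteqP; split=> o /=; first by case.
  by move=> [pos als]; split => //; exact: le_lt_trans als.
pose h := heat (t - s) G.
have hM x : `|h x| <= M by exact: heat_le.
have hL : lip h L by exact: (@heat_lip _ _ _ M).
have hodd x : h (- x) = - h x by exact: (@heat_odd _ _ _ M).
have mh : measurable_fun setT h by exact: lip_measurable hL.
rewrite (markov_integral bm u (ltW s0) st pA mG GM) -/h.
pose K (n : nat) x := ramp al n.+1%:R^-1 `|x| * h x.
have KM n x : `|K n x| <= M.
  rewrite normrM ger0_norm ?ramp_ge0 // -[leRHS]mul1r.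
  by apply: ler_pM => //; [exact: ramp_ge0|exact: ramp_le1].
have Kodd n x : K n (- x) = - K n x by rewrite /K normrN hodd mulrN.
have KL n : lip (K n) (n.+1%:R * M + L).
  move=> x y; rewrite /K.
  have -> : ramp al n.+1%:R^-1 `|x| * h x - ramp al n.+1%:R^-1 `|y| * h y =
    (ramp al n.+1%:R^-1 `|x| - ramp al n.+1%:R^-1 `|y|) * h x +
    ramp al n.+1%:R^-1 `|y| * (h x - h y) by ring.
  apply: le_trans (ler_normD _ _) _; rewrite !normrM mulrDl; apply: lerD.
    rewrite mulrAC; apply: ler_pM => //.
    have n0 : 0 < n.+1%:R^-1 :> R by rewrite invr_gt0.
    apply: le_trans (ramp_lip al n0 _ _) _; rewrite invrK.
    by rewrite ler_wpM2l // ler_dist_dist.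
  rewrite -[leRHS]mul1r; apply: ler_pM => //.
  by rewrite ger0_norm ?ramp_ge0 ?ramp_le1.
have pT : past Y 0 setT.
  exact: (@measurableT _ (g_sigma_algebraType (coordinate_events Y [set z | 0 <= z <= 0]))).
have Krefl n : \int[P]_o K n (V s o) = \int[P]_(o in positive_on 0 s) K n (V s o).
  have KL0 : 0 <= n.+1%:R * M + L by rewrite addr_ge0 // mulr_ge0.
  have := reflection_principle bm u (lexx 0) s0 pT KL0 (KM n) (KL n) (Kodd n).
  rewrite !setTI (_ : [set o | 0 < u + Y 0 o] = setT) //.
  by apply/seteqP; split=> // o _ /=; rewrite (bm_start bm) addr0.
have mhV : measurable_fun setT (fun o => h (V s o)) by exact: measurableT_comp.
have mpos : measurable (positive_on 0 s) by exact: (past_measurable bm (past_positive s0)).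
have mKV n : measurable_fun setT (fun o => K n (V s o)).
  by apply: measurableT_comp => //; exact: lip_measurable (KL n).
have mals : measurable [set o | al < V s o].
  rewrite (_ : [set o | _] = [set o | `]al, +oo[%classic (V s o)]).
    by apply: event_V; exact: measurable_itv.
  by apply/seteqP; split=> o; rewrite /= in_itv /= andbT.
have Kcvg o : K n (V s o) @[n --> \oo] --> \1_[set o | al < `|V s o|] o * h (V s o).
  apply: cvgM; last exact: cvg_cst.
  have := @ramp_cvg R al `|V s o|.
  rewrite indicE; case: ltP => alV.
    by rewrite mem_set.
  by rewrite memNset //= => /=; apply/negP; rewrite -leNgt.
have lhs : \int[P]_o K n (V s o) @[n --> \oo] -->
    \int[P]_(o in [set o | al < `|V s o|]) h (V s o).
  rewrite (Rintegral_indicl P [set o | al < `|V s o|]).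
  apply: (@Rintegral_cvg _ _ _ _ _ _ M) => //; exact: probability_lty.
have rhs : \int[P]_(o in positive_on 0 s) K n (V s o) @[n --> \oo] -->
    \int[P]_(o in A) h (V s o).
  under eq_fun do rewrite (Rintegral_indicl P (positive_on 0 s)).
  rewrite (Rintegral_indicl P A).
  apply: (@Rintegral_cvg _ _ _ _ _ _ M) => [|n|n o|o].
  - exact: probability_lty.
  - by apply: measurable_funM => //; exact: measurable_indic.
  - rewrite normrM indicE; case: (_ \in _); rewrite ?normr1 ?mul1r // normr0 mul0r //.
  - have -> : \1_A o * h (V s o) = \1_(positive_on 0 s) o * (\1_[set o | al < `|V s o|] o * h (V s o)).
      rewrite mulrA; congr (_ * _); rewrite !indicE -natrM mulnb; congr (_%:R).
      congr nat_of_bool; apply/idP/andP; rewrite !inE /A /=.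
        by move=> [pos als]; split => //; exact: lt_le_trans (ler_norm _).
      move=> [pos als]; split => //; rewrite gtr0_norm // in als; apply: pos.
      by rewrite lexx ltW.
    by apply: cvgM; [exact: cvg_cst|exact: Kcvg].
have -> : \int[P]_(o in A) h (V s o) = \int[P]_(o in [set o | al < `|V s o|]) h (V s o).
  have KK := funext Krefl.
  by rewrite -(cvg_lim _ rhs) // -KK; exact: cvg_lim.
apply/esym; apply: (markov_integral bm u (ltW s0) st _ mG GM).
rewrite (_ : [set o | _] = [set o | [set x | al < `|x|] (V s o)]) //.
by apply: past_event_V; rewrite ?lexx ?ltW //; exact: measurable_abs_ray.
Qed.

(** The limit of the previous identity along odd ramps, which tend to the
indicator of the ray above b minus that of its opposite. On positive paths the
second one vanishes. *)
Lemma killed_rays :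
  (P (positive_on 0 t `&` [set o | al < V s o] `&` [set o | b < V t o])%R +
   P ([set o | al < `|V s o|] `&` [set o | b < - V t o])%R =
   P ([set o | al < `|V s o|] `&` [set o | b < V t o])%R)%E.
Proof.
have t0 := lt_trans s0 st.
have mray := measurable_ray b.
have mneg := measurable_neg_ray b.
have mabs := measurable_abs_ray al.
set A := positive_on 0 t `&` _; set B := [set o | al < `|V s o|].
have mA : measurable A.
  apply: measurableI; first exact: (past_measurable bm (past_positive t0)).
  rewrite (_ : [set o | _] = [set o | `]al, +oo[%classic (V s o)]); first exact: event_V.
  by apply/seteqP; split=> o; rewrite /= in_itv /= andbT.
have mB : measurable B by rewrite /B; exact: (event_V s mabs).
have lim D : measurable D ->
    \int[P]_(o in D) odd_ramp b n.+1%:R^-1 (V t o) @[n --> \oo] -->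
    \int[P]_(o in D) (\1_[set o | b < V t o] o - \1_[set o | b < - V t o] o).
  move=> mD; under eq_fun do rewrite (Rintegral_indicl P D).
  rewrite (Rintegral_indicl P D).
  apply: (@Rintegral_cvg _ _ _ _ _ _ 1) => [|n|n o|o].
  - exact: probability_lty.
  - apply: measurable_funM; first exact: measurable_indic.
    apply: measurableT_comp => //; apply: (@lip_measurable _ _ (n.+1%:R^-1^-1 + n.+1%:R^-1^-1)).
    by apply: odd_ramp_lip; rewrite invr_gt0.
  - rewrite normrM -[leRHS]mul1r; apply: ler_pM => //; last exact: odd_ramp_le1.
    by rewrite indicE; case: (_ \in _); rewrite ?normr1 ?normr0.
  - apply: cvgM; first exact: cvg_cst.
    rewrite !indic_pred; exact: odd_ramp_cvg.
have E : \int[P]_(o in A) (\1_[set o | b < V t o] o - \1_[set o | b < - V t o] o) =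
   \int[P]_(o in B) (\1_[set o | b < V t o] o - \1_[set o | b < - V t o] o).
  have KK : (fun n => \int[P]_(o in A) odd_ramp b n.+1%:R^-1 (V t o)) =
      (fun n => \int[P]_(o in B) odd_ramp b n.+1%:R^-1 (V t o)).
    apply/funext => n; have n0 : 0 < n.+1%:R^-1 :> R by rewrite invr_gt0.
    apply: (@killed_odd _ 1 (n.+1%:R^-1^-1 + n.+1%:R^-1^-1)).
    - by rewrite addr_ge0 // invr_ge0 ltW.
    - by move=> x; exact: odd_ramp_le1.
    - exact: odd_ramp_lip.
    - by move=> x; exact: odd_rampN.
  by rewrite -(cvg_lim _ (lim A mA)) // KK; apply: cvg_lim => //; exact: lim.
have mVt (C : set R) : measurable C -> measurable [set o | C (V t o)] by exact: event_V.
have m1 := mVt _ mray; have m2 := mVt _ mneg.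
move: E; rewrite !Rintegral_indicB //.
have -> : A `&` [set o | b < - V t o] = set0.
  apply/seteqP; split=> // o [[pos _]] /=.
  have : 0 < V t o by apply: pos; rewrite (ltW t0) lexx.
  by move: b0; lra.
rewrite measure0 subr0 => E.
have fin X : measurable X -> P X = (fine (P X))%:E by move=> mX; rewrite fineK // fin_num_measure.
rewrite (fin (A `&` _)); last exact: measurableI.
rewrite E; clear E; rewrite (fin (B `&` [set o | b < - V t o])); last exact: measurableI.
rewrite (fin (B `&` [set o | b < V t o])); last exact: measurableI.
by rewrite -EFinD subrK.
Qed.

End two_times.
End killed.

(** * Densities on the event of staying positive *)

Section two_time_density.
Context (R : realType) d (T : measurableType d) (P : probability T R).
Context (Y : R -> T -> R) (bm : clean_bm P Y) (u : R).
Local Open Scope ereal_scope.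

Lemma ge0_integral_increment a b x (F : R -> \bar R) : (0 <= a)%R -> (a < b)%R ->
  measurable_fun setT F -> (forall x, 0 <= F x) ->
  \int[P]_o F (x + (Y b o - Y a o))%R =
  \int[lebesgue_measure]_y (F y * (gauss (b - a) (y - x))%:E).
Proof.
move=> a0 ab mF F0.
have mD : measurable_fun setT (fun o => Y b o - Y a o : measurableTypeR R)%R.
  by apply: measurable_funB; exact: (bm_meas bm).
pose D : {mfun T >-> measurableTypeR R} :=
  @mfun_Sub _ _ T (measurableTypeR R) (fun o => Y b o - Y a o)%R (mem_set mD).
have mFx : measurable_fun (setT : set (measurableTypeR R)) (fun y => F (x + y)%R).
  by apply: (measurableT_comp mF); exact: measurable_funD.
transitivity (\int[distribution P D]_y F (x + y)%R).
  by rewrite ge0_integral_distribution.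
rewrite (eq_measure_integral (normal_prob 0 (Num.sqrt (b - a)))); last first.
  by move=> E mE _; exact: (bm_law bm a0 ab).
rewrite (@integral_normal R (b - a) (fun y => F (x + y)%R) mFx (fun y => F0 _)).
rewrite -(@lebesgue_integral_shift R (fun y => F y * (gauss (b - a) (y - x))%:E) x).
- by apply: eq_integral => y _; rewrite addrK addrC.
- apply: emeasurable_funM => //; apply/measurable_EFinP.
  by apply: (measurableT_comp (@measurable_gauss R _)); exact: measurable_funB.
- by move=> y; rewrite mule_ge0 // lee_fin gauss_ge0.
Qed.

Lemma ge0_integral_V z (F : R -> \bar R) : (0 < z)%R ->
  measurable_fun setT F -> (forall x, 0 <= F x) ->
  \int[P]_o F (u + Y z o)%R = \int[lebesgue_measure]_y (F y * (gauss z (y - u))%:E).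
Proof.
move=> z0 mF F0; have := @ge0_integral_increment 0%R z u F (lexx _) z0 mF F0.
rewrite subr0 => <-; apply: eq_integral => o _.
by rewrite (bm_start bm) subr0.
Qed.

Lemma two_time_law (s t : R) (E C : set R) : (0 < s)%R -> (s < t)%R ->
  measurable E -> measurable C ->
  P ([set o | E (u + Y s o)%R] `&` [set o | C (u + Y t o)%R]) =
  \int[lebesgue_measure]_(c in C) \int[lebesgue_measure]_(y in E)
    (gauss s (y - u) * gauss (t - s) (c - y))%:E.
Proof.
move=> s0 st mE mC.
have mD : measurable_fun setT (fun o => Y t o - Y s o : measurableTypeR R)%R.
  by apply: measurable_funB; exact: (bm_meas bm).
pose W : {mfun T >-> R} := mfun_Sub (mem_set (measurable_V bm u s)).
pose D : {mfun T >-> measurableTypeR R} :=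
  @mfun_Sub _ _ T (measurableTypeR R) (fun o => Y t o - Y s o)%R (mem_set mD).
pose Phi (p : (R * measurableTypeR R)%type) : \bar R := (\1_E p.1 * \1_C (p.1 + p.2)%R)%:E.
have mI (A : set R) : measurable A -> measurable_fun setT (\1_A : R -> R).
  by move=> mA; exact: measurable_indic.
have mPhi : measurable_fun setT Phi.
  apply/measurable_EFinP; apply: measurable_funM.
    by apply: (measurableT_comp (mI _ mE)); exact: measurable_fst.
  apply: (measurableT_comp (mI _ mC)).
  apply: measurable_funD; first exact: measurable_fst.
  exact: (@measurable_snd _ _ R (measurableTypeR R)).
have Phi0 x : 0 <= Phi x by rewrite lee_fin.
have ind (S : set R) (F : set (measurableTypeR R)) : measurable S -> measurable F ->
    indep_events P (W @^-1` S) (D @^-1` F).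
  move=> mS mF; apply: (past_indep bm (ltW s0) (ltW st) mF).
  have mW' : measurable_fun (setT : set (g_sigma_algebraType
      (coordinate_events Y [set z | 0 <= z <= s]%R))) (fun o => u + Y s o)%R.
    by apply: measurable_funD => //; apply: past_Y_measurable; rewrite (ltW s0) lexx.
  by have := mW' measurableT S mS; rewrite setTI.
have mEC : measurable ([set o | E (u + Y s o)%R] `&` [set o | C (u + Y t o)%R]).
  apply: measurableI.
    by have := measurable_V bm u s measurableT mE; rewrite setTI.
  by have := measurable_V bm u t measurableT mC; rewrite setTI.
have mg v x : measurable_fun setT (fun y : R => gauss v (y - x)).
  by apply: (measurableT_comp (@measurable_gauss R _)); exact: measurable_funB.
have mg' v x : measurable_fun setT (fun y : R => gauss v (x - y)).
  by apply: (measurableT_comp (@measurable_gauss R _)); exact: measurable_funB.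
have m2 : measurable_fun setT (fun p : (R * R)%type => gauss (t - s) (p.2 - p.1)).
  by apply: (measurableT_comp (@measurable_gauss R _)); exact: measurable_funB.
rewrite measure_indic //.
transitivity (\int[P]_o Phi (W o, D o)).
  apply: eq_integral => o _; rewrite /Phi /= -addrA (addrC (Y s o)) subrK indicI.
  by [].
rewrite (indep_integral ind mPhi Phi0).
pose K x := \int[lebesgue_measure]_c (\1_C c * gauss (t - s) (c - x))%:E.
have mf : measurable_fun setT (fun p : (R * R)%type =>
    (\1_E p.1 * gauss s (p.1 - u) * (\1_C p.2 * gauss (t - s) (p.2 - p.1)))%:E).
  apply/measurable_EFinP; apply: measurable_funM.
    apply: measurable_funM.
      by apply: (measurableT_comp (mI _ mE)); exact: measurable_fst.
    by apply: (measurableT_comp (mg s u)); exact: measurable_fst.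
  apply: measurable_funM => //.
  by apply: (measurableT_comp (mI _ mC)); exact: measurable_snd.
have mK : measurable_fun setT (fun x => (\1_E x)%:E * K x).
  have mh : measurable_fun setT (fun p : (R * R)%type =>
      (\1_C p.2 * gauss (t - s) (p.2 - p.1))%:E).
    apply/measurable_EFinP; apply: measurable_funM => //.
    by apply: (measurableT_comp (mI _ mC)); exact: measurable_snd.
  apply: emeasurable_funM; first by apply/measurable_EFinP.
  apply: (@measurable_fun_fubini_tonelli_F _ _ (measurableTypeR R) (measurableTypeR R) R
    lebesgue_measure _ mh).
  by move=> p; rewrite lee_fin mulr_ge0 ?gauss_ge0.
have K0 x : 0 <= K x by apply: integral_ge0 => c _; rewrite lee_fin mulr_ge0 ?gauss_ge0.
transitivity (\int[P]_o ((\1_E (u + Y s o)%R)%:E * K (u + Y s o)%R)).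
  apply: eq_integral => o _; rewrite /Phi /=.
  under eq_integral do rewrite EFinM.
  rewrite ge0_integralZl //; last first.
    by apply/measurable_EFinP; exact: (measurable_shift (u + Y s o) (mI _ mC)).
  congr (_ * _).
  transitivity (\int[P]_w (\1_C (u + Y s o + (Y t w - Y s w))%R)%:E).
    rewrite [LHS]ge0_integral_distribution //.
    by apply/measurable_EFinP; exact: (measurable_shift (u + Y s o) (mI _ mC)).
  rewrite (@ge0_integral_increment s t (u + Y s o)%R (fun x => (\1_C x)%:E)) //; first exact: ltW.
  by apply/measurable_EFinP; exact: mI.
rewrite (@ge0_integral_V s (fun x => (\1_E x)%:E * K x)) //; last first.
  by move=> x; rewrite mule_ge0 ?lee_fin.
transitivity (\int[lebesgue_measure]_x \int[lebesgue_measure]_c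
    (\1_E x * gauss s (x - u) * (\1_C c * gauss (t - s) (c - x)))%:E).
  apply: eq_integral => x _; rewrite muleAC -EFinM /K -ge0_integralZl //.
  - by apply/measurable_EFinP; apply: measurable_funM; [exact: mI|exact: mg].
  - by move=> c _; rewrite lee_fin mulr_ge0 ?gauss_ge0.
  - by rewrite lee_fin mulr_ge0 ?gauss_ge0.
rewrite (lebesgue_tonelli mf); last first.
  by move=> p; rewrite lee_fin !mulr_ge0 ?gauss_ge0.
rewrite [RHS]integral_indicl; apply: eq_integral => c _.
rewrite (integral_indicl lebesgue_measure E) -ge0_integralZl //.
- by apply: eq_integral => x _; rewrite -!EFinM; congr (_%:E); ring.
- apply: emeasurable_funM; apply/measurable_EFinP; first exact: mI.
  by apply: measurable_funM; [exact: mg|exact: mg'].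
- by move=> y _; rewrite mule_ge0 ?lee_fin // mulr_ge0 ?gauss_ge0.
Qed.

End two_time_density.

(** Transition density of Brownian motion killed at 0, by the method of images. *)
Definition killed_gauss (R : realType) (v x y : R) : R := gauss v (y - x) - gauss v (y + x).

Lemma gauss_le (R : realType) (v x y : R) : 0 < v -> `|x| <= `|y| -> gauss v y <= gauss v x.
Proof.
move=> v0 xy; rewrite !gaussE // ler_pM2l; last first.
  by rewrite invr_gt0 sqrtr_gt0 mulrn_wgt0 // mulr_gt0 // pi_gt0.
rewrite ler_expR lerN2 ler_pM2r ?invr_gt0 ?mulrn_wgt0 //.
by rewrite -(real_normK (num_real x)) -(real_normK (num_real y)) lerXn2r ?nnegrE.
Qed.

Lemma killed_gauss_ge0 (R : realType) (v x y : R) : 0 < v -> 0 <= x -> 0 <= y ->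
  0 <= killed_gauss v x y.
Proof.
move=> v0 x0 y0; rewrite subr_ge0; apply: gauss_le => //.
by rewrite [leRHS]ger0_norm ?addr_ge0 // ler_norml; apply/andP; split; lra.
Qed.

Lemma continuous_gauss (R : realType) (v : R) : 0 < v -> continuous (gauss v).
Proof. by move=> v0; apply: continuous_normal_pdf; rewrite gt_eqF // sqrtr_gt0. Qed.

Lemma integrable_gauss (R : realType) (v a : R) : 0 < v ->
  lebesgue_measure.-integrable setT (fun y : measurableTypeR R => (gauss v (y - a))%:E).
Proof.
move=> v0; have := integrable_normal_pdf a (Num.sqrt v).
congr (_.-integrable _ _); apply/funext => y; congr (_%:E).
rewrite /gauss !normal_pdfE ?gt_eqF ?sqrtr_gt0 //.
by rewrite /normal_fun subr0.
Qed.

Lemma killed_gauss_le (R : realType) (v x y : R) : 0 < v -> `|killed_gauss v x y| <= gauss v 0.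
Proof.
move=> v0; have h z : gauss v z <= gauss v 0 by apply: gauss_le => //; rewrite normr0.
have := gauss_ge0 v (y - x); have := gauss_ge0 v (y + x).
have := h (y - x); have := h (y + x); rewrite /killed_gauss ler_norml.
by move=> *; apply/andP; split; lra.
Qed.

Lemma continuous_killed_gauss (R : realType) (v x : R) : 0 < v ->
  continuous (killed_gauss v x).
Proof.
move=> v0 y; apply: (@cvgB _ R^o).
  apply: (@continuous_comp _ _ _ (fun y : R => y - x) (gauss v)); last exact: continuous_gauss.
  by apply: cvgB; [exact: cvg_id|exact: cvg_cst].
apply: (@continuous_comp _ _ _ (fun y : R => y + x) (gauss v)); last exact: continuous_gauss.
by apply: cvgD; [exact: cvg_id|exact: cvg_cst].
Qed.

Lemma killed_gaussC (R : realType) (v x y : R) : 0 < v ->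
  killed_gauss v x y = killed_gauss v y x.
Proof. by move=> v0; rewrite /killed_gauss -(gaussN (y - x)) // opprB (addrC y x). Qed.

(** Symmetry folds the two rays onto the positive one. *)
Lemma integral_fold (R : realType) (al : R) (F : R -> \bar R) : 0 <= al ->
  measurable_fun setT F -> (forall x, 0 <= F x)%E ->
  (\int[lebesgue_measure]_(y in [set x : R | al < `|x|]%R) F y =
   \int[lebesgue_measure]_(y in [set x : R | al < x]%R) (F y + F (- y)%R))%E.
Proof.
move=> al0 mF F0.
have mE1 := measurable_ray al; have mE2 := measurable_neg_ray al.
have mFN : measurable_fun setT (fun y : R => F (- y)).
  by apply: (measurableT_comp mF); exact: oppr_measurable.
have -> : [set x : R | al < `|x|] = [set x | al < x] `|` [set x | al < - x].
  apply/seteqP; split=> x /=; first by move=> h; apply/orP; rewrite -lt_max maxrN.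
  by move=> /orP; rewrite -lt_max maxrN.
rewrite ge0_integral_setU //; first last.
- by rewrite disj_set2E; apply/eqP; apply/seteqP; split=> // x [/= h1 h2]; move: al0 h1 h2; lra.
- exact: measurable_funTS.
rewrite ge0_integralD //; first last.
- exact: measurable_funTS.
- exact: measurable_funTS.
congr (_ + _)%E; rewrite integral_indicl [RHS]integral_indicl -lebesgue_integral_opp.
- by apply: eq_integral => x _; rewrite !indic_pred opprK.
- apply: emeasurable_funM; first by apply/measurable_EFinP; exact: measurable_indic.
  exact: mF.
- by move=> x; rewrite mule_ge0 ?lee_fin.
Qed.

Section killed_density.
Context (R : realType) d (T : measurableType d) (P : probability T R).
Context (Y : R -> T -> R) (bm : clean_bm P Y) (u : R) (u0 : 0 < u).
Context (s t al : R) (s0 : 0 < s) (st : s < t) (al0 : 0 <= al).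
Local Open Scope ereal_scope.

Let ts0 : (0 < t - s)%R. Proof. by rewrite subr_gt0. Qed.

Definition two_time_density c := \int[lebesgue_measure]_(y in [set x | al < `|x|]%R)
  (gauss s (y - u) * gauss (t - s) (c - y))%:E.

Definition killed_density (c : R) : R := \int[lebesgue_measure]_(y in [set x | al < x]%R)
  (killed_gauss s u y * killed_gauss (t - s) y c)%R.

Let mg c : measurable_fun setT (fun y : R => gauss s (y - u) * gauss (t - s) (c - y))%R.
Proof.
apply: measurable_funM.
  by apply: (measurableT_comp (@measurable_gauss R _)); exact: measurable_funB.
by apply: (measurableT_comp (@measurable_gauss R _)); exact: measurable_funB.
Qed.

Let mk c : measurable_fun setT (fun y : R => killed_gauss s u y * killed_gauss (t - s) y c)%R.
Proof.
apply: measurable_funM; apply: measurable_funB;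
  apply: (measurableT_comp (@measurable_gauss R _)); (exact: measurable_funB||exact: measurable_funD).
Qed.

Let dom (y : measurableTypeR R) : R :=
  ((gauss s (y - u) + gauss s (y - - u)) * gauss (t - s) 0)%R.

Let int_dom : lebesgue_measure.-integrable setT (EFin \o dom).
Proof.
rewrite (_ : _ \o _ = (fun y => ((gauss (t - s) 0)%:E *
    ((gauss s (y - u))%:E + (gauss s (y - - u))%:E)))).
  by apply: integrableZl => //; apply: integrableD => //; exact: integrable_gauss.
by apply/funext => y; rewrite /dom /= -EFinD -EFinM mulrC.
Qed.

Let k_le c y : (`|killed_gauss s u y * killed_gauss (t - s) y c| <= dom y)%R.
Proof.
rewrite normrM; apply: ler_pM => //; last exact: killed_gauss_le.
rewrite opprK; apply: le_trans (ler_normB _ _) _.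
by rewrite !ger0_norm ?gauss_ge0.
Qed.

Let int_k c : lebesgue_measure.-integrable setT
  (EFin \o (fun y : measurableTypeR R => killed_gauss s u y * killed_gauss (t - s) y c)%R).
Proof.
apply: (le_integrable measurableT _ _ int_dom); first by apply/measurable_EFinP; exact: mk.
move=> y _ /=; rewrite lee_fin; apply: le_trans (k_le c y) _; exact: ler_norm.
Qed.

Lemma killed_densityE c : (killed_density c)%:E =
  \int[lebesgue_measure]_(y in [set x | al < x]%R)
    (killed_gauss s u y * killed_gauss (t - s) y c)%:E.
Proof.
rewrite fineK //; apply: integrable_fin_num; first exact: measurable_ray.
by apply: (integrableS measurableT _ (@subsetT _ _) (int_k c)); exact: measurable_ray.
Qed.

Lemma continuous_killed_density : continuous killed_density.
Proof.
move=> c; have cI : c \in (`]c - 1, c + 1[%classic)%R.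
  by rewrite inE /= in_itv /=; apply/andP; split; lra.
move: c cI => c0; have mray := measurable_ray al.
apply: (@continuity_under_integral R _ (measurableTypeR R) lebesgue_measure
  (fun c y => killed_gauss s u y * killed_gauss (t - s) y c)%R _ mray _ _ _ _ dom).
- move=> c _; apply: (integrableS measurableT _ (@subsetT _ _) (int_k c)).
  exact: measurable_ray.
- apply: aeW => y _ c _; apply: cvgM; first exact: cvg_cst.
  exact: continuous_killed_gauss.
- apply: (integrableS measurableT _ (@subsetT _ _) int_dom).
  exact: measurable_ray.
- by move=> c _; apply: aeW => y _; exact: k_le.
Qed.

(** Reflecting the endpoint c subtracts the image terms: after folding y with -y
the difference is the product of the two killed transition densities. *)
Lemma two_time_density_opp c : (0 <= c)%R ->
  two_time_density c = two_time_density (- c)%R + (killed_density c)%:E.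
Proof.
move=> c0; have mE1 := measurable_ray al.
have mEg c' := measurableT_comp (@EFin_measurable _ setT) (mg c').
rewrite killed_densityE /two_time_density !integral_fold //; first last.
- by move=> x; rewrite lee_fin mulr_ge0 ?gauss_ge0.
- by apply/measurable_EFinP; exact: mg.
- by move=> x; rewrite lee_fin mulr_ge0 ?gauss_ge0.
- by apply/measurable_EFinP; exact: mg.
have mo c' : measurable_fun setT (fun y : R => (gauss s (- y - u) * gauss (t - s) (c' - - y))%:E).
  apply/measurable_EFinP; apply: (measurableT_comp (mg c')); exact: oppr_measurable.
rewrite -ge0_integralD //; first last.
- by apply/measurable_EFinP; apply: measurable_funTS; exact: mk.
- move=> y /= aly; rewrite lee_fin mulr_ge0 // killed_gauss_ge0 //.
  + exact: ltW.
  + by move: aly al0; lra.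
  + by move: aly al0; lra.
- apply: measurable_funTS; apply: emeasurable_funD; first by apply/measurable_EFinP; exact: mg.
  exact: mo.
- by move=> y _; rewrite -EFinD lee_fin addr_ge0 // mulr_ge0 ?gauss_ge0.
apply: eq_integral => y _; rewrite -!EFinD /killed_gauss; congr (_%:E).
rewrite -(gaussN (- y - u)) // -(gaussN (- c - y)) // -(gaussN (- c - - y)) //.
have -> : (- (- y - u) = y + u)%R by ring.
have -> : (- (- c - y) = c + y)%R by ring.
have -> : (- (- c - - y) = c - y)%R by ring.
have -> : (c - - y = c + y)%R by ring.
ring.
Qed.

Lemma measurable_two_time_density : measurable_fun setT two_time_density.
Proof.
have mF : measurable_fun setT (fun p : (R * R)%type =>
    (\1_[set x | al < `|x|]%R p.2)%:E * (gauss s (p.2 - u) * gauss (t - s) (p.1 - p.2))%:E).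
  apply: emeasurable_funM; apply/measurable_EFinP.
    apply: measurableT_comp; last exact: measurable_snd.
    by apply: measurable_indic; exact: measurable_abs_ray.
  apply: measurable_funM; apply: (measurableT_comp (@measurable_gauss R _)); exact: measurable_funB.
rewrite (_ : two_time_density = (fun c => \int[lebesgue_measure]_y
    ((\1_[set x | al < `|x|]%R y)%:E * (gauss s (y - u) * gauss (t - s) (c - y))%:E))).
  apply: (@measurable_fun_fubini_tonelli_F _ _ (measurableTypeR R) (measurableTypeR R) R
    lebesgue_measure _ mF).
  by move=> p; rewrite mule_ge0 // lee_fin mulr_ge0 ?gauss_ge0.
by apply/funext => c; rewrite [LHS]integral_indicl.
Qed.

Lemma killed_density_ge0 c : (0 <= c)%R -> (0 <= killed_density c)%R.
Proof.
move=> c0; apply: Rintegral_ge0 => y /= aly; rewrite mulr_ge0 // killed_gauss_ge0 //.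
- exact: ltW.
- by move: aly al0; lra.
- by move: aly al0; lra.
Qed.

Lemma killed_law b : (0 <= b)%R ->
  P (positive_on Y u 0 t `&` [set o | (al < u + Y s o)%R] `&` [set o | (b < u + Y t o)%R]) =
  \int[lebesgue_measure]_(c in [set c | b < c]%R) (killed_density c)%:E.
Proof.
move=> b0; have H := killed_rays bm u0 s0 st al0 b0.
have mabs := measurable_abs_ray al.
have mb := measurable_ray b; have mnb := measurable_neg_ray b.
have e1 : P ([set o | (al < `|u + Y s o|)%R] `&` [set o | (b < u + Y t o)%R]) =
    \int[lebesgue_measure]_(c in [set c | b < c]%R) two_time_density c.
  exact: (@two_time_law _ _ _ _ _ bm u s t _ _ s0 st mabs mb).
have e2 : P ([set o | (al < `|u + Y s o|)%R] `&` [set o | (b < - (u + Y t o))%R]) =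
    \int[lebesgue_measure]_(c in [set c | b < c]%R) two_time_density (- c)%R.
  rewrite (@two_time_law _ _ _ _ _ bm u s t _ _ s0 st mabs mnb).
  rewrite integral_indicl [RHS]integral_indicl -lebesgue_integral_opp.
  - by apply: eq_integral => x _; rewrite !indic_pred opprK.
  - apply: emeasurable_funM; first by apply/measurable_EFinP; exact: measurable_indic.
    exact: measurable_two_time_density.
  - move=> x; rewrite mule_ge0 ?lee_fin //; apply: integral_ge0 => y _.
    by rewrite lee_fin mulr_ge0 ?gauss_ge0.
have e3 : \int[lebesgue_measure]_(c in [set c | b < c]%R) two_time_density c =
    \int[lebesgue_measure]_(c in [set c | b < c]%R) two_time_density (- c)%R +
    \int[lebesgue_measure]_(c in [set c | b < c]%R) (killed_density c)%:E.
  have h1 c : [set c : R | b < c]%R c -> 0 <= two_time_density (- c)%R.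
    by move=> _; apply: integral_ge0 => y _; rewrite lee_fin mulr_ge0 ?gauss_ge0.
  have h2 : measurable_fun [set c : R | b < c]%R (fun c => two_time_density (- c)%R).
    apply: measurable_funTS; apply: (measurableT_comp measurable_two_time_density).
    exact: oppr_measurable.
  have h3 c : [set c : R | b < c]%R c -> 0 <= (killed_density c)%:E.
    by move=> /= bc; rewrite lee_fin; apply: killed_density_ge0; move: bc b0; lra.
  have h4 : measurable_fun [set c : R | b < c]%R (fun c => (killed_density c)%:E).
    apply: measurable_funTS; apply/measurable_EFinP; apply: continuous_measurable_fun.
    exact: continuous_killed_density.
  rewrite -(@ge0_integralD _ (measurableTypeR R) R lebesgue_measure _ mb _ _ h1 h2 h3 h4).
  by apply: eq_integral => c; rewrite inE /= => bc; apply: two_time_density_opp; move: bc b0; lra.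
move: H; rewrite e1 e3 -e2 addeC => /(congr1 (fun x => x - P ([set o | (al < `|u + Y s o|)%R] `&`
  [set o | (b < - (u + Y t o))%R]))).
have mX : measurable ([set o | (al < `|u + Y s o|)%R] `&` [set o | (b < - (u + Y t o))%R]).
  by apply: measurableI; [exact: (event_V bm u s mabs)|exact: (event_V bm u t mnb)].
have fX : P ([set o | (al < `|u + Y s o|)%R] `&` [set o | (b < - (u + Y t o))%R]) \is a fin_num.
  exact: fin_num_measure.
by rewrite !addeK.
Qed.

End killed_density.

Section killed_mass.
Context (R : realType) d (T : measurableType d) (P : probability T R).
Context (Y : R -> T -> R) (bm : clean_bm P Y) (u : R).
Local Open Scope ereal_scope.

Lemma V_law (z : R) (E : set R) : (0 < z)%R -> measurable E ->
  P [set o | E (u + Y z o)%R] = \int[lebesgue_measure]_(y in E) (gauss z (y - u))%:E.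
Proof.
move=> z0 mE.
rewrite measure_indic; last by have := measurable_V bm u z measurableT mE; rewrite setTI.
have := @ge0_integral_V _ _ _ _ _ bm u z (fun x => (\1_E x)%:E) z0.
rewrite -integral_indicl; apply; last by move=> x; rewrite lee_fin.
by apply/measurable_EFinP; exact: measurable_indic.
Qed.

(** The case al = 0, where the constraint on V s is almost surely void. It gives
the total mass directly in terms of k_t, without the semigroup property. *)
Lemma killed_mass t b : (0 < u)%R -> (0 < t)%R -> (0 <= b)%R ->
  P (positive_on Y u 0 t `&` [set o | (b < u + Y t o)%R]) =
  \int[lebesgue_measure]_(c in [set c | b < c]%R) (killed_gauss t u c)%:E.
Proof.
move=> u0 t0 b0.
have s0 : (0 < t / 2)%R by rewrite divr_gt0.
have st : (t / 2 < t)%R by rewrite ltr_pdivrMr // ltr_pMr // ltr1n.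
have H := killed_rays bm u0 s0 st (lexx 0%R) b0.
have mb := measurable_ray b; have mnb := measurable_neg_ray b.
have mabs := measurable_abs_ray (0 : R).
have mV z (E : set R) : measurable E -> measurable [set o | E (u + Y z o)%R].
  by move=> mE; exact: (event_V bm u z mE).
have Vs0 : {ae P, forall o, (0 < `|u + Y (t / 2) o|)%R}.
  exists [set o | [set 0%R] (u + Y (t / 2) o)%R]; split.
  - by apply: mV; exact: measurable_set1.
  - rewrite (@V_law (t / 2) [set 0%R] s0 (measurable_set1 _)).
    by rewrite integral_set1.
  - by move=> o /=; rewrite normr_gt0 => /negP; rewrite negbK => /eqP.
have drop (E : set R) : measurable E -> P ([set o | (0 < `|u + Y (t / 2) o|)%R] `&`
    [set o | E (u + Y t o)%R]) = P [set o | E (u + Y t o)%R].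
  move=> mE; apply: measure_ae_eq; [|exact: mV|].
    by apply: measurableI; [exact: (mV _ _ mabs)|exact: mV].
  by apply: filterS Vs0 => o /= h; split=> [[]//|].
move: H; rewrite (drop _ mb) (drop _ mnb).
have -> : positive_on Y u 0 t `&` [set o | (0 < u + Y (t / 2) o)%R] = positive_on Y u 0 t.
  apply/seteqP; split=> o /=; first by case.
  by move=> pos; split => //; apply: pos; rewrite !ltW.
have e1 : P [set o | [set x | (b < x)%R] (u + Y t o)%R] =
    \int[lebesgue_measure]_(c in [set c | b < c]%R) (gauss t (c - u))%:E.
  exact: V_law.
have e2 : P [set o | [set x | (b < - x)%R] (u + Y t o)%R] =
    \int[lebesgue_measure]_(c in [set c | b < c]%R) (gauss t (c + u))%:E.
  rewrite (@V_law t _ t0 mnb) integral_indicl [RHS]integral_indicl -lebesgue_integral_opp.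
  - apply: eq_integral => x _; rewrite !indic_pred opprK -[in RHS]gaussN //.
    by rewrite opprD.
  - apply: emeasurable_funM; apply/measurable_EFinP; first exact: measurable_indic.
    by apply: (measurableT_comp (@measurable_gauss R _)); exact: measurable_funB.
  - by move=> x; rewrite mule_ge0 ?lee_fin ?gauss_ge0.
have e3 : \int[lebesgue_measure]_(c in [set c | b < c]%R) (gauss t (c - u))%:E =
    \int[lebesgue_measure]_(c in [set c | b < c]%R) (killed_gauss t u c)%:E +
    \int[lebesgue_measure]_(c in [set c | b < c]%R) (gauss t (c + u))%:E.
  have h1 c : [set c : R | b < c]%R c -> 0 <= (killed_gauss t u c)%:E.
    by move=> /= bc; rewrite lee_fin killed_gauss_ge0 // ltW //; exact: le_lt_trans bc.
  have h2 : measurable_fun [set c : R | b < c]%R (fun c => (killed_gauss t u c)%:E).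
    apply: measurable_funTS; apply/measurable_EFinP; apply: continuous_measurable_fun.
    exact: continuous_killed_gauss.
  have h3 c : [set c : R | b < c]%R c -> 0 <= (gauss t (c + u))%:E.
    by rewrite lee_fin gauss_ge0.
  have h4 : measurable_fun [set c : R | b < c]%R (fun c => (gauss t (c + u))%:E).
    apply: measurable_funTS; apply/measurable_EFinP.
    by apply: (measurableT_comp (@measurable_gauss R _)); exact: measurable_funD.
  rewrite -(@ge0_integralD _ (measurableTypeR R) R lebesgue_measure _ mb _ _ h1 h2 h3 h4).
  by apply: eq_integral => c _; rewrite -EFinD /killed_gauss subrK.
rewrite e1 e3 -e2 => /(congr1 (fun x => x - P [set o | [set x | (b < - x)%R] (u + Y t o)%R])).
have fX : P [set o | [set x | (b < - x)%R] (u + Y t o)%R] \is a fin_num.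
  by apply: fin_num_measure; exact: mV.
by rewrite !addeK.
Qed.

End killed_mass.

(** * The bridge at every endpoint *)

Lemma measurable_positive_paths (R : realType) (t : R) : 0 < t ->
  measurable (positive_paths t).
Proof.
move=> t0.
rewrite (_ : positive_paths t = \bigcup_n \bigcap_N \bigcap_(k in [set k | (k <= N.+1)%N])
    [set w : path_space t | n.+1%:R^-1 <= w (grid 0 t N k)]).
  apply: bigcupT_measurable => n; apply: bigcapT_measurable => N.
  apply: bigcap_measurable => [|k kN]; first by exists 0%N.
  have := measurable_evaluation (grid_itv t0 kN) measurableT
    (measurable_itv (`[n.+1%:R^-1, +oo[ : interval R)).
  by rewrite setTI; congr measurable; apply/seteqP; split=> w; rewrite /= in_itv /= andbT.
apply/seteqP; split=> w /=.
  move=> H; have cw : {within `[0, t], continuous w} by case: w {H}.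
  have [c ct Hc] := EVT_min (ltW t0) cw.
  have wc : 0 < w c by apply: H; move: ct; rewrite in_itv.
  have [n _ /(_ n (leqnn n)) nc] := near_infty_natSinv_lt (PosNum wc).
  exists n => // N _ k kN; apply: (le_trans (ltW nc)); apply: Hc.
  by rewrite in_itv /= grid_itv.
move=> [n _ H] z zt; rewrite ltNge; apply/negP => wz.
have cw : {within `[0, t], continuous w} by case: w {H wz}.
have n0 : 0 < n.+1%:R^-1 :> R by rewrite invr_gt0.
have [N _ /(_ N (leqnn N)) [k kN wk]] := grid_below t0 cw zt (le_lt_trans wz n0).
by have := H N I k kN => /=; rewrite leNgt wk.
Qed.

Lemma integral_itv_lt (R : realType) (F G : R -> R) (a b p q : R) : a < b -> p < q ->
  measurable_fun `]a, b] F -> measurable_fun `]a, b] G ->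
  (forall c, a < c <= b -> 0 <= F c <= p) -> (forall c, a < c <= b -> q <= G c) ->
  (\int[lebesgue_measure]_(c in `]a, b]) (F c)%:E <
   \int[lebesgue_measure]_(c in `]a, b]) (G c)%:E)%E.
Proof.
move=> ab pq mF mG Fp Gq.
have inI c : `]a, b]%classic c -> a < c <= b by rewrite /= in_itv.
have bI : a < b <= b by rewrite ab lexx.
have p0 : 0 <= p by have /andP[] := Fp b bI; exact: le_trans.
have mI : (\int[lebesgue_measure]_(c in `]a, b]) (p%:E : \bar R) = p%:E * (b - a)%:E)%E.
  by rewrite integral_cst //= lebesgue_measure_itv /= lte_fin ab.
have mI' : (\int[lebesgue_measure]_(c in `]a, b]) (q%:E : \bar R) = q%:E * (b - a)%:E)%E.
  by rewrite integral_cst //= lebesgue_measure_itv /= lte_fin ab.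
apply: (@le_lt_trans _ _ (p%:E * (b - a)%:E)%E).
  rewrite -mI; apply: ge0_le_integral => //.
  - by move=> c /inI /Fp /andP[]; rewrite lee_fin.
  - exact/measurable_EFinP.
  - by move=> c /inI /Fp /andP[]; rewrite lee_fin.
apply: (@lt_le_trans _ _ (q%:E * (b - a)%:E)%E).
  by rewrite -!EFinM lte_fin ltr_pM2r // subr_gt0.
rewrite -mI'; apply: ge0_le_integral => //.
- by move=> c _; rewrite lee_fin (le_trans p0) // ltW.
- exact/measurable_EFinP.
Qed.

(** The hypotheses give m * g = h almost everywhere. A strict inequality at c0
would persist on an interval on the side of c0 where monotonicity of m helps,
and the integrals over this interval would differ. *)
Lemma monotone_density (R : realType) (m g h : R -> R) :
  measurable_fun setT m -> (forall c, 0 <= m c) ->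
  (forall c c', c <= c' -> m c <= m c') ->
  continuous g -> (forall c, 0 < g c) -> continuous h -> (forall c, 0 < c -> 0 <= h c) ->
  (\int[lebesgue_measure]_(c in [set c : R | 0 < c]%R) (h c)%:E < +oo)%E ->
  (forall b, 0 <= b ->
    (\int[lebesgue_measure]_(c in [set c : R | b < c]%R) (m c * g c)%:E =
     \int[lebesgue_measure]_(c in [set c : R | b < c]%R) (h c)%:E)%E) ->
  forall c, 0 < c -> m c * g c = h c.
Proof.
move=> mm m0 mmono cg g0 ch h0 hoo mgh c0 c00.
have mmg : measurable_fun setT (fun c => m c * g c).
  by apply: measurable_funM => //; exact: continuous_measurable_fun.
have mh : measurable_fun setT h by exact: continuous_measurable_fun.
have split (F : R -> R) b b' : 0 <= b -> b < b' -> measurable_fun setT F -> (forall c, 0 < c -> 0 <= F c) ->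
    (\int[lebesgue_measure]_(c in [set c : R | b < c]%R) (F c)%:E =
     \int[lebesgue_measure]_(c in `]b, b']) (F c)%:E +
     \int[lebesgue_measure]_(c in [set c : R | b' < c]%R) (F c)%:E)%E.
  move=> b0 bb' mF F0.
  rewrite (_ : [set c : R | b < c] = `]b, b']%classic `|` [set c : R | b' < c]).
    rewrite ge0_integral_setU //.
    - exact: measurable_ray.
    - by apply/measurable_EFinP; exact: measurable_funTS.
    - move=> x /= xI; rewrite lee_fin; apply: F0; case: xI => [|b'x].
        by rewrite in_itv /= => /andP[bx _]; exact: le_lt_trans bx.
      by apply: le_lt_trans b'x; rewrite (le_trans b0) // ltW.
    - rewrite disj_set2E; apply/eqP; apply/seteqP; split=> // x [] /=.
      by rewrite in_itv /= => /andP[_ h1] h2; move: h1 h2; lra.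
  apply/seteqP; split=> x /=; rewrite in_itv /=.
    by move=> bx; have [xb'|b'x] := leP x b'; [left; rewrite bx|right].
  by case=> [/andP[]//|]; exact: lt_trans.
have itv b b' : 0 <= b -> b < b' ->
    (\int[lebesgue_measure]_(c in `]b, b']) (m c * g c)%:E =
     \int[lebesgue_measure]_(c in `]b, b']) (h c)%:E)%E.
  move=> b0 bb'; have b'0 : 0 <= b' by rewrite (le_trans b0) // ltW.
  have := mgh _ b0.
  rewrite (split h b b') // (split (fun c => m c * g c) b b') //; last first.
    by move=> c _; rewrite mulr_ge0 // ltW.
  rewrite (mgh _ b'0) => /(congr1 (fun x => x -
    \int[lebesgue_measure]_(c in [set c : R | (b' < c)%R]) (h c)%:E)%E).
  have fin : (\int[lebesgue_measure]_(c in [set c : R | (b' < c)%R]) (h c)%:E)%E \is a fin_num.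
    rewrite ge0_fin_numE; last first.
      by apply: integral_ge0 => c /= b'c; rewrite lee_fin h0 //; exact: le_lt_trans b'c.
    apply: le_lt_trans hoo; apply: ge0_subset_integral => //.
    - exact: measurable_ray.
    - exact: measurable_ray.
    - by apply/measurable_EFinP; exact: measurable_funTS.
    - by move=> c /=; exact: le_lt_trans.
  by rewrite !addeK.
apply/eqP; rewrite eq_le !leNgt; apply/andP; split; apply/negP => H.
- pose mid := (h c0 + m c0 * g c0) / 2; pose de := (m c0 * g c0 - h c0) / 4.
  have de0 : 0 < de by rewrite /de; lra.
  have n1 : \forall c \near c0, mid + de < m c0 * g c.
    have cmg : m c0 * g c @[c --> c0] --> m c0 * g c0 by apply: cvgM; [exact: cvg_cst|exact: cg].
    by move: cmg => /cvgr_gt; apply; rewrite /mid /de; lra.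
  have n2 : \forall c \near c0, h c < mid - de.
    by have := ch c0 => /cvgr_lt; apply; rewrite /mid /de; lra.
  have [r /= r0 cr] : nbhs_ball c0 [set c | mid + de < m c0 * g c /\ h c < mid - de].
    by apply/nbhs_ballP; near=> c; split; near: c.
  have Icr c : c0 < c <= c0 + r / 2 -> mid + de < m c0 * g c /\ h c < mid - de.
    move=> /andP[c1 c2]; apply: cr.
    by rewrite /ball /= ltr_distlC; apply/andP; split; lra.
  have lt1 : c0 < c0 + r / 2 by rewrite ltrDl divr_gt0.
  have pq : mid - de < mid + de by lra.
  have := @integral_itv_lt R h (fun c => m c * g c) c0 (c0 + r / 2) _ _ lt1 pq (measurable_funTS mh)
    (measurable_funTS mmg) _ _.
  rewrite (itv _ _ (ltW c00) lt1) ltxx => F; apply: notF; apply: F.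
  + move=> c cI; have [_ /ltW ->] := Icr c cI; rewrite andbT h0 //.
    by have /andP[c1 _] := cI; exact: lt_trans c1.
  + move=> c cI; have [/ltW h1 _] := Icr c cI; apply: (le_trans h1).
    by apply: ler_wpM2r; [exact: ltW|apply: mmono; have /andP[/ltW] := cI].
- pose mid := (h c0 + m c0 * g c0) / 2; pose de := (h c0 - m c0 * g c0) / 4.
  have de0 : 0 < de by rewrite /de; lra.
  have n1 : \forall c \near c0, m c0 * g c < mid - de.
    have cmg : m c0 * g c @[c --> c0] --> m c0 * g c0 by apply: cvgM; [exact: cvg_cst|exact: cg].
    by move: cmg => /cvgr_lt; apply; rewrite /mid /de; lra.
  have n2 : \forall c \near c0, mid + de < h c.
    by have := ch c0 => /cvgr_gt; apply; rewrite /mid /de; lra.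
  have [r /= r0 cr] : nbhs_ball c0 [set c | m c0 * g c < mid - de /\ mid + de < h c].
    by apply/nbhs_ballP; near=> c; split; near: c.
  pose b := Num.max 0 (c0 - r / 2).
  have b0 : 0 <= b by rewrite le_max lexx.
  have bc : b < c0 by rewrite gt_max c00 /=; lra.
  have Icr c : b < c <= c0 -> m c0 * g c < mid - de /\ mid + de < h c.
    rewrite gt_max => /andP[/andP[_ c1] c2]; apply: cr.
    by rewrite /ball /= ltr_distlC; apply/andP; split; lra.
  have pq : mid - de < mid + de by lra.
  have := @integral_itv_lt R (fun c => m c * g c) h b c0 _ _ bc pq (measurable_funTS mmg)
    (measurable_funTS mh) _ _.
  rewrite (itv _ _ b0 bc) ltxx => F; apply: notF; apply: F.
  + move=> c cI; have [/ltW h1 _] := Icr c cI; rewrite mulr_ge0 ?m0 ?(ltW (g0 _)) //=.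
    apply: le_trans h1; apply: ler_wpM2r; first exact: ltW.
    by apply: mmono; have /andP[_] := cI.
  + by move=> c cI; have [_ /ltW] := Icr c cI.
Unshelve. all: by end_near.
Qed.

Section density_measure.
Context (R : realType) d (T : measurableType d) (mu : {measure set T -> \bar R}).
Context (h : T -> R) (h0 : forall x, 0 <= h x) (mh : measurable_fun setT h).

Definition density_measure of (forall x, 0 <= h x) & measurable_fun setT h :=
  fun A : set T => (\int[mu]_(x in A) (h x)%:E)%E.

Let density_measure0 : density_measure h0 mh set0 = 0%E.
Proof. exact: integral_set0. Qed.

Let density_measure_ge0 A : (0 <= density_measure h0 mh A)%E.
Proof. by apply: integral_ge0 => x _; rewrite lee_fin. Qed.

Let density_measure_sigma_additive : semi_sigma_additive (density_measure h0 mh).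
Proof.
move=> A mA tA mUA; rewrite /density_measure ge0_integral_bigcup //.
- apply: is_cvg_ereal_nneg_natsum_cond => n _ _.
  by apply: integral_ge0 => x _; rewrite lee_fin.
- by apply/measurable_EFinP; exact: measurable_funTS.
- by move=> x _; rewrite lee_fin.
Qed.

HB.instance Definition _ := isMeasure.Build _ _ _ (density_measure h0 mh)
  density_measure0 density_measure_ge0 density_measure_sigma_additive.

End density_measure.

Lemma measure_eq_rays (R : realType) (m1 m2 : {measure set (measurableTypeR R) -> \bar R}) :
  (m1 setT < +oo)%E ->
  (forall a : R, m1 [set x : R | a < x] = m2 [set x : R | a < x]) ->
  forall E : set R, measurable E -> m1 E = m2 E.
Proof.
move=> m1oo m12 E /borel_rays.
have rayE a : [set x : R | a < x] = `]a, +oo[%classic.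
  by apply/seteqP; split=> x; rewrite /= in_itv /= andbT.
apply: (@g_sigma_algebra_measure_unique _ R (measurableTypeR R) (@RGenOInfty.G R) _
  (fun k => `](- k%:R : R), +oo[%classic)).
- by move=> _ [a ->]; exact: measurable_itv.
- by move=> k; exists (- k%:R).
- apply/seteqP; split=> // x _; exists (Num.truncn `|x|).+1 => //=.
  rewrite in_itv /= andbT ltrNl; apply: le_lt_trans (truncnS_gt _).
  by rewrite -normrN ler_norm.
- move=> _ _ [a ->] [b ->]; exists (Num.max a b).
  by apply/seteqP; split=> x; rewrite /= !in_itv /= !andbT gt_max => /andP.
- by move=> _ [a ->]; rewrite -rayE.
- by move=> k; apply: le_lt_trans m1oo; apply: le_measure; rewrite ?inE.
Qed.

Lemma kernel_fin (R : realType) (t : R) (Q : R.-pker R ~> path_space t) c A :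
  measurable A -> Q c A \is a fin_num.
Proof.
move=> mA; rewrite ge0_fin_numE //; apply: le_lt_trans (kernel_lty Q c).
by apply: le_measure; rewrite ?inE.
Qed.

Section bridge_density.
Context (R : realType) d (T : measurableType d) (P : probability T R).
Context (Y : R -> T -> R) (bm : clean_bm P Y) (u : R) (u0 : 0 < u).
Context (s t : R) (s0 : 0 < s) (st : s < t).

Let t0 : 0 < t. Proof. exact: lt_trans st. Qed.
Let ts0 : 0 < t - s. Proof. by rewrite subr_gt0. Qed.
Let Q c := bridge_pker bm t u c.

Let mpos := measurable_positive_paths t0.
Let s_itv : 0 <= s <= t. Proof. by rewrite !ltW. Qed.

Lemma bridge_integral (b : R) (A : set (path_space t)) : measurable A ->
  (P [set o | A (tilt u (u + Y t o, bridge_path bm t o))%R /\ (b < u + Y t o)%R] =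
   \int[lebesgue_measure]_(c in [set c | b < c]%R) (fine (Q c A) * gauss t (c - u))%:E)%E.
Proof.
move=> mA; pose S : {mfun T >-> R} := mfun_Sub (mem_set (measurable_V bm u t)).
have mb := measurable_ray b.
have SE o : S o = u + 0 * t + Y t o by rewrite mul0r addr0.
have mQ : measurable_fun setT (fun c => Q c A) by exact: measurable_kernel.
have := disintegration bm t0 SE mb mA.
rewrite integral_indicl ge0_integral_distribution; first last.
- by move=> c; rewrite mule_ge0 ?lee_fin.
- by apply: emeasurable_funM => //; apply/measurable_EFinP; exact: measurable_indic.
have := @ge0_integral_V _ _ _ _ _ bm u t (fun c => (\1_[set c | (b < c)%R] c)%:E * Q c A)%E t0 _ _.
move=> ->; first last.
- by move=> c; rewrite mule_ge0 ?lee_fin.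
- by apply: emeasurable_funM => //; apply/measurable_EFinP; exact: measurable_indic.
move=> H; rewrite integral_indicl; apply: etrans (etrans H _).
  by congr (P _); apply/seteqP; split=> o [].
apply: eq_integral => c _; rewrite -muleA EFinM fineK //.
exact: kernel_fin.
Qed.

(** For an event closed under raising the path, the probability under the tilted
bridge is nondecreasing in the endpoint, so that a continuous density
determines it at every endpoint. *)
Lemma bridge_up_closed_density (A : set (path_space t)) (h : R -> R) : measurable A ->
  (forall (w w' : path_space t), (forall z, 0 <= z <= t -> w z <= w' z) -> A w -> A w') ->
  continuous h -> (forall c, 0 < c -> 0 <= h c) ->
  (forall b : R, 0 <= b ->
    (P [set o | A (tilt u (u + Y t o, bridge_path bm t o))%R /\ (b < u + Y t o)%R] =
    \int[lebesgue_measure]_(c in [set c | b < c]%R) (h c)%:E)%E) ->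
  forall c, 0 < c -> fine (Q c A) * gauss t (c - u) = h c.
Proof.
move=> mA upA ch h0 hE.
have mQ : measurable_fun setT (fun c => Q c A) by exact: measurable_kernel.
apply: (@monotone_density R (fun c => fine (Q c A)) (fun c => gauss t (c - u))) => //.
- by apply: measurableT_comp.
- move=> c c' cc'; apply: fine_le; rewrite ?kernel_fin //.
  rewrite !bridge_kernelE; apply: le_measure; rewrite ?inE.
  + by have := measurable_tilted bm u c measurableT mA; rewrite setTI.
  + by have := measurable_tilted bm u c' measurableT mA; rewrite setTI.
  move=> o /=; apply: upA => z /andP[z0 zt] /=.
  by rewrite lerD2l ler_wpM2l ?divr_ge0 ?(ltW t0) // lerB.
- move=> c; apply: (@continuous_comp _ _ _ (fun c : R => c - u) (gauss t)).
    by apply: cvgB; [exact: cvg_id|exact: cvg_cst].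
  exact: continuous_gauss.
- by move=> c; exact: gauss_gt0.
- rewrite -hE //; apply: (le_lt_trans (probability_le1 _ _)); rewrite ?ltry //.
  apply: measurableI; last exact: (event_V bm u t (measurable_ray 0)).
  rewrite -[X in measurable X]setTI.
  apply: (measurableT_comp (measurable_tilt (t := t) u)) => //.
  apply: measurable_fun_pair; [exact: (measurable_V bm u t)|exact: measurable_bridge_path].
- by move=> b b0; rewrite -bridge_integral // hE.
Qed.

Let tiltE o z : tilt u (u + Y t o, bridge_path bm t o) z = u + Y z o.
Proof. by have := tilt_bridge bm t0 u 0 z o; rewrite !mul0r !addr0. Qed.

Lemma bridge_positive c : 0 < c ->
  fine (Q c (positive_paths t)) * gauss t (c - u) = killed_gauss t u c.
Proof.
apply: bridge_up_closed_density => //.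
- by move=> w w' ww' pos z zt; apply: lt_le_trans (ww' z zt); exact: pos.
- exact: continuous_killed_gauss.
- by move=> c' c'0; apply: killed_gauss_ge0; rewrite ?ltW.
- move=> b b0; rewrite -(killed_mass bm) //; congr (P _).
  by apply/seteqP; split=> o [pos bt]; split=> // z zt; have := pos z zt; rewrite tiltE.
Qed.

Lemma bridge_positive_above (al c : R) : 0 <= al -> 0 < c ->
  fine (Q c ([set w : path_space t | al < w s] `&` positive_paths t)) * gauss t (c - u) =
  killed_density u s t al c.
Proof.
move=> al0; apply: bridge_up_closed_density.
- apply: measurableI => //.
  by have := measurable_evaluation s_itv measurableT (measurable_ray al); rewrite setTI.
- move=> w w' ww' [als pos]; split; first exact: lt_le_trans (ww' s s_itv).
  by move=> z zt; apply: lt_le_trans (ww' z zt); exact: pos.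
- exact: continuous_killed_density.
- by move=> c' c'0; apply: killed_density_ge0 => //; exact: ltW.
- move=> b b0; rewrite -(killed_law bm) //; congr (P _).
  apply/seteqP; split=> o.
    move=> [[als pos] bt]; split; last by [].
    split; last by move: als; rewrite /mkset tiltE.
    by move=> z zt; have := pos z zt; rewrite tiltE.
  move=> [[pos als] bt]; split; last by [].
  split; first by rewrite /mkset tiltE.
  by move=> z zt; rewrite tiltE; exact: pos.
Qed.

(** The two sides are finite measures in E, and they agree on rays. *)
Lemma bridge_positive_law (c : R) (E : set R) : 0 < c -> measurable E ->
  (Q c ([set w : path_space t | E (w s)] `&` positive_paths t) =
   \int[lebesgue_measure]_(y in E `&` `]0%R, +oo[)
     (killed_gauss s u y * killed_gauss (t - s) y c / gauss t (c - u))%:E)%E.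
Proof.
move=> c0; set g := gauss t (c - u); have g0 : 0 < g by exact: gauss_gt0.
pose kk (y : R) := killed_gauss s u y * killed_gauss (t - s) y c / g.
pose h (y : measurableTypeR R) : R := \1_[set y : R | 0 < y] y * kk y.
have mkk : measurable_fun setT kk.
  apply: continuous_measurable_fun => y; apply: cvgM; last exact: cvg_cst.
  apply: cvgM; first exact: continuous_killed_gauss.
  rewrite (_ : killed_gauss (t - s) ^~ c = killed_gauss (t - s) c).
    by rewrite (killed_gaussC y c ts0); exact: continuous_killed_gauss.
  by apply/funext => x; exact: killed_gaussC.
have kk0 y : 0 < y -> 0 <= kk y.
  by move=> y0; rewrite /kk !mulr_ge0 ?invr_ge0 ?killed_gauss_ge0 // ltW.
have h0 y : 0 <= h y.
  rewrite /h indic_pred; have [/kk0 y0|y0] := ltP 0 y; first by rewrite mul1r.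
  by rewrite mul0r.
have mh : measurable_fun setT h.
  by apply: measurable_funM => //; apply: measurable_indic; exact: measurable_ray.
have mev : measurable_fun setT (fun w : path_space t => w s : measurableTypeR R).
  exact: measurable_evaluation.
pose m1 : {measure set (measurableTypeR R) -> \bar R} := image_measure (mrestr (Q c) mpos) mev.
pose m2 : {measure set (measurableTypeR R) -> \bar R} := density_measure lebesgue_measure h0 mh.
have mpre (A : set R) : measurable A -> measurable [set w : path_space t | A (w s)].
  by move=> mA; have := measurable_evaluation s_itv measurableT mA; rewrite setTI.
have m1E A : m1 A = Q c ([set w : path_space t | A (w s)] `&` positive_paths t) by [].
move=> mE; rewrite -m1E.
transitivity (m2 E).
  apply: measure_eq_rays mE.
    rewrite m1E -ge0_fin_numE //; apply: kernel_fin.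
    by apply: measurableI => //; exact: (mpre _ measurableT).
  (* A ray that starts below 0 sees the same positive paths as the ray from 0. *)
  move=> a; pose a' := Num.max 0 a; have a'0 : 0 <= a' by rewrite le_max lexx.
  have mX : measurable ([set w : path_space t | a' < w s] `&` positive_paths t).
    by apply: measurableI => //; exact: (mpre _ (measurable_ray a')).
  transitivity (Q c ([set w : path_space t | a' < w s] `&` positive_paths t)).
    rewrite m1E; congr (Q c _); apply/seteqP; split=> w /= [aw pos].
      by split => //; rewrite gt_max aw andbT; apply: pos.
    by split => //; move: aw; rewrite gt_max => /andP[].
  rewrite -[LHS]fineK ?kernel_fin //.
  have -> : fine (Q c ([set w : path_space t | a' < w s] `&` positive_paths t)) =
      g^-1 * killed_density u s t a' c.
    by rewrite -(bridge_positive_above a'0 c0) mulrCA mulVf ?mulr1 // gt_eqF.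
  rewrite EFinM killed_densityE // -ge0_integralZl ?lee_fin ?invr_ge0 ?(ltW g0) //; first last.
  - move=> y /= ay; rewrite lee_fin mulr_ge0 // killed_gauss_ge0 ?(ltW c0) ?(ltW u0) //.
      by rewrite (le_trans a'0) // ltW.
    by rewrite (le_trans a'0) // ltW.
  - apply/measurable_EFinP; apply: measurable_funTS.
    rewrite (_ : (fun y => _) = (fun y => g * kk y)); first exact: measurable_funM.
    by apply/funext => y; rewrite /kk mulrCA divff ?mulr1 // gt_eqF.
  - exact: measurable_ray.
  rewrite (integral_indicl lebesgue_measure [set x : R | a' < x]%R).
  rewrite /m2 /= /density_measure (integral_indicl lebesgue_measure [set x : R | a < x]%R).
  apply: eq_integral => y _; rewrite !indic_pred /h /kk -!EFinM indic_pred gt_max.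
  case: (0 < y); case: (a < y); rewrite /= ?mul0r ?mul1r //.
  by rewrite mulrC.
rewrite (integral_indicl lebesgue_measure (E `&` _)).
rewrite /m2 /= /density_measure (integral_indicl lebesgue_measure E).
apply: eq_integral => y _; rewrite /h indicI /= EFinM muleA -EFinM; congr (_ * _ * _)%:E.
by rewrite indic_pred indicE; congr (nat_of_bool _)%:R; apply/idP/idP; rewrite inE /= in_itv /= andbT.
Qed.

End bridge_density.

(** * Asymptotics of the density as the endpoints tend to zero *)

Section sinhc.
Context (R : realType).
Implicit Types x : R.

(** The hyperbolic sine of x divided by x. *)
Definition sinhc x : R := (expR x - expR (- x)) / (2 * x).

Lemma expR_sub_opp x : 0 < x -> expR x - expR (- x) = 2 * x * sinhc x.
Proof. by move=> x0; rewrite /sinhc mulrC divfK // gt_eqF // mulr_gt0. Qed.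

Lemma sinhc_ge1 x : 0 < x -> 1 <= sinhc x.
Proof.
move=> x0; rewrite ler_pdivlMr ?mulr_gt0 // mul1r.
pose f (y : R) := expR y - expR (- y).
have df (y : R) : is_derive y 1 f (expR y + expR (- y)).
  have dN : is_derive y 1 (expR \o -%R) (expR (- y) * - 1).
    by apply: is_derive1_comp; apply: is_deriveN; exact: is_derive_id.
  by have := is_deriveB (is_derive_expR y) dN; rewrite mulrN1 opprK.
have cf : {within `[0, x], continuous f}.
  apply: derivable_within_continuous => y _.
  by have [] := df y.
have [c _] := @MVT R f (fun y => expR y + expR (- y)) 0 x x0 (fun y _ => df y) cf.
rewrite /f oppr0 subrr !subr0 addr0 => ->; rewrite ler_pM2r //.
have := expR_ge1Dx c; have := expR_ge1Dx (- c); lra.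
Qed.

Lemma sinhc_le x : 0 < x -> sinhc x <= expR x.
Proof.
move=> x0; rewrite ler_pdivrMr ?mulr_gt0 //.
have h : 1 - 2 * x <= expR (- x) * expR (- x).
  by rewrite -expRD; apply: le_trans (expR_ge1Dx (- x + - x)); lra.
have e : expR x * (expR (- x) * expR (- x)) = expR (- x).
  by rewrite mulrA expRxMexpNx_1 mul1r.
rewrite -subr_ge0; have -> : expR x * (2 * x) - (expR x - expR (- x)) =
  expR (- x) - expR x * (1 - 2 * x) by ring.
by rewrite subr_ge0 -[leRHS]e ler_pM2l ?expR_gt0.
Qed.

Lemma sinhc_gt0 x : 0 < x -> 0 < sinhc x.
Proof. by move=> x0; apply: lt_le_trans (sinhc_ge1 x0). Qed.

End sinhc.

Section asymptotics.
Context (R : realType) (s t : R) (s0 : 0 < s) (st : s < t).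

Let t0 : 0 < t. Proof. exact: lt_trans st. Qed.
Let ts0 : 0 < t - s. Proof. by rewrite subr_gt0. Qed.

Definition excursion_pdf (y : R) : R :=
  Num.sqrt (2 / pi) * y ^+ 2 * (t / (s * (t - s))) `^ (3 / 2) *
  expR (- (y ^+ 2 * t / (2 * s * (t - s)))).

Definition killed_bridge_pdf (u c y : R) : R :=
  killed_gauss s u y * killed_gauss (t - s) y c / killed_gauss t u c.

Let rho (u c y : R) : R :=
  sinhc (u * y / s) * sinhc (y * c / (t - s)) / sinhc (u * c / t) *
  expR (- (u ^+ 2 * ((2 * s)^-1 - (2 * t)^-1) + c ^+ 2 * ((2 * (t - s))^-1 - (2 * t)^-1))).

Lemma killed_gaussE (v x y : R) : 0 < v -> 0 < x -> 0 < y ->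
  killed_gauss v x y = (Num.sqrt (v * pi *+ 2))^-1 *
    expR (- ((x ^+ 2 + y ^+ 2) / (2 * v))) * (2 * (x * y / v) * sinhc (x * y / v)).
Proof.
move=> v0 x0 y0; have xy0 : 0 < x * y / v by rewrite divr_gt0 // mulr_gt0.
rewrite -expR_sub_opp // /killed_gauss !gaussE // -mulrBr -mulrA; congr (_ * _).
rewrite mulrBr -!expRD; congr (expR _ - expR _); field; rewrite gt_eqF //.
Qed.

Lemma pdf_constant (p : R) : 0 < p ->
  Num.sqrt (t * p *+ 2) / (Num.sqrt (s * p *+ 2) * Num.sqrt ((t - s) * p *+ 2)) *
    (2 * (t / (s * (t - s)))) =
  Num.sqrt (2 / p) * (t / (s * (t - s))) `^ (3 / 2).
Proof.
move=> p0; have A0 v : 0 < v -> 0 < v * p *+ 2 :> R.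
  by move=> v0; rewrite mulrn_wgt0 // mulr_gt0.
set r := t / (s * (t - s)); have r0 : 0 < r by rewrite divr_gt0 // mulr_gt0.
have h1 : Num.sqrt (t * p *+ 2) =
    Num.sqrt (s * p *+ 2) * Num.sqrt ((t - s) * p *+ 2) * Num.sqrt (r / (2 * p)).
  rewrite -!sqrtrM; [|by rewrite mulr_ge0 // ltW // A0|by rewrite ltW // A0].
  congr Num.sqrt; rewrite /r !mulr2n; field.
  by rewrite !gt_eqF.
have h2 : 2 * Num.sqrt (r / (2 * p)) = Num.sqrt (2 / p) * Num.sqrt r.
  rewrite -[X in X * _ = _](ger0_norm (ler0n _ 2)) -sqrtr_sqr -!sqrtrM ?sqr_ge0 ?divr_ge0 ?(ltW p0) //.
  by congr Num.sqrt; field; rewrite gt_eqF.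
have h3 : r `^ (3 / 2) = r * Num.sqrt r.
  have -> : (3 / 2 : R) = 1 + 2^-1 by field.
  rewrite powRD; last by rewrite (gt_eqF r0) implybT.
  by rewrite powRr1 ?powR12_sqrt // ltW.
rewrite h1 h3 (mulrC (Num.sqrt _ * Num.sqrt _)) mulfK; last first.
  by rewrite mulf_neq0 // gt_eqF // sqrtr_gt0 A0.
transitivity (2 * Num.sqrt (r / (2 * p)) * r); first by ring.
by rewrite h2; ring.
Qed.

(** The Gaussian exponents add up to that of q, up to terms without y. The factors
u and c of the arguments of the hyperbolic sines cancel between numerator and
denominator, and y ^+ 2 is what they leave. *)
Lemma killed_bridge_pdfE (u c y : R) : 0 < u -> 0 < c -> 0 < y ->
  killed_bridge_pdf u c y = excursion_pdf y * rho u c y.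
Proof.
move=> u0 c0 y0; rewrite /killed_bridge_pdf !killed_gaussE // /excursion_pdf /rho.
set A1 := Num.sqrt (s * pi *+ 2); set A2 := Num.sqrt ((t - s) * pi *+ 2).
set A3 := Num.sqrt (t * pi *+ 2).
have A0 v : 0 < v -> 0 < Num.sqrt (v * pi *+ 2) :> R.
  by move=> v0; rewrite sqrtr_gt0 mulrn_wgt0 // mulr_gt0 // pi_gt0.
have A10 : A1 != 0 by rewrite gt_eqF // A0.
have A20 : A2 != 0 by rewrite gt_eqF // A0.
have A30 : A3 != 0 by rewrite gt_eqF // A0.
have uc0 : 0 < u * c / t by rewrite divr_gt0 // mulr_gt0.
have S30 : sinhc (u * c / t) != 0 by rewrite gt_eqF // sinhc_gt0.
set E1 := expR (- ((u ^+ 2 + y ^+ 2) / (2 * s))).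
set E2 := expR (- ((y ^+ 2 + c ^+ 2) / (2 * (t - s)))).
set E3 := expR (- ((u ^+ 2 + c ^+ 2) / (2 * t))).
set Eq := expR (- (y ^+ 2 * t / (2 * s * (t - s)))); set Er := expR (- (_ + _)).
have E30 : E3 != 0 by rewrite gt_eqF // expR_gt0.
have EE : E1 * E2 = E3 * (Eq * Er).
  rewrite /E1 /E2 /E3 /Eq /Er -!expRD; congr expR; field.
  by rewrite !gt_eqF.
have r0 : 0 < t / (s * (t - s)) by rewrite divr_gt0 // mulr_gt0.
have cst : A3 / (A1 * A2) * (2 * (t / (s * (t - s)))) =
    Num.sqrt (2 / pi) * (t / (s * (t - s))) `^ (3 / 2).
  exact: (pdf_constant (pi_gt0 R)).
transitivity (A3 / (A1 * A2) * (2 * (t / (s * (t - s)))) * y ^+ 2 * (E1 * E2 / E3) *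
  (sinhc (u * y / s) * sinhc (y * c / (t - s)) / sinhc (u * c / t))).
  by field; rewrite A10 A20 A30 E30 S30 !gt_eqF.
rewrite EE cst; move: (Num.sqrt (2 / pi)) (_ `^ _) => p1 p2.
by field; rewrite E30 S30.
Qed.

Lemma excursion_pdf_ge0 y : 0 <= excursion_pdf y.
Proof.
exact: (mulr_ge0 (mulr_ge0 (mulr_ge0 (sqrtr_ge0 _) (sqr_ge0 _)) (powR_ge0 _ _)) (expR_ge0 _)).
Qed.

(** Uniform in y: lower bound of the ratio between the density of the conditioned
bridge and its limit. *)
Definition ratio_lower_bound (u c : R) : R := expR (- (u * c / t +
  (u ^+ 2 * ((2 * s)^-1 - (2 * t)^-1) + c ^+ 2 * ((2 * (t - s))^-1 - (2 * t)^-1)))).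

Let coef_ge0 v : 0 < v -> v < t -> 0 <= (2 * v)^-1 - (2 * t)^-1.
Proof.
by move=> v0 vt; rewrite subr_ge0 lef_pV2 ?posrE ?mulr_gt0 // ler_pM2l // ltW.
Qed.

Let gap_ge0 (u c : R) :
  0 <= u ^+ 2 * ((2 * s)^-1 - (2 * t)^-1) + c ^+ 2 * ((2 * (t - s))^-1 - (2 * t)^-1).
Proof.
rewrite addr_ge0 // mulr_ge0 ?sqr_ge0 // coef_ge0 //.
by rewrite ltrBlDr ltrDl.
Qed.

Lemma ratio_lower_bound_le1 u c : 0 < u -> 0 < c -> ratio_lower_bound u c <= 1.
Proof.
move=> u0 c0; rewrite expR_le1 oppr_le0 addr_ge0 //.
by rewrite divr_ge0 ?mulr_ge0 // ltW.
Qed.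

Lemma killed_bridge_pdf_ge (u c y : R) : 0 < u -> 0 < c -> 0 < y ->
  ratio_lower_bound u c * excursion_pdf y <= killed_bridge_pdf u c y.
Proof.
move=> u0 c0 y0; rewrite killed_bridge_pdfE // mulrC.
apply: ler_wpM2l; first exact: excursion_pdf_ge0.
rewrite /ratio_lower_bound /rho opprD expRD ler_wpM2r ?expR_ge0 //.
have uc0 : 0 < u * c / t by rewrite divr_gt0 // mulr_gt0.
rewrite ler_pdivlMr ?sinhc_gt0 //.
apply: (@le_trans _ _ 1).
  rewrite expRN mulrC ler_pdivrMr ?expR_gt0 // mul1r; exact: sinhc_le.
by rewrite mulr_ege1 // sinhc_ge1 // divr_gt0 // mulr_gt0.
Qed.

Lemma killed_bridge_pdf_le (u c y : R) : 0 < u -> 0 < c -> 0 < y ->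
  killed_bridge_pdf u c y <= expR (y * (u / s + c / (t - s))) * excursion_pdf y.
Proof.
move=> u0 c0 y0; rewrite killed_bridge_pdfE // mulrC.
apply: ler_wpM2r; first exact: excursion_pdf_ge0.
have uy0 : 0 < u * y / s by rewrite divr_gt0 // mulr_gt0.
have yc0 : 0 < y * c / (t - s) by rewrite divr_gt0 // mulr_gt0.
have uc0 : 0 < u * c / t by rewrite divr_gt0 // mulr_gt0.
rewrite /rho -[leRHS]mulr1; apply: ler_pM.
- by apply: divr_ge0; [apply: mulr_ge0|]; apply: ltW; exact: sinhc_gt0.
- exact: expR_ge0.
- rewrite ler_pdivrMr ?sinhc_gt0 //.
  apply: (@le_trans _ _ (expR (y * (u / s + c / (t - s))))); last first.
    by rewrite ler_peMr ?expR_ge0 // sinhc_ge1.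
  have -> : y * (u / s + c / (t - s)) = u * y / s + y * c / (t - s) by ring.
  rewrite expRD; apply: ler_pM; [| |exact: sinhc_le|exact: sinhc_le];
    by apply: ltW; exact: sinhc_gt0.
- by rewrite expR_le1 oppr_le0.
Qed.

Lemma near_endpoints (x : R) : 0 < x ->
  \forall uc \near ((0 : R)^'+, (0 : R)^'+), 0 < uc.1 < x /\ 0 < uc.2 < x.
Proof.
move=> x0; exists (`]0, x[%classic, `]0, x[%classic) => /=.
  by split; apply: filterS2 (nbhs_right_gt 0) (nbhs_right_lt x0) => z z0 zx; rewrite /= in_itv /= z0.
by move=> uc [/=]; rewrite !in_itv.
Qed.

Lemma cvg_endpoints (h : R * R -> R) : {for (0, 0), continuous h} ->
  h uc @[uc --> ((0 : R)^'+, (0 : R)^'+)] --> h (0, 0).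
Proof.
move=> ch A hA; have [[U V] [/= U0 V0] UV] := ch A hA.
exists (U, V) => //=; split; [exact: (cvg_at_right_filter cvg_id)|exact: (cvg_at_right_filter cvg_id)].
Qed.

Lemma ratio_lower_bound_cvg : ratio_lower_bound uc.1 uc.2 @[uc --> ((0 : R)^'+, (0 : R)^'+)] --> (1 : R).
Proof.
have -> : (1 : R) = ratio_lower_bound (0 : R) (0 : R).
  by rewrite /ratio_lower_bound /= expr0n /= !mul0r !addr0 oppr0 expR0.
apply: (@cvg_endpoints (fun uc : R * R => ratio_lower_bound uc.1 uc.2)).
apply: continuous_comp; last exact: continuous_expR.
apply: continuousN; apply: cvgD.
  apply: cvgM; last exact: cvg_cst.
  by apply: cvgM; [exact: cvg_fst|exact: cvg_snd].
apply: cvgD; (apply: cvgM; last exact: cvg_cst).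
  by apply: cvgM; exact: cvg_fst.
by apply: cvgM; exact: cvg_snd.
Qed.

Lemma slope_cvg : (uc.1 / s + uc.2 / (t - s) : R)
  @[uc --> ((0 : R)^'+, (0 : R)^'+)] --> (0 : R).
Proof.
have e0 : (0 : R) / s + (0 : R) / (t - s) = 0 by rewrite !mul0r addr0.
rewrite -[X in _ --> X]e0.
apply: (@cvg_endpoints (fun uc : R * R => uc.1 / s + uc.2 / (t - s))).
apply: cvgD; (apply: cvgM; last exact: cvg_cst); [exact: cvg_fst|exact: cvg_snd].
Qed.

Lemma killed_bridge_pdf_cvg y : 0 < y ->
  killed_bridge_pdf uc.1 uc.2 y @[uc --> ((0 : R)^'+, (0 : R)^'+)] --> excursion_pdf y.
Proof.
move=> y0.
apply: (@squeeze_cvgr _ _ _ _ (fun uc => ratio_lower_bound uc.1 uc.2 * excursion_pdf y)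
  (fun uc => expR (y * (uc.1 / s + uc.2 / (t - s))) * excursion_pdf y)).
- apply: filterS (near_endpoints ltr01) => -[u c] /= [/andP[u0 _] /andP[c0 _]].
  by rewrite killed_bridge_pdf_ge //= killed_bridge_pdf_le.
- by rewrite -[X in _ --> X]mul1r; apply: cvgM; [exact: ratio_lower_bound_cvg|exact: cvg_cst].
- rewrite -[X in _ --> X]mul1r; apply: cvgM; last exact: cvg_cst.
  have e0 : expR (y * 0) = 1 by rewrite mulr0 expR0.
  rewrite -[X in _ --> X]e0.
  apply: (@continuous_cvg _ _ _ _ _ _ (fun x => expR (y * x))); last exact: slope_cvg.
  apply: continuous_comp; last exact: continuous_expR.
  by apply: cvgM; [exact: cvg_cst|exact: cvg_id].
Qed.

Lemma measurable_killed_bridge_pdf u c : measurable_fun setT (killed_bridge_pdf u c).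
Proof.
have mg v (h : R -> R) : measurable_fun setT h -> measurable_fun setT (fun y => gauss v (h y)).
  by move=> mh; apply: (measurableT_comp (@measurable_gauss R v)).
apply: measurable_funM; last exact: measurable_cst.
by apply: measurable_funM; apply: measurable_funB; apply: mg;
  (exact: measurable_funB||exact: measurable_funD).
Qed.

Lemma continuous_excursion_pdf : continuous excursion_pdf.
Proof.
move=> y; apply: cvgM.
  apply: cvgM; last exact: cvg_cst.
  by apply: cvgM; [exact: cvg_cst|apply: cvgM; exact: cvg_id].
apply: continuous_comp; last exact: continuous_expR.
apply: continuousN; apply: cvgM; last exact: cvg_cst.
by apply: cvgM; [apply: cvgM; exact: cvg_id|exact: cvg_cst].
Qed.

(** As y <= exp y, the left-hand side is at most a multiple of
exp (4 y - k y ^+ 2), and the linear term is absorbed by half of the quadratic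
one. *)
Lemma excursion_pdf_le : exists D v : R, 0 < v /\
  forall y : R, 0 < y -> excursion_pdf y * (1 + y * expR y) <= D * gauss v y.
Proof.
pose k := t / (2 * s * (t - s)).
have k0 : 0 < k by rewrite divr_gt0 // !mulr_gt0.
pose K := Num.sqrt (2 / pi) * (t / (s * (t - s))) `^ (3 / 2).
have K0 : 0 <= K by rewrite mulr_ge0 ?sqrtr_ge0 ?powR_ge0.
pose A := Num.sqrt (k^-1 * pi *+ 2).
have A0 : A != 0.
  by rewrite gt_eqF // sqrtr_gt0 mulrn_wgt0 // mulr_gt0 ?pi_gt0 // invr_gt0.
(* 4 y - k y ^+ 2 = 8 / k - k y ^+ 2 / 2 - (k / 2) (y - 4 / k) ^+ 2 *)
exists (K * (2 * (expR (8 / k) * A))), k^-1; split => [|y y0]; first by rewrite invr_gt0.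
rewrite gaussE ?invr_gt0 // -/A.
have -> : excursion_pdf y * (1 + y * expR y) =
    K * (y ^+ 2 * (1 + y * expR y) * expR (- (k * y ^+ 2))).
  rewrite /excursion_pdf /K -(_ : y ^+ 2 * t / (2 * s * (t - s)) = k * y ^+ 2).
    by move: (Num.sqrt (2 / pi)) (_ `^ _) => p1 p2; ring.
  by rewrite /k; field; rewrite !gt_eqF.
have -> : K * (2 * (expR (8 / k) * A)) * (A^-1 * expR (- (y ^+ 2 / (k^-1 *+ 2)))) =
    K * (2 * (expR (8 / k) * expR (- (y ^+ 2 / (k^-1 *+ 2))))).
  by field.
apply: ler_wpM2l => //.
have e1 : y <= expR y by apply: le_trans (expR_ge1Dx y); lra.
have e1' : 1 <= expR y by apply: le_trans (expR_ge1Dx y); lra.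
have e2 : y ^+ 2 * (1 + y * expR y) <= 2 * expR (4 * y).
  have -> : expR (4 * y) = expR y ^+ 2 * expR y ^+ 2 by rewrite -exprD expRM_natl.
  rewrite mulrCA; apply: ler_pM.
  - exact: sqr_ge0.
  - by rewrite addr_ge0 // mulr_ge0 ?expR_ge0 // ltW.
  - by rewrite lerXn2r ?nnegrE ?expR_ge0 // ltW.
  - have h1 : 1 <= expR y ^+ 2 by rewrite exprn_ege1.
    have h2 : y * expR y <= expR y ^+ 2 by rewrite expr2 ler_wpM2r ?expR_ge0.
    by lra.
apply: le_trans (_ : 2 * expR (4 * y) * expR (- (k * y ^+ 2)) <= _).
  by rewrite ler_wpM2r ?expR_ge0.
rewrite -mulrA ler_wpM2l // -!expRD ler_expR mulr2n -subr_ge0.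
have -> : 8 / k - y ^+ 2 / (k^-1 + k^-1) - (4 * y - k * y ^+ 2) =
    k / 2 * (y - 4 / k) ^+ 2 by field; rewrite !gt_eqF // addr_gt0 ?invr_gt0.
by rewrite mulr_ge0 ?sqr_ge0 // divr_ge0 // ltW.
Qed.

Let W (y : measurableTypeR R) : R := excursion_pdf y * (1 + y * expR y).

Let mI : measurable (`]0%R, +oo[%classic : set (measurableTypeR R)).
Proof. exact: measurable_itv. Qed.

Let inI (y : R) : `]0%R, +oo[%classic y -> 0 < y.
Proof. by rewrite /= in_itv /= andbT. Qed.

Let mW : measurable_fun setT W.
Proof.
apply: measurable_funM; first exact: continuous_measurable_fun continuous_excursion_pdf.
by apply: measurable_funD => //; apply: measurable_funM.
Qed.

Let W_ge0 (y : R) : 0 < y -> excursion_pdf y <= W y.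
Proof.
move=> y0; rewrite /W ler_peMr ?excursion_pdf_ge0 // lerDl mulr_ge0 ?expR_ge0 //.
exact: ltW.
Qed.

Let integrable_W : lebesgue_measure.-integrable `]0, +oo[ (EFin \o W).
Proof.
have [D [v [v0 DW]]] := excursion_pdf_le.
have ig : lebesgue_measure.-integrable `]0, +oo[
    (fun y : measurableTypeR R => (D%:E * (gauss v (y - 0))%:E)%E).
  apply: integrableZl => //.
  exact: (integrableS measurableT mI (@subsetT _ _) (integrable_gauss 0 v0)).
apply: (le_integrable mI _ _ ig).
  by apply/measurable_EFinP; exact: measurable_funTS.
move=> y /inI y0 /=; rewrite lee_fin subr0 ger0_norm.
  by apply: le_trans (ler_norm _); exact: DW.
exact: le_trans (excursion_pdf_ge0 y) (W_ge0 y0).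
Qed.

Let integrable_le (h : R -> R) (M : R) : measurable_fun setT h ->
  (forall y, 0 < y -> `|h y| <= M * W y) ->
  lebesgue_measure.-integrable `]0, +oo[ (EFin \o (h : measurableTypeR R -> R)).
Proof.
move=> mh hM.
have iMW : lebesgue_measure.-integrable `]0, +oo[
    (fun y : measurableTypeR R => (M%:E * (W y)%:E)%E).
  exact: integrableZl.
apply: (le_integrable mI _ _ iMW); first by apply/measurable_EFinP; exact: measurable_funTS.
move=> y /inI y0 /=; rewrite lee_fin; apply: le_trans (ler_norm _); exact: hM.
Qed.

Definition pdf_error (u c : R) := 1 - ratio_lower_bound u c + (u / s + c / (t - s)).

Lemma killed_bridge_pdf_error (u c y : R) : 0 < u -> 0 < c -> 0 < y ->
  u / s + c / (t - s) <= 1 ->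
  `|killed_bridge_pdf u c y - excursion_pdf y| <= pdf_error u c * W y.
Proof.
move=> u0 c0 y0; set e := u / s + c / (t - s) => e1.
have e0 : 0 <= e by rewrite addr_ge0 // divr_ge0 // ltW.
have h1 := killed_bridge_pdf_ge u0 c0 y0; have h2 := killed_bridge_pdf_le u0 c0 y0.
have L1 := ratio_lower_bound_le1 u0 c0; have q0 := excursion_pdf_ge0 y.
have ye : expR (y * e) <= 1 + e * (y * expR y).
  have h : expR (y * e) - 1 <= y * e * expR (y * e).
    have h3 : 1 - y * e <= expR (- (y * e)) by apply: le_trans (expR_ge1Dx _); lra.
    have h4 : expR (y * e) * (1 - y * e) <= expR (y * e) * expR (- (y * e)).
      by rewrite ler_wpM2l ?expR_ge0.
    by move: h4; rewrite expRxMexpNx_1 mulrBr mulr1 [_ * (y * e)]mulrC; lra.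
  rewrite -lerBlDl; apply: (le_trans h); rewrite [y * e]mulrC -mulrA.
  rewrite ler_wpM2l // ler_wpM2l ?(ltW y0) // ler_expR -[leRHS]mul1r.
  by rewrite ler_wpM2r // ltW.
have ye0 : 0 <= y * expR y by rewrite mulr_ge0 ?expR_ge0 // ltW.
have eL : 0 <= e * (y * expR y) by rewrite mulr_ge0.
have Le : 0 <= (1 - ratio_lower_bound u c) * (y * expR y) by rewrite mulr_ge0 // subr_ge0.
rewrite -/e in h2; rewrite /pdf_error -/e /W mulrCA.
apply: (@le_trans _ _ (excursion_pdf y * (1 - ratio_lower_bound u c + e * (y * expR y)))); last first.
  by apply: ler_wpM2l => //; move: (ratio_lower_bound u c) e0 Le eL => l e0; lra.
rewrite ler_norml; apply/andP; split.
  rewrite lerNl opprB; apply: (@le_trans _ _ (excursion_pdf y * (1 - ratio_lower_bound u c))).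
    by rewrite mulrBr mulr1 lerD2l lerN2 mulrC.
  by rewrite ler_wpM2l // lerDl.
rewrite lerBlDl -[X in X + _]mulr1 -mulrDr; apply: (le_trans h2); rewrite mulrC.
by rewrite ler_wpM2l //; lra.
Qed.

(** The distance between the two integrals is at most the error pdf_error times a
fixed finite integral. *)
Lemma killed_bridge_pdf_weak (g : R -> R) (M : R) : measurable_fun setT g ->
  (forall x, `|g x| <= M) ->
  \int[lebesgue_measure]_(y in `]0, +oo[) (g y * killed_bridge_pdf uc.1 uc.2 y)
    @[uc --> ((0 : R)^'+, (0 : R)^'+)] -->
  \int[lebesgue_measure]_(y in `]0, +oo[) (g y * excursion_pdf y).
Proof.
move=> mg gM; have M0 : 0 <= M by exact: le_trans (gM 0).
set I0 := (X in _ --> X).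
pose IW := \int[lebesgue_measure]_(y in `]0, +oo[) W y.
have mq : measurable_fun setT excursion_pdf.
  exact: continuous_measurable_fun continuous_excursion_pdf.
have int_q : lebesgue_measure.-integrable `]0, +oo[
    (EFin \o (fun y : measurableTypeR R => g y * excursion_pdf y)).
  apply: (integrable_le (M := M)); first exact: measurable_funM.
  move=> y y0; rewrite normrM; apply: ler_pM => //.
  by rewrite ger0_norm ?W_ge0 // excursion_pdf_ge0.
have key u c : 0 < u -> 0 < c -> u / s + c / (t - s) <= 1 ->
    `|\int[lebesgue_measure]_(y in `]0, +oo[) (g y * killed_bridge_pdf u c y) - I0| <=
    M * pdf_error u c * IW.
  move=> u0 c0 e1; have mf := measurable_killed_bridge_pdf u c.
  have err y (y0 : 0 < y) := killed_bridge_pdf_error u0 c0 y0 e1.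
  have int_f : lebesgue_measure.-integrable `]0, +oo[
      (EFin \o (fun y : measurableTypeR R => g y * killed_bridge_pdf u c y)).
    apply: (integrable_le (M := M * (1 + pdf_error u c))); first exact: measurable_funM.
    move=> y y0; rewrite normrM -mulrA; apply: ler_pM => //.
    rewrite -[killed_bridge_pdf u c y](subrK (excursion_pdf y)).
    apply: le_trans (ler_normD _ _) _; rewrite addrC mulrDl mul1r; apply: lerD.
      by rewrite ger0_norm ?W_ge0 // excursion_pdf_ge0.
    exact: err.
  rewrite /I0 -RintegralB //.
  have int_d : lebesgue_measure.-integrable `]0, +oo[ (EFin \o (fun y : measurableTypeR R =>
      g y * killed_bridge_pdf u c y - g y * excursion_pdf y)).
    exact: (integrableB mI int_f int_q).
  apply: le_trans (le_normr_Rintegral mI int_d) _.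
  rewrite /IW -RintegralZl //; apply: le_Rintegral => //.
  - exact: (integrable_norm int_d).
  - exact: (integrableZl mI _ integrable_W).
  - move=> y /inI y0; rewrite -mulrBr normrM -mulrA; apply: ler_pM => //.
    exact: err.
have ev : pdf_error uc.1 uc.2 @[uc --> ((0 : R)^'+, (0 : R)^'+)] --> (0 : R).
  have e0 : (1 - 1 + 0 : R) = 0 by rewrite subrr addr0.
  rewrite -[X in _ --> X]e0; apply: cvgD; last exact: slope_cvg.
  by apply: cvgB; [exact: cvg_cst|exact: ratio_lower_bound_cvg].
have ev' : M * pdf_error uc.1 uc.2 * IW @[uc --> ((0 : R)^'+, (0 : R)^'+)] --> (0 : R).
  have e0 : M * 0 * IW = 0 by rewrite mulr0 mul0r.
  rewrite -[X in _ --> X]e0; apply: cvgM; last exact: cvg_cst.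
  by apply: cvgM; [exact: cvg_cst|exact: ev].
have ltI0 : \forall uc \near ((0 : R)^'+, (0 : R)^'+),
    I0 - M * pdf_error uc.1 uc.2 * IW <=
    \int[lebesgue_measure]_(y in `]0, +oo[) (g y * killed_bridge_pdf uc.1 uc.2 y) <=
    I0 + M * pdf_error uc.1 uc.2 * IW.
  have le1 : \forall uc \near ((0 : R)^'+, (0 : R)^'+), uc.1 / s + uc.2 / (t - s) <= 1.
    by have := slope_cvg => /cvgr_le; apply; exact: ltr01.
  apply: filterS2 (near_endpoints ltr01) le1 => -[u c] /= [/andP[u0 _] /andP[c0 _]] e1.
  have := key u c u0 c0 e1; rewrite ler_norml => /andP[h1 h2].
  by apply/andP; split; move: h1 h2; set J := Rintegral _ _ _; lra.
apply: (squeeze_cvgr ltI0).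
- rewrite -[X in _ --> X]subr0; apply: cvgB; [exact: cvg_cst|exact: ev'].
- rewrite -[X in _ --> X]addr0; apply: cvgD; [exact: cvg_cst|exact: ev'].
Qed.

End asymptotics.

(** * The bridge conditioned to stay positive *)

Lemma killed_gauss_gt0 (R : realType) (v x y : R) : 0 < v -> 0 < x -> 0 < y ->
  0 < killed_gauss v x y.
Proof.
move=> v0 x0 y0; have xy0 : 0 < x * y / v by rewrite divr_gt0 // mulr_gt0.
rewrite killed_gaussE //; apply: mulr_gt0; last first.
  exact: (mulr_gt0 (mulr_gt0 (ltr0n _ 2) xy0) (sinhc_gt0 xy0)).
apply: mulr_gt0 (expR_gt0 _).
by rewrite invr_gt0 sqrtr_gt0 mulrn_wgt0 // mulr_gt0 // pi_gt0.
Qed.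

Section bridge_conditioned.
Context (R : realType) d (T : measurableType d) (P : probability T R).
Context (Y : R -> T -> R) (bm : clean_bm P Y).
Context (s t : R) (s0 : 0 < s) (st : s < t).
Context (u c : R) (u0 : 0 < u) (c0 : 0 < c).

Let t0 : 0 < t. Proof. exact: lt_trans st. Qed.
Let ts0 : 0 < t - s. Proof. by rewrite subr_gt0. Qed.
Let Q := bridge_pker bm t u c.
Let mpos := measurable_positive_paths t0.
Let s_itv : 0 <= s <= t. Proof. by rewrite !ltW. Qed.
Let g := gauss t (c - u).
Let g0 : 0 < g. Proof. exact: gauss_gt0. Qed.
Let Z := killed_gauss t u c / g.
Let Z0 : 0 < Z. Proof. by rewrite divr_gt0 // killed_gauss_gt0. Qed.
Let kk y := killed_gauss s u y * killed_gauss (t - s) y c / g.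

Lemma fine_bridge_positive : fine (Q (positive_paths t)) = Z.
Proof. by rewrite /Z -(bridge_positive bm u0 s0 st c0) mulfK // gt_eqF. Qed.

Lemma bridge_positive_gt0 : (0 < Q (positive_paths t))%E.
Proof.
rewrite -[X in (_ < X)%E](@fineK _ (Q (positive_paths t))); last exact: kernel_fin.
by rewrite fine_bridge_positive lte_fin.
Qed.

Let kk_pdf y : Z^-1 * kk y = killed_bridge_pdf s t u c y.
Proof.
rewrite /Z /kk /killed_bridge_pdf; field.
by rewrite (gt_eqF g0) gt_eqF // killed_gauss_gt0.
Qed.

Let kk_ge0 y : 0 < y -> 0 <= kk y.
Proof.
by move=> y0; rewrite /kk divr_ge0 ?(ltW g0) // mulr_ge0 // killed_gauss_ge0 // ltW.
Qed.

Let mkk : measurable_fun setT kk.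
Proof.
rewrite (_ : kk = (fun y => Z * killed_bridge_pdf s t u c y)).
  by apply: measurable_funM => //; exact: measurable_killed_bridge_pdf.
by apply/funext => y; rewrite -kk_pdf mulrA divff ?mul1r // gt_eqF.
Qed.

Let mev : measurable_fun setT (fun w : path_space t => w s : measurableTypeR R).
Proof. exact: measurable_evaluation. Qed.

Let inI (y : R) : `]0%R, +oo[%classic y -> 0 < y.
Proof. by rewrite /= in_itv /= andbT. Qed.

Let mI : measurable (`]0%R, +oo[%classic : set (measurableTypeR R)).
Proof. exact: measurable_itv. Qed.

Lemma bridge_density_given_positive :
  density_given_positive Q s (killed_bridge_pdf s t u c).
Proof.
split.
- by move=> y y0; rewrite -kk_pdf mulr_ge0 ?kk_ge0 // invr_ge0 ltW.
- move=> y y0; apply: cvgM; last exact: cvg_cst.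
  apply: cvgM; first exact: continuous_killed_gauss.
  rewrite (_ : killed_gauss (t - s) ^~ c = killed_gauss (t - s) c).
    by rewrite (killed_gaussC y c ts0); exact: continuous_killed_gauss.
  by apply/funext => x; exact: killed_gaussC.
- move=> E mE; rewrite /prob_given_positive fine_bridge_positive mulrC EFinM.
  have mA : measurable ([set w : path_space t | E (w s)] `&` positive_paths t).
    by apply: measurableI => //; have := measurable_evaluation s_itv measurableT mE; rewrite setTI.
  rewrite fineK; last exact: kernel_fin.
  rewrite bridge_positive_law // -ge0_integralZl //.
  + by apply: eq_integral => y _; rewrite -EFinM kk_pdf.
  + by apply: measurableI.
  + by apply/measurable_EFinP; exact: measurable_funTS.
  + by move=> y [_ /inI y0]; rewrite lee_fin kk_ge0.
  + by rewrite lee_fin invr_ge0 ltW.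
Qed.

Lemma ge0_integral_bridge_positive (G : R -> \bar R) : measurable_fun setT G ->
  (forall x, (0 <= G x)%E) ->
  (\int[Q]_(w in positive_paths t) G (w s) =
   \int[lebesgue_measure]_(y in `]0%R, +oo[) (G y * (kk y)%:E))%E.
Proof.
move=> mG G0.
have mGs : measurable_fun setT (fun w : path_space t => G (w s)).
  by apply: (measurableT_comp mG); exact: measurable_evaluation.
pose nu := mrestr Q mpos.
have nuE (A : set (path_space t)) : measurable A ->
    nu A = (\int[Q]_(w in A) (\1_(positive_paths t) w)%:E)%E.
  by move=> mA; rewrite integral_indic // setIC.
have := @ge0_integral_density R _ _ Q nu (\1_(positive_paths t)) _ _ nuE (fun w => G (w s)) _ mGs.
move=> H; transitivity (\int[nu]_w G (w s))%E.
  rewrite (integral_indicl Q (positive_paths t)) H //; first by apply: eq_integral => w _; rewrite muleC.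
pose m1 : {measure set (measurableTypeR R) -> \bar R} := image_measure nu mev.
pose h (y : measurableTypeR R) : R := \1_(`]0%R, +oo[%classic : set R) y * kk y.
have h0 y : 0 <= h y.
  rewrite /h indicE; case: (boolP (y \in _)) => [|_]; last by rewrite mul0r.
  by rewrite inE => /inI y0; rewrite mul1r kk_ge0.
have mh : measurable_fun setT h by apply: measurable_funM => //; exact: measurable_indic.
transitivity (\int[m1]_y G y)%E.
  by rewrite ge0_integral_pushforward // preimage_setT.
rewrite (@ge0_integral_density R _ _ lebesgue_measure m1 h h0 mh) //.
  rewrite [RHS]integral_indicl; apply: eq_integral => y _.
  by rewrite /h EFinM muleCA.
move=> A mA; rewrite [LHS](bridge_positive_law bm u0 s0 st c0 (E := A)) //.
rewrite (integral_indicl lebesgue_measure (A `&` _)) (integral_indicl lebesgue_measure A).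
by apply: eq_integral => y _; rewrite indicI /= EFinM -muleA.
Qed.

(** Positive and negative parts are handled separately, so that integrability is
not an issue. *)
Lemma integral_bridge_positive (G : R -> R) : measurable_fun setT G ->
  (\int[Q]_(w in positive_paths t) (G (w s))%:E =
   \int[lebesgue_measure]_(y in `]0%R, +oo[) (G y * kk y)%:E)%E.
Proof.
move=> mG; rewrite integralE [RHS]integralE.
have mEG : measurable_fun setT (EFin \o G) by exact/measurable_EFinP.
congr (_ - _)%E.
- transitivity (\int[Q]_(w in positive_paths t) ((EFin \o G)^\+ (w s)))%E.
    by apply: eq_integral => w _; rewrite !funeposE.
  rewrite ge0_integral_bridge_positive //; last exact: measurable_funepos.
  apply: eq_integral => y; rewrite inE => /inI y0.
  rewrite !funeposE /= -!EFin_max -EFinM; congr (_%:E).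
  by rewrite maxr_pMl ?mul0r ?kk_ge0.
- transitivity (\int[Q]_(w in positive_paths t) ((EFin \o G)^\- (w s)))%E.
    by apply: eq_integral => w _; rewrite !funenegE.
  rewrite ge0_integral_bridge_positive //; last exact: measurable_funeneg.
  apply: eq_integral => y; rewrite inE => /inI y0.
  rewrite !funenegE /= -!EFin_max -EFinM; congr (_%:E).
  by rewrite maxr_pMl ?mul0r ?mulNr ?kk_ge0.
Qed.

(** The law at time s on the positive paths has density kk, and dividing by its
mass Z turns kk into the normalized density. *)
Lemma bridge_mean_given_positive (G : R -> R) (M : R) : measurable_fun setT G ->
  (forall x, `|G x| <= M) ->
  mean_given_positive Q (fun w => G (w s)) =
  \int[lebesgue_measure]_(y in `]0, +oo[) (G y * killed_bridge_pdf s t u c y).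
Proof.
move=> mG GM; rewrite /mean_given_positive fine_bridge_positive mulrC -RintegralZl //.
  rewrite /Rintegral; congr fine.
  rewrite (@integral_bridge_positive (fun x => Z^-1 * G x)); last exact: measurable_funM.
  by apply: eq_integral => y _; rewrite mulrAC kk_pdf mulrC.
apply: (integrableS measurableT) => //.
apply: (@bounded_integrable _ _ _ _ _ M) => //; first exact: kernel_lty.
by apply: (measurableT_comp mG); exact: measurable_evaluation.
Qed.

End bridge_conditioned.

(** Where two continuous densities differ, they differ strictly on an interval. *)
Lemma continuous_density_unique (R : realType) (f1 f2 : R -> R) :
  (forall y, 0 < y -> 0 <= f1 y) -> (forall y, 0 < y -> 0 <= f2 y) ->
  (forall y, 0 < y -> {for y, continuous f1}) ->
  (forall y, 0 < y -> {for y, continuous f2}) ->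
  (forall E : set R, measurable E ->
    (\int[lebesgue_measure]_(y in E `&` `]0%R, +oo[) (f1 y)%:E =
     \int[lebesgue_measure]_(y in E `&` `]0%R, +oo[) (f2 y)%:E)%E) ->
  forall y, 0 < y -> f1 y = f2 y.
Proof.
have H (h1 h2 : R -> R) : (forall y, 0 < y -> 0 <= h1 y) ->
    (forall y, 0 < y -> {for y, continuous h1}) ->
    (forall y, 0 < y -> {for y, continuous h2}) ->
    (forall E : set R, measurable E ->
      (\int[lebesgue_measure]_(y in E `&` `]0%R, +oo[) (h1 y)%:E =
       \int[lebesgue_measure]_(y in E `&` `]0%R, +oo[) (h2 y)%:E)%E) ->
    forall y, 0 < y -> h2 y <= h1 y.
  move=> h10 c1 c2 h12 y0 y00; rewrite leNgt; apply/negP => lt12.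
  pose mid := (h1 y0 + h2 y0) / 2; pose de := (h2 y0 - h1 y0) / 4.
  have de0 : 0 < de by rewrite /de; lra.
  have n1 : \forall y \near y0, h1 y < mid - de.
    by have := c1 y0 y00 => /cvgr_lt; apply; rewrite /mid /de; lra.
  have n2 : \forall y \near y0, mid + de < h2 y.
    by have := c2 y0 y00 => /cvgr_gt; apply; rewrite /mid /de; lra.
  have [r /= r0 yr] : nbhs_ball y0 [set y | h1 y < mid - de /\ mid + de < h2 y].
    by apply/nbhs_ballP; near=> y; split; near: y.
  have Iyr y : y0 < y <= y0 + r / 2 -> h1 y < mid - de /\ mid + de < h2 y.
    move=> /andP[y1 y2]; apply: yr.
    by rewrite /ball /= ltr_distlC; apply/andP; split; lra.
  have lt1 : y0 < y0 + r / 2 by rewrite ltrDl divr_gt0.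
  have pq : mid - de < mid + de by lra.
  have subI : `]y0, y0 + r / 2]%classic `<=` `]0, +oo[%classic.
    by move=> y /=; rewrite !in_itv /= andbT => /andP[y1 _]; exact: lt_trans y1.
  have mh (h : R -> R) : (forall y, 0 < y -> {for y, continuous h}) ->
      measurable_fun `]y0, y0 + r / 2] h.
    move=> ch; apply: (measurable_funS _ subI) => //.
    apply: open_continuous_measurable_fun; first exact: interval_open.
    by move=> y; rewrite inE /= in_itv /= andbT => yy0; exact: ch.
  have := @integral_itv_lt R h1 h2 y0 (y0 + r / 2) _ _ lt1 pq (mh _ c1) (mh _ c2) _ _.
  have := h12 _ (measurable_itv `]y0, y0 + r / 2]).
  rewrite (setIidl subI) => ->; rewrite ltxx => F; apply: notF; apply: F.
  - move=> y yI; have [/ltW -> _] := Iyr y yI; rewrite andbT h10 //.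
    by have /andP[y1 _] := yI; exact: lt_trans y1.
  - by move=> y yI; have [_ /ltW] := Iyr y yI.
move=> f10 f20 c1 c2 E y y0; apply/eqP; rewrite eq_le; apply/andP; split.
  by apply: (H f2 f1) => // A mA; rewrite E.
exact: (H f1 f2).
Unshelve. all: by end_near.
Qed.

(** * The excursion density *)

Section excursion.
Context (R : realType) d (T : measurableType d) (P : probability T R).
Context (Y : R -> T -> R) (bm : clean_bm P Y) (X : R -> {RV P >-> R}) (mu : R).
Context (XY : forall z, 0 <= z -> {ae P, forall o, X z o = mu * z + Y z o}).
Context (s t : R) (s0 : 0 < s) (st : s < t).

Let t0 : 0 < t. Proof. exact: lt_trans st. Qed.

(** The value at time t is Gaussian, and a Gaussian density is bounded below on
bounded intervals. *)
Lemma started_at_charges u (a b : R) : a < b ->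
  (0 < distribution P (started_at u X t) `]a, b[%classic)%E.
Proof.
move=> ab; pose v := u + mu * t.
have mab := measurable_itv `]a, b[.
have SX : {ae P, forall o, started_at u X t o = v + Y t o}.
  by apply: filterS (XY (ltW t0)) => o /= Xo; rewrite /v -addrA -Xo.
have -> : distribution P (started_at u X t) `]a, b[%classic =
    P [set o | `]a, b[%classic (v + Y t o)].
  apply: (@measure_ae_eq _ _ T P (started_at u X t @^-1` `]a, b[)
    [set o | `]a, b[%classic (v + Y t o)]).
  - by rewrite -[X in measurable X]setTI; exact: (measurable_funPT (started_at u X t)).
  - exact: (event_V bm v t mab).
  - by apply: filterS SX => o /= ->.
rewrite (V_law bm v t0 mab).
pose m := Num.max `|a - v| `|b - v|.
have gm y : a < y < b -> gauss t m <= gauss t (y - v).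
  move=> /andP[ay yb]; apply: gauss_le => //.
  rewrite [leRHS]ger0_norm; last by rewrite le_max normr_ge0.
  rewrite le_max; have [yv|vy] := leP v y; apply/orP; [right|left].
    by rewrite !ger0_norm; lra.
  by rewrite !ltr0_norm; lra.
apply: (@lt_le_trans _ _ (\int[lebesgue_measure]_(y in `]a, b[) (gauss t m)%:E)%E).
  rewrite integral_cst //= lebesgue_measure_itv /= lte_fin ab -EFinB -EFinM lte_fin.
  by rewrite mulr_gt0 ?gauss_gt0 // subr_gt0.
apply: ge0_le_integral => //.
- by move=> y _; rewrite lee_fin gauss_ge0.
- apply/measurable_EFinP; apply: measurable_funTS.
  by apply: (measurableT_comp (@measurable_gauss R _)); exact: measurable_funB.
Qed.

(** All bridge laws are the tilted bridges, whose conditioned densities are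
explicit, whatever the drift. *)
Lemma clean_excursion_density : excursion_density X t s (excursion_pdf s t).
Proof.
pose Q0 u := bridge_pker bm t u.
have Q0law u : bridge_law (started_at u X) (Q0 u) by exact: (bridge_pker_law bm t0 u XY).
split; first by exists Q0.
move=> Q Qlaw.
have QE u c A : 0 < u -> measurable A -> Q u c A = Q0 u c A.
  move=> u0 mA; exact: (@bridge_law_unique _ _ _ P (started_at u X) t (ltW t0)
    (@started_at_charges u) (Q u) (Q0 u) c A (Qlaw u u0) (Q0law u) mA).
have mpos := measurable_positive_paths t0.
have s_itv : 0 <= s <= t by rewrite !ltW.
have densE u c f : 0 < u -> density_given_positive (Q u c) s f <-> density_given_positive (Q0 u c) s f.
  move=> u0; have E (A : set R) : measurable A ->
      prob_given_positive (Q u c) [set w | A (w s)] = prob_given_positive (Q0 u c) [set w | A (w s)].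
    move=> mA; rewrite /prob_given_positive !QE //; apply: measurableI => //.
    by have := measurable_evaluation s_itv measurableT mA; rewrite setTI.
  by split=> -[f0 cf fE]; split=> // A mA; rewrite -fE // E.
have dens u c : 0 < u -> 0 < c -> density_given_positive (Q u c) s (killed_bridge_pdf s t u c).
  by move=> u0 c0; apply/densE => //; exact: bridge_density_given_positive.
split.
- move=> u c u0 c0; rewrite QE //; exact: (bridge_positive_gt0 bm s0 st).
- by exists (killed_bridge_pdf s t).
- move=> f fdens y y0.
  apply: cvg_trans (killed_bridge_pdf_cvg s0 st y0); apply: near_eq_cvg.
  apply: filterS (near_endpoints ltr01) => -[u c] /= [/andP[u0 _] /andP[c0 _]].
  have [h0 hc hE] := dens u c u0 c0; have [f0 fc fE] := fdens u c u0 c0.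
  by apply: continuous_density_unique => // E mE; rewrite -hE // -fE.
- move=> g cg [M gM]; have mg := continuous_measurable_fun cg.
  apply: cvg_trans (killed_bridge_pdf_weak s0 st mg gM); apply: near_eq_cvg.
  apply: filterS (near_endpoints ltr01) => -[u c] /= [/andP[u0 _] /andP[c0 _]].
  rewrite -(bridge_mean_given_positive bm s0 st u0 c0 mg gM) /mean_given_positive QE //.
  congr (_ / _); rewrite /Rintegral; congr fine; apply: eq_measure_integral => A mA _.
  by rewrite QE.
Qed.

End excursion.

Section clean_version.
Context (R : realType) d (T : measurableType d) (P : probability T R).
Context (B : R -> {RV P >-> R}) (bmB : standard_brownian_motion B).

Lemma brownian_good_set : exists G : set T, [/\ measurable G, P (~` G) = 0%E,
  forall o, G o -> B 0 o = 0 &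
  forall o, G o -> {within `[0, +oo[, continuous (fun z => B z o)}].
Proof.
case: bmB => [[N0 [mN0 PN0 sN0]] _ _ [N1 [mN1 PN1 sN1]]].
exists (~` (N0 `|` N1)); split.
- by apply: measurableC; exact: measurableU.
- rewrite setCK; apply/eqP; rewrite eq_le measure_ge0 andbT.
  by apply: (le_trans (measureU2 _ mN0 mN1)); rewrite [X in (X + _)%E]PN0 [X in (_ + X)%E]PN1 adde0.
- by move=> o /not_orP[nN0 _]; apply: contrapT => h; exact/nN0/sN0.
- by move=> o /not_orP[_ nN1]; apply: contrapT => h; exact/nN1/sN1.
Qed.

(** Set the process to 0 off the set of good outcomes, and freeze it at its value
at 0 for negative times. *)
Lemma clean_version : exists2 Y : R -> T -> R, clean_bm P Y &
  forall z, 0 <= z -> {ae P, forall o, B z o = Y z o}.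
Proof.
have [G [mG PG B0 cB]] := brownian_good_set.
have [_ law incr _] := bmB.
pose Y z o := \1_G o * B (Num.max z 0) o.
have YG z o : G o -> Y z o = B (Num.max z 0) o.
  by move=> Go; rewrite /Y indicE mem_set // mul1r.
have YN z o : ~ G o -> Y z o = 0.
  by move=> Go; rewrite /Y indicE memNset // mul0r.
have aeG : {ae P, forall o, G o} by exists (~` G); split => //; exact: measurableC.
have mB z : measurable_fun setT (B z) by exact: measurable_funPT.
have mY z : measurable_fun setT (Y z).
  by apply: measurable_funM => //; exact: measurable_indic.
have YB z o : 0 <= z -> G o -> Y z o = B z o.
  by move=> z0 Go; rewrite YG // max_l.
have mYY a b (E : set R) : measurable E -> measurable [set o | E (Y b o - Y a o)].
  move=> mE; have mD : measurable_fun setT (fun o => Y b o - Y a o) by exact: measurable_funB.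
  by have := mD measurableT E mE; rewrite setTI.
have mBB a b (E : set R) : measurable E -> measurable [set o | E (B b o - B a o)].
  move=> mE; have mD : measurable_fun setT (fun o => B b o - B a o) by exact: measurable_funB.
  by have := mD measurableT E mE; rewrite setTI.
have incrE a b (E : set R) : 0 <= a -> 0 <= b -> measurable E ->
    P [set o | E (Y b o - Y a o)] = P [set o | E (B b o - B a o)].
  move=> a0 b0 mE; apply: measure_ae_eq; [exact: mYY|exact: mBB|].
  by apply: filterS aeG => o Go /=; rewrite !YB.
exists Y; last by move=> z z0; apply: filterS aeG => o Go; rewrite YB.
split => //.
- move=> o; have [Go|nGo] := pselect (G o); last by rewrite YN.
  by rewrite YG // maxxx B0.
- move=> o; have [Go|nGo] := pselect (G o); last first.
    by rewrite (_ : Y ^~ o = cst 0); [move=> z; exact: cvg_cst|apply/funext => z; rewrite YN].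
  rewrite (_ : Y ^~ o = (fun z => B (Num.max z 0) o)); last by apply/funext => z; rewrite YG.
  move=> x A.
  have mx : `[0, +oo[%classic (Num.max x 0) by rewrite /= in_itv /= andbT le_max lexx orbT.
  have /subspace_continuousP /(_ _ mx) cBx := cB o Go.
  move=> /cBx HA'.
  have HA : \forall y \near Num.max x 0, `[0, +oo[%classic y -> A (B y o) := HA'.
  have cmax : {for x, continuous (fun z : R => Num.max z 0)}.
    by apply: (@continuous_max R R id (cst 0) x); [exact: cvg_id|exact: cvg_cst].
  have : \forall z \near x, `[0, +oo[%classic (Num.max z 0) -> A (B (Num.max z 0) o).
    exact: (cmax _ HA).
  apply: filterS => z; apply.
  by rewrite /= in_itv /= andbT le_max lexx orbT.
- by move=> a b a0 ab E mE; rewrite incrE ?law // (le_trans a0) // ltW.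
- move=> n z z0 zh E mE.
  have z0' i : 0 <= z i by apply: (le_trans z0); exact: zh.
  transitivity (P [set o | forall i : 'I_n, E i (B (z i.+1) o - B (z i) o)]); last first.
    rewrite (incr n z z0 zh (fun i : 'I_n => E i) (fun i => mE i)).
    by apply: eq_bigr => i _; rewrite incrE.
  apply: measure_ae_eq.
  + rewrite cylinder_bigcap; apply: bigsetI_measurable => i _; exact: mYY.
  + rewrite (_ : [set o | _] = cylinder (fun i o => B (z i.+1) o - B (z i) o) n id E).
      by rewrite cylinder_bigcap; apply: bigsetI_measurable => i _; exact: mBB.
    apply/seteqP; split=> o H; first by move=> i ii; exact: (H (Ordinal ii)).
    by move=> i; exact: (H i (ltn_ord i)).
  + apply: filterS aeG => o Go; split=> H.
      by move=> i; have := H i (ltn_ord i); rewrite /= !YB.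
    by move=> i ii /=; rewrite !YB //; exact: (H (Ordinal ii)).
Qed.

End clean_version.

Theorem mainTheorem10 (R : realType) (d : measure_display)
    (T : measurableType d) (P : probability T R) (B : R -> {RV P >-> R})
    (mu s t : R) :
  standard_brownian_motion B -> 0 < s -> s < t ->
  let q := fun y : R =>
    Num.sqrt (2 / pi) * y ^+ 2 * (t / (s * (t - s))) `^ (3 / 2) *
    expR (- (y ^+ 2 * t / (2 * s * (t - s)))) in
  excursion_density (drifted B mu) t s q /\ excursion_density B t s q.
Proof.
move=> bmB s0 st q; have [Y bm BY] := clean_version bmB.
split.
- apply: (clean_excursion_density bm (mu := mu) _ s0 st) => z z0.
  by apply: filterS (BY z z0) => o /= <-; rewrite addrC.
- apply: (clean_excursion_density bm (mu := 0) _ s0 st) => z z0.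
  by apply: filterS (BY z z0) => o <-; rewrite mul0r add0r.
Qed.
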